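(* Let $\nu>0$ and let $j\in\mathbb{N}$ be fixed. Then $$\mu_{j,n}(\nu)=\frac{1}{4n^{2}}\left[1+\frac{i_{j}}{\sqrt[3]{3}}\,n^{-2/3}+o\left(n^{-2/3}\right)\right],\quad n\to\infty,$$ where $i_{1}<i_{2}<\dots$ are the positive zeros of the Airy function $$A(x):=\frac{\pi}{3}\sum_{m=0}^{\infty}\left(\frac{1}{\Gamma(m+2/3)}+\frac{x}{3\,\Gamma(m+4/3)}\right)\frac{(-x/3)^{3m}}{m!}.$$
   Context: For $n\in\mathbb{N}=\{1,2,\dots\}$ and $\nu>0$, $L_{n}(\nu)$ denotes the $n\times n$ real symmetric matrix with entries $(L_{n}(\nu))_{i,j}=\dfrac{1}{\max(i,j)+\nu}$ for $i,j=0,1,\dots,n-1$. Its eigenvalues (counted with multiplicity, in nondecreasing order) are denoted $\mu_{1,n}(\nu)\leq\mu_{2,n}(\nu)\leq\dots\leq\mu_{n,n}(\nu)$. The numbers $i_1<i_2<\dots$ are the positive zeros, listed in increasing order, of the function $A$ defined in the claim (this normalization differs from the standard function $\mathrm{Ai}$). *)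

(* Defs.v *)
From HB Require Import structures.
From mathcomp Require Import all_boot all_order all_algebra.
From mathcomp Require Import polyrcf.
From mathcomp Require Import all_classical all_reals all_analysis.

Set Implicit Arguments.
Unset Strict Implicit.
Unset Printing Implicit Defensive.

Import Order.TTheory GRing.Theory Num.Theory.
Import numFieldNormedType.Exports.

Local Open Scope classical_set_scope.
Local Open Scope ring_scope.

Definition L_matrix (R : realType) (nu : R) (n : nat) : 'M[R]_n :=
  \matrix_(i < n, j < n) ((maxn i j)%:R + nu)^-1.

(* The real eigenvalues of M in nondecreasing order, each repeated according to
   its algebraic multiplicity; for a symmetric M this list has size n. *)
Definition eigenvalues (R : rcfType) (n : nat) (M : 'M[R]_n) : seq R :=
  flatten [seq nseq (mup x (char_poly M)) x | x <- rootsR (char_poly M)].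

(* Eigenvalues are numbered from 1, so this is meaningful for 1 <= j <= n. *)
Definition mu (R : realType) (j n : nat) (nu : R) : R :=
  (eigenvalues (L_matrix nu n))`_j.-1.

(* Euler's integral; it converges for 0 < s, the only case used below. *)
Definition Gamma (R : realType) (s : R) : R :=
  \int[lebesgue_measure]_(t in `]0, +oo[) (t `^ (s - 1) * expR (- t)).

Definition airyA (R : realType) (x : R) : R :=
  pi / 3 *
  limn (series (fun m : nat =>
    ((Gamma (m%:R + 2 / 3))^-1 + x / (3 * Gamma (m%:R + 4 / 3)))
      * ((- x / 3) ^+ (3 * m) / m`!%:R))).

(* i 1 < i 2 < ... lists exactly the positive zeros of f; the value i 0 is
   irrelevant. *)
Definition lists_positive_zeros (R : realType) (f : R -> R) (i : nat -> R) :
    Prop :=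
  [/\ forall k, (0 < k)%N -> 0 < i k /\ f (i k) = 0,
      forall k l, (0 < k)%N -> (k < l)%N -> i k < i l
    & forall x, 0 < x -> f x = 0 -> exists2 k, (0 < k)%N & x = i k].

(* Main.v *)
Require Import Defs.
From HB Require Import structures.
From mathcomp Require Import all_boot all_order all_algebra.
From mathcomp Require Import polyrcf.
From mathcomp Require Import complex sesquilinear spectral.
From mathcomp Require Import all_classical all_reals all_analysis.
From mathcomp Require Import measurable_realfun.
From mathcomp Require Import ring lra zify.

Set Implicit Arguments.
Unset Strict Implicit.
Unset Printing Implicit Defensive.

Import Order.TTheory GRing.Theory Num.Theory.
Import numFieldNormedType.Exports.

Local Open Scope classical_set_scope.
Local Open Scope ring_scope.

(** Write n = N + 1.  The proof turns the claim about the eigenvalues of L_n into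
    a statement about a discretised Sturm-Liouville problem, and compares the
    latter with the Airy equation from both sides.

    Change of variables.  In terms of the signed partial sums
    r_t = (-1)^(N-t) (x_0 + ... + x_(N-t)) of a vector x, extended by r_t = 0 for
    t > N, the form of L_n is diagonal up to a shift (L_form), and for every lam
      lam x L x^T - x x^T
        = sum_(t <= N) (r_t - r_(t+1))^2 + sum_(t <= N) V_t r_t^2,
    where V_t is explicit (T_form).  Fix h by n h^3 = 24 and let
    lam = 4 n^2 (1 - h^2 xi / 12).  Then V_t is (h^2 / 3) (h t - xi) up to higher
    order for t >= 1, while V_0 has order n and thus acts as a Dirichlet
    condition at the origin.  So the right-hand side is a discretisation with
    step h of the form of - w'' + (x / 3) w = (xi / 3) w on the half-line with
    w(0) = 0, whose decaying solution is w(x) = A(xi - x).  By the min-max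
    principle (eigenvalue_lt, eigenvalue_ge) it remains to show that, for small
    h, this discrete form is negative definite on a space of dimension j if
    xi > i_j, and nonnegative on a space of codimension j - 1 if xi < i_j.

    Lower bound (eigenvalue_lower_bound).  Choose xi' slightly larger than xi,
    still below i_j.  The function f(x) = A(xi' - x) has at most j - 1 zeros in
    x >= 0.  Identify r with the piecewise linear function w with nodal values
    r_t; requiring w to vanish at these zeros costs at most j - 1 linear
    conditions.  The identity of Jacobi and Picone
      w'^2 + ((x - xi') / 3) w^2 = (w' - (f'/f) w)^2 + ((f'/f) w^2)'
    integrated over each cell (picone_cell) and summed makes the form
    nonnegative; the surplus xi' - xi > 0 pays for the discretisation error.

    Upper bound (eigenvalue_upper_of_bumps).  Let f(x) = A(i_j - x), which has
    the j nodal intervals bounded by 0 = i_j - i_j < i_j - i_(j-1) < ... <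
    i_j - i_1 and by infinity.  On each of them |f| truncated to (|f| - c)_+ gives
    a test vector, and for small c > 0 these j vectors have supports at positive
    distance, so that the form is diagonal on their span.  A summation by parts
    and the surplus xi - i_j > 0 make each of the j values negative
    (bump_exists).

    The Airy function.  Both parts use that F(y) = (3 / pi) A(- y) solves
    F'' = (y / 3) F, is positive for y >= 0, tends to 0 at +oo, and has only
    simple zeros.  Write F = P - Q, with P and Q the solutions given by the
    exponents congruent to 0 and to 1 mod 3 in the power series.  All
    coefficients of P and Q are nonnegative; log-convexity of the Gamma function
    (Gamma_two_thirds, Gamma_one_third) compares them term by term and yields
    P / Q -> 1 (ratio_bound).  As the Wronskian of F and Q is constant, F / Q
    decreases, to 0, whence F > 0 (recessive_gt0); the same constancy bounds F
    by a multiple of 1 / Q' (recessive_le), whence F -> 0 (recessive_small). *)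

(** * The sorted list of eigenvalues *)

(** In a sorted list, the k-th entry is below c exactly when more than k entries
    are; eigenvalue bounds thus become counting statements. *)
Lemma sorted_nth_lt_count (R : realDomainType) (s : seq R) (c : R) (k : nat) :
  sorted <=%O s -> (k < size s)%N ->
  (s`_k < c) = (k < count (< c)%R s)%N.
Proof.
elim: s k => //= a s IH k; rewrite (path_sortedE le_trans) => /andP[/allP ha hs].
have nc : ~~ (a < c) -> count (< c)%R s = 0%N.
  move=> hac; apply/eqP; rewrite -leqn0 leqNgt -has_count; apply/hasPn => x xs.
  by move: hac; rewrite -!leNgt => /le_trans; apply; exact: ha.
case: k => [_|k]; first by rewrite /=; case: (boolP (a < c)) => // /nc ->.
rewrite ltnS => hk /=; rewrite IH//.
by case: (boolP (a < c)) => // /nc ->.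
Qed.

Lemma mup_prod_XsubC (F : fieldType) (s : seq F) x :
  mup x (\prod_(a <- s) ('X - a%:P)) = count_mem x s.
Proof.
elim: s => [|a s IH]; first by rewrite big_nil /= mupNroot// rootC oner_eq0.
rewrite big_cons mupM ?polyXsubC_eq0 ?IH//=.
  have := mup_XsubCX 1 x a; rewrite expr1 => ->.
  by case: eqP.
by rewrite -size_poly_eq0 size_prod_XsubC.
Qed.

(** If the characteristic polynomial splits with roots d, then the sorted list of
    real roots with multiplicities is a rearrangement of d. *)
Lemma eigenvalues_split (R : rcfType) n (M : 'M[R]_n) (d : seq R) :
  char_poly M = \prod_(a <- d) ('X - a%:P) ->
  sorted <=%O (eigenvalues M) /\ perm_eq (eigenvalues M) d.
Proof.
move=> hd.
have p0 : char_poly M != 0 by rewrite monic_neq0// char_poly_monic.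
have srt : sorted <%O (rootsR (char_poly M)) by exact: sorted_roots.
split.
  rewrite /eigenvalues.
  elim: (rootsR _) srt => //= a s IH; rewrite (path_sortedE lt_trans) => /andP[/allP ha hs].
  elim: (mup a _) => [|k IHk] /=; first exact: IH.
  rewrite (path_sortedE le_trans) IHk andbT all_cat; apply/andP; split.
    by apply/allP => x; rewrite mem_nseq => /andP[_ /eqP ->].
  apply/allP => x /flattenP[t /mapP[b bs ->]]; rewrite mem_nseq => /andP[_ /eqP ->].
  by apply/ltW/ha.
apply/permP => P.
suff hc : forall x, count_mem x (eigenvalues M) = count_mem x d.
  by apply/permP; apply/allP => x _ /=; rewrite hc.
move=> x; transitivity (mup x (char_poly M)); last first.
  by rewrite hd; exact: mup_prod_XsubC.
rewrite /eigenvalues.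
have hu : uniq (rootsR (char_poly M)) by exact: (sorted_uniq lt_trans ltxx srt).
rewrite count_flatten -map_comp sumnE big_map.
under eq_bigr do rewrite /= count_nseq /=.
have [xr|xnr] := boolP (x \in rootsR (char_poly M)).
  rewrite (bigD1_seq x)//= eqxx mul1n big1 ?addn0// => y /negPf nyx.
  by rewrite nyx.
rewrite mupNroot ?big_seq ?big1// => [y yr|].
  by case: eqP => // yx; move: xnr; rewrite -yx yr.
by apply: contra xnr; rewrite -roots_on_rootsR.
Qed.

(** * Spectral decomposition of a real symmetric matrix *)

(** The value at the row vector x of the quadratic form of M. *)
Notation qform M x := ((x *m M *m x^T) 0 0).

(** The spectral theorem for normal matrices over an algebraically closed field C
    is transported to a real closed field R, embedded in C as its subfield of real
    elements. *)
Section ComplexSpectral.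
Local Open Scope sesquilinear_scope.
Variables (R : rcfType) (C : numClosedFieldType) (toC : {rmorphism R -> C}).
Hypothesis toC_le : forall a b, (toC a <= toC b) = (a <= b).
Hypothesis toC_real : forall z, z \is Num.real -> exists a, z = toC a.

Lemma toC_is_real a : toC a \is Num.real.
Proof. by rewrite realE -(rmorph0 toC) !toC_le le_total. Qed.

Lemma conj_toC a : (toC a)^* = toC a.
Proof. exact/CrealP/toC_is_real. Qed.

Lemma toC_lt a b : (toC a < toC b) = (a < b).
Proof. by rewrite !lt_def toC_le (inj_eq (fmorph_inj toC)). Qed.

Lemma mx_split m n (x : 'M[C]_(m, n)) :
  exists x1 x2 : 'M[R]_(m, n), x = map_mx toC x1 + 'i *: map_mx toC x2.
Proof.
have re z : exists a : R, 'Re z = toC a by apply: toC_real; exact: Creal_Re.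
have im z : exists a : R, 'Im z = toC a by apply: toC_real; exact: Creal_Im.
have [fre hre] := choice re; have [fim him] := choice im.
exists (map_mx fre x), (map_mx fim x).
by apply/matrixP => k l; rewrite !mxE -hre -him -Crect.
Qed.

(** The Hermitian form at x1 + i x2 is the sum of the values at x1 and x2, since
    the mixed terms cancel for symmetric M. *)
Lemma hform_split n (M : 'M[R]_n) (x1 x2 : 'rV[R]_n) : M^T = M ->
  let x := map_mx toC x1 + 'i *: map_mx toC x2 in
  (x *m map_mx toC M *m x^t*) 0 0 = toC (qform M x1 + qform M x2).
Proof.
move=> Msym x.
have -> : x^t* = map_mx toC x1^T - 'i *: map_mx toC x2^T.
  by apply/matrixP => k l; rewrite !mxE rmorphD rmorphM /= !conj_toC conjCi mulNr.
rewrite /x !mulmxDl !mulmxBr -!scalemxAl -!scalemxAr -!map_mxM.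
rewrite scalerA -expr2 sqrCi scaleN1r opprK.
have -> : x1 *m M *m x2^T = x2 *m M *m x1^T.
  apply/matrixP => k l; rewrite !ord1 -[LHS](mxE trmx_key (fun i j => (x1 *m M *m x2^T) j i)).
  by rewrite -/(trmx _) trmx_mul trmxK trmx_mul Msym mulmxA.
rewrite !mxE rmorphD.
by rewrite -!addrA; congr (_ + _); rewrite addrCA addrA addrN add0r ?addr0.
Qed.

Variables (n : nat) (M : 'M[R]_n).
Hypothesis Msym : M^T = M.

(** A real symmetric matrix is unitarily diagonalisable over C with real
    eigenvalues d, which are the roots of its characteristic polynomial over R. *)
Lemma sym_spectral : exists (P : 'M[C]_n) (d : 'I_n -> R),
  [/\ P \is unitarymx, map_mx toC M = P^t* *m diag_mx (\row_i toC (d i)) *m P &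
   char_poly M = \prod_(a <- [seq d i | i <- enum 'I_n]) ('X - a%:P)].
Proof.
set MC := map_mx toC M.
have hM : MC \is hermsymmx.
  apply/is_hermitianmxP; rewrite expr0 scale1r; apply/matrixP => i j.
  have Mij : M j i = M i j by rewrite -[in LHS]Msym mxE.
  by rewrite !mxE conj_toC Mij.
have rd : forall i, exists a, spectral_diag MC 0 i = toC a.
  by move=> i; apply: toC_real; have /mxOverP := hermitian_spectral_diag_real hM.
have [d hd] := choice rd.
have /orthomx_spectralP eqM := hermitian_normalmx hM.
have hrow : spectral_diag MC = \row_i toC (d i).
  by apply/rowP => i; rewrite mxE -hd.
exists (spectralmx MC), d.
have U := spectral_unitarymx MC.
rewrite -(invmx_unitary U) -hrow; split => //.
apply: (map_poly_inj toC); rewrite map_char_poly -/MC.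
set P := spectralmx MC; have uP : P \in unitmx := spectral_unit MC.
have -> : char_poly MC = char_poly (diag_mx (spectral_diag MC)).
  rewrite /char_poly.
  have -> : char_poly_mx MC = map_mx polyC (invmx P) *m
      char_poly_mx (diag_mx (spectral_diag MC)) *m map_mx polyC P.
    rewrite /char_poly_mx mulmxBr mulmxBl -!map_mxM -eqM; congr (_ - _).
    by rewrite mul_mx_scalar -scalemxAl -map_mxM mulVmx// map_mx1 scalemx1.
  rewrite !det_mulmx mulrAC -det_mulmx -map_mxM mulVmx// map_mx1.
  by rewrite det1 mul1r.
rewrite char_poly_trig ?diag_mx_is_trig// rmorph_prod /= big_map big_enum /=.
by apply: eq_bigr => i _; rewrite map_polyXsubC mxE eqxx mulr1n -hd.
Qed.

Lemma sqnormE (x : 'rV[C]_n) : (x *m x^t*) 0 0 = \sum_i `|x 0 i| ^+ 2.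
Proof. by rewrite mxE; apply: eq_bigr => i _; rewrite !mxE normCK. Qed.

Lemma hform_diag (P : 'M[C]_n) (d : 'I_n -> R) (y : 'rV[C]_n) :
  P \is unitarymx -> map_mx toC M = P^t* *m diag_mx (\row_i toC (d i)) *m P ->
  let x := y *m P in
  (x *m map_mx toC M *m x^t*) 0 0 = \sum_i toC (d i) * `|y 0 i| ^+ 2 /\
  (x *m x^t*) 0 0 = \sum_i `|y 0 i| ^+ 2.
Proof.
move=> /unitarymxP U -> x.
have -> : x^t* = P^t* *m y^t* by rewrite /x trmx_mul map_mxM.
split; last by rewrite /x !mulmxA -(mulmxA y) U mulmx1 sqnormE.
rewrite /x !mulmxA -(mulmxA y) U mulmx1 -2!mulmxA (mulmxA P) U mul1mx.
rewrite !mxE; apply: eq_bigr => i _.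
rewrite normCK mulrA !mxE; congr (_ * _).
rewrite (bigD1 i)//= big1 ?addr0 => [|k ki]; rewrite !mxE ?(negPf ki) ?mulr0n ?mulr0//.
by rewrite eqxx mulr1n mulrC.
Qed.
End ComplexSpectral.

(** * The min-max principle *)

Section MinMaxComplex.
Local Open Scope sesquilinear_scope.
Variables (R : rcfType) (C : numClosedFieldType) (toC : {rmorphism R -> C}).
Hypothesis toC_le : forall a b, (toC a <= toC b) = (a <= b).
Hypothesis toC_real : forall z, z \is Num.real -> exists a, z = toC a.

Variables (n : nat) (M : 'M[R]_n).
Hypothesis Msym : M^T = M.

Lemma nth_eigenvalues_lt (d : 'I_n -> R) (c : R) (k : nat) :
  char_poly M = \prod_(a <- [seq d i | i <- enum 'I_n]) ('X - a%:P) ->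
  (k < n)%N -> ((eigenvalues M)`_k < c) = (k < #|[pred i | (d i < c)%R]|)%N.
Proof.
move=> /eigenvalues_split [srt pe] kn.
rewrite sorted_nth_lt_count//; last by rewrite (perm_size pe) size_map size_enum_ord.
rewrite (permP pe) count_map cardE /enum_mem -enumT size_filter; congr (_ < _)%N.
by rewrite count_filter; apply: eq_count => i; rewrite /= andbT.
Qed.

(** A homogeneous linear system with more unknowns than equations has a nonzero
    solution. *)
Lemma kernel_row (F : fieldType) p q (N : 'M[F]_(p, q)) : (q < p)%N ->
  exists2 a : 'rV_p, a != 0 & a *m N = 0.
Proof.
move=> qp; have : kermx N != 0.
  by rewrite -mxrank_eq0 mxrank_ker subn_eq0 -ltnNge (leq_ltn_trans (rank_leq_col _)).
case/rowV0Pn => a /sub_kermxP aN a0; by exists a.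
Qed.

(** The row space of B is a space of dimension k + 1 on which the form is below c
    (its injectivity is implied by the strict inequality).  Were at most k
    eigenvalues below c, a nonzero combination of the rows would be orthogonal to
    their eigenvectors.  That combination has coefficients in C, and one of its
    real and imaginary parts contradicts the hypothesis. *)
Lemma minmax_lt (k : nat) (c : R) (B : 'M[R]_(k.+1, n)) : (k < n)%N ->
  (forall a : 'rV_k.+1, a != 0 ->
     qform M (a *m B) < c * ((a *m B) *m (a *m B)^T) 0 0) ->
  (eigenvalues M)`_k < c.
Proof.
move=> kn hB.
have [P [d [U eqM cp]]] := sym_spectral toC_le toC_real Msym.
rewrite (nth_eigenvalues_lt c cp kn) ltnNge; apply/negP => hk.
set s := [pred i | _] in hk.
pose N := colsub (@enum_val _ s) (map_mx toC B *m P^t*).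
have [a a0 aN] := kernel_row N hk.
set y := a *m map_mx toC B *m P^t*.
have ys i : d i < c -> y 0 i = 0.
  move=> hi; have is_ : i \in s by rewrite inE.
  have := congr1 (fun A : 'rV_(#|s|) => A 0 (enum_rank_in is_ i)) aN.
  rewrite /= [in RHS]mxE => <-; rewrite /N /y -mulmxA !mxE; apply: eq_bigr => l _.
  by rewrite !mxE enum_rankK_in.
have [] := hform_diag y U eqM.
have -> : y *m P = a *m map_mx toC B.
  by rewrite /y -mulmxA -(invmx_unitary U) mulVmx ?mulmx1 ?unitarymx_unit.
set x := a *m _; move=> e1 e2.
have [a1 [a2 ea]] := mx_split toC_real a.
have ex : x = map_mx toC (a1 *m B) + 'i *: map_mx toC (a2 *m B).
  by rewrite /x ea mulmxDl -scalemxAl -!map_mxM.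
have f1 := hform_split toC_le (a1 *m B) (a2 *m B) Msym.
have f2 := hform_split toC_le (a1 *m B) (a2 *m B) (trmx1 _ n).
rewrite /= -ex in f1 f2; rewrite map_mx1 !mulmx1 in f2.
have : toC (c * (((a1 *m B) *m (a1 *m B)^T) 0 0 + ((a2 *m B) *m (a2 *m B)^T) 0 0))
   <= toC (qform M (a1 *m B) + qform M (a2 *m B)).
  rewrite rmorphM -f1 -f2 e1 e2 mulr_sumr; apply: ler_sum => i _.
  have [di|di] := ltP (d i) c; first by rewrite ys// normr0 expr0n !mulr0.
  by rewrite ler_wpM2r ?exprn_ge0// toC_le.
rewrite toC_le leNgt => /negP; apply.
rewrite mulrDr.
have q0 (b : 'rV_k.+1) : qform M (b *m B) <= c * ((b *m B) *m (b *m B)^T) 0 0.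
  have [->|b0] := eqVneq b 0; first by rewrite !mul0mx !mxE mulr0.
  by apply: ltW; exact: hB.
have [a10|a10] := eqVneq a1 0; last by rewrite ltr_leD ?hB.
have [a20|a20] := eqVneq a2 0; last by rewrite ler_ltD ?hB.
by move: a0; rewrite ea a10 a20 !map_mx0 scaler0 addr0 eqxx.
Qed.

(** The kernel of D is a space of codimension at most k on which the form is at
    least c.  Were more than k eigenvalues below c, a nonzero combination of
    their eigenvectors would lie in the kernel of D. *)
Lemma minmax_ge (k : nat) (c : R) (D : 'M[R]_(n, k)) : (k < n)%N ->
  (forall x : 'rV_n, x *m D = 0 -> c * (x *m x^T) 0 0 <= qform M x) ->
  c <= (eigenvalues M)`_k.
Proof.
move=> kn hD.
have [P [d [U eqM cp]]] := sym_spectral toC_le toC_real Msym.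
rewrite leNgt (nth_eigenvalues_lt c cp kn); apply/negP => hk.
set s := [pred i | _] in hk.
pose N := rowsub (@enum_val _ s) (P *m map_mx toC D).
have [b b0 bN] := kernel_row N hk.
pose E := rowsub (@enum_val _ s) (1%:M : 'M[C]_n).
pose y := b *m E.
have ys i : i \notin s -> y 0 i = 0.
  move=> hi; rewrite mxE big1// => l _; rewrite !mxE.
  by case: eqP hi (enum_valP l) => [->|]; rewrite ?mulr0// => /negPf ->.
have yv l : y 0 (enum_val l) = b 0 l.
  rewrite mxE (bigD1 l)//= !mxE eqxx mulr1 big1 ?addr0// => m ml.
  by rewrite !mxE (inj_eq enum_val_inj) (negPf ml) mulr0.
have [l bl] : exists l, b 0 l != 0.
  apply/existsP; apply: contraNT b0 => /existsPn h; apply/eqP/rowP => l.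
  by rewrite mxE; apply/eqP; have := h l; rewrite negbK.
have xD : y *m P *m map_mx toC D = 0.
  by rewrite -mulmxA /y -mulmxA /E mul_rowsub_mx mul1mx.
have [] := hform_diag y U eqM.
set x := y *m P; move=> e1 e2.
have [x1 [x2 ex]] := mx_split toC_real x.
have f1 := hform_split toC_le x1 x2 Msym.
have f2 := hform_split toC_le x1 x2 (trmx1 _ n).
rewrite /= -ex in f1 f2; rewrite map_mx1 !mulmx1 in f2.
have [x1D x2D] : x1 *m D = 0 /\ x2 *m D = 0.
  move: xD; rewrite -/x ex mulmxDl -scalemxAl -!map_mxM => h.
  have rl (z : 'rV[R]_k) : map_mx toC z \is a realmx.
    by apply/mxOverP => u v; rewrite mxE toC_is_real.
  have : (map_mx toC (x1 *m D), map_mx toC (x2 *m D)) = (map_mx toC 0, map_mx toC 0).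
    by apply: eqmx_ReiIm; rewrite ?rl// h !map_mx0 scaler0 addr0.
  by case=> /map_mx_inj -> /map_mx_inj ->.
have : toC (qform M x1 + qform M x2) <
  toC (c * ((x1 *m x1^T) 0 0 + (x2 *m x2^T) 0 0)).
  rewrite rmorphM -f1 -f2 e1 e2 mulr_sumr.
  rewrite (bigD1 (enum_val l))//= [ltRHS](bigD1 (enum_val l))//=.
  have := enum_valP l; rewrite inE => dl.
  apply: ltr_leD; first by rewrite ltr_pM2r ?toC_lt// exprn_gt0// normr_gt0 yv.
  apply: ler_sum => i _.
  have [si|si] := boolP (i \in s); last by rewrite ys// normr0 expr0n !mulr0.
  by rewrite ler_wpM2r ?exprn_ge0// toC_le ltW//; move: si; rewrite inE.
rewrite toC_lt// ltNge => /negP; apply.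
by rewrite mulrDr lerD ?hD.
Qed.
End MinMaxComplex.

(** The two bounds above for C = R[i]. *)
Section MinMax.
Variables (R : rcfType) (n : nat) (M : 'M[R]_n) (k : nat) (c : R).
Hypothesis Msym : M^T = M.

Let real_complex_le (a b : R) :
  ((real_complex R a : R[i]%C) <= (real_complex R b : R[i]%C)) = (a <= b).
Proof. exact: lecR. Qed.

Let complex_real (z : R[i]%C) : z \is Num.real -> exists a, z = real_complex R a.
Proof.
move=> /CrealP; case: z => a b /eqP; rewrite eq_complex /= => /andP[_ /eqP hb].
exists a; congr Complex; lra.
Qed.

Lemma eigenvalue_lt (B : 'M[R]_(k.+1, n)) : (k < n)%N ->
  (forall a : 'rV_k.+1, a != 0 ->
     qform M (a *m B) < c * ((a *m B) *m (a *m B)^T) 0 0) ->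
  (eigenvalues M)`_k < c.
Proof. exact: (minmax_lt (toC := real_complex R) real_complex_le complex_real). Qed.

Lemma eigenvalue_ge (D : 'M[R]_(n, k)) : (k < n)%N ->
  (forall x : 'rV_n, x *m D = 0 -> c * (x *m x^T) 0 0 <= qform M x) ->
  c <= (eigenvalues M)`_k.
Proof. exact: (minmax_ge (toC := real_complex R) real_complex_le complex_real). Qed.
End MinMax.

(** * The quadratic form of L_n in terms of partial sums *)

Section Form.
Variables (R : realType) (nu : R).

Lemma L_sym n : (L_matrix nu n)^T = L_matrix nu n.
Proof. by apply/matrixP => i j; rewrite !mxE maxnC. Qed.

(** The sum of the first k terms of x. *)
Definition psum (x : nat -> R) (k : nat) := \sum_(i < k) x i.

(** Abel summation: the entries of L depend on max(i, j) only, and the terms with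
    max(i, j) = k of the double sum add up to a difference of squares. *)
Lemma L_form n (x : 'rV[R]_n) (X : nat -> R) :
  (forall k : 'I_n, x 0 k = X k) ->
  qform (L_matrix nu n) x =
  \sum_(k < n) (psum X k.+1 ^+ 2 - psum X k ^+ 2) / (k%:R + nu).
Proof.
move=> hx.
transitivity (\sum_(i < n) \sum_(j < n) X i * X j / ((maxn i j)%:R + nu)).
  rewrite -mulmxA mxE; apply: eq_bigr => i _; rewrite hx mxE mulr_sumr.
  by apply: eq_bigr => j _; rewrite !mxE hx -mulrA; congr (_ * _); rewrite mulrC.
clear hx x; elim: n => [|n IH]; first by rewrite !big_ord0.
rewrite [RHS]big_ord_recr /= -IH big_ord_recr /=.
under eq_bigr do rewrite big_ord_recr /=.
rewrite big_split /= -addrA; congr (_ + _).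
rewrite big_ord_recr /= maxnn.
have e1 : \sum_(i < n) X i * X n / ((maxn i n)%:R + nu) =
   psum X n * X n / (n%:R + nu).
  rewrite /psum !mulr_suml; apply: eq_bigr => i _.
  by rewrite (maxn_idPr (ltnW (ltn_ord i))).
have e2 : \sum_(i < n) X n * X i / ((maxn n i)%:R + nu) =
   psum X n * X n / (n%:R + nu).
  by rewrite -e1; apply: eq_bigr => i _; rewrite maxnC (mulrC (X n)).
rewrite e1 e2 {3}/psum big_ord_recr /= -/(psum X n).
rewrite -!mulrDl; congr (_ / _); ring.
Qed.

End Form.

Section FormT.
Variables (R : realType) (nu : R) (N : nat).

(** The coefficients V_t of the transformed form.  The index t counts the rows of
    the matrix of size N + 1 from the last one, which is exceptional. *)
Definition pot (lam : R) (t : nat) : R :=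
  if t is 0 then lam / (N%:R + nu) - 2
  else lam / (((N - t)%:R + nu) * ((N - t)%:R + 1 + nu)) - 4.

(** A discrete Sturm-Liouville energy with potential V, for sequences r that vanish
    beyond the index N. *)
Definition Tform (V r : nat -> R) :=
  \sum_(t < N.+1) (r t - r t.+1) ^+ 2 + \sum_(t < N.+1) V t * r t ^+ 2.

(** The hypothesis on x says that r_t is, up to the sign (-1)^(N-t), the partial
    sum x_0 + ... + x_(N-t). *)
Lemma T_form (lam : R) (r : nat -> R) (x : 'rV[R]_N.+1) :
  0 < nu ->
  (forall t, (N < t)%N -> r t = 0) ->
  (forall k : 'I_N.+1, x 0 k = (-1) ^+ k * (r (N - k)%N + r (N.+1 - k)%N)) ->
  lam * qform (L_matrix nu N.+1) x - (x *m x^T) 0 0 = Tform (pot lam) r.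
Proof.
move=> nu0 r0 hx.
pose X k := (-1) ^+ k * (r (N - k)%N + r (N.+1 - k)%N).
have sq (s : R) k : (((-1) ^+ k) * s) ^+ 2 = s ^+ 2 by rewrite exprMn sqrr_sign mul1r.
have psE k : (k <= N.+1)%N -> psum X k = - (-1) ^+ k * r (N.+1 - k)%N.
  elim: k => [_|k IH kN]; first by rewrite /psum big_ord0 subn0 r0// mulr0.
  rewrite /psum big_ord_recr /= -/(psum X k) IH 1?ltnW// exprS subSS /X; ring.
rewrite (@L_form _ _ _ _ X) //.
rewrite mxE.
have -> : \sum_j x 0 j * x^T j 0 = \sum_(t < N.+1) (r t + r t.+1) ^+ 2.
  rewrite (reindex_inj rev_ord_inj) /=; apply: eq_bigr => t _.
  have tN : (t <= N)%N by rewrite -ltnS.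
  rewrite mxE -expr2 hx sq.
  by congr ((r _ + r _) ^+ 2); rewrite /=; lia.
have -> : \sum_(k < N.+1) (psum X k.+1 ^+ 2 - psum X k ^+ 2) / (k%:R + nu) =
   \sum_(t < N.+1) (r t ^+ 2 - r t.+1 ^+ 2) / ((N - t)%:R + nu).
  rewrite (reindex_inj rev_ord_inj) /=; apply: eq_bigr => t _.
  have tN : (t <= N)%N by rewrite -ltnS.
  rewrite subSS !psE; try lia.
  rewrite !mulNr !sqrrN !sq; congr ((r _ ^+ 2 - r _ ^+ 2) / _); lia.
have shift (g : nat -> R) : \sum_(t < N.+1) g t * r t.+1 ^+ 2 =
   \sum_(t < N.+1) (if (t : nat) is 0 then 0 else g t.-1) * r t ^+ 2.
  rewrite big_ord_recr /= r0// expr0n mulr0 addr0 big_ord_recl /= mul0r add0r.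
  by apply: eq_bigr => t _.
rewrite mulr_sumr -sumrB /Tform.
under eq_bigr => t _.
  have -> : lam * ((r t ^+ 2 - r t.+1 ^+ 2) / ((N - t)%:R + nu)) - (r t + r t.+1) ^+ 2
    = (r t - r t.+1) ^+ 2 + ((lam / ((N - t)%:R + nu) - 2) * r t ^+ 2
      - (lam / ((N - t)%:R + nu) + 2) * r t.+1 ^+ 2) by ring.
  over.
rewrite big_split /= sumrB; congr (_ + _).
rewrite (shift (fun t => lam / ((N - t)%:R + nu) + 2)) -sumrB.
apply: eq_bigr => -[[|t] /= tN] _; rewrite /pot ?subn0; first by ring.
rewrite -mulrBl; congr (_ * _).
have -> : (N - t)%:R = (N - t.+1)%:R + 1 :> R by rewrite natr1; congr (_%:R); lia.
have : 0 <= (N - t.+1)%:R :> R by [].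
set a := _%:R => a0.
field; lra.
Qed.
End FormT.

Section Criteria.
Variables (R : realType) (nu lam : R) (N k : nat).
Hypotheses (nu0 : 0 < nu) (lam0 : 0 < lam) (kN : (k <= N)%N).

Lemma eigenvalue_lt_of_Tform (rho : 'I_k.+1 -> nat -> R) :
  (forall l t, (N < t)%N -> rho l t = 0) ->
  (forall a : 'rV[R]_k.+1, a != 0 ->
    Tform N (pot nu N lam) (fun t => \sum_l a 0 l * rho l t) < 0) ->
  (eigenvalues (L_matrix nu N.+1))`_k < lam^-1.
Proof.
move=> rho0 hT.
pose B : 'M[R]_(k.+1, N.+1) :=
  \matrix_(l, i) ((-1) ^+ i * (rho l (N - i)%N + rho l (N.+1 - i)%N)).
apply: (@eigenvalue_lt _ _ _ _ _ (L_sym nu N.+1) B) => // a a0.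
have := hT a a0; rewrite -(@T_form _ _ _ _ _ (a *m B)) //; last first.
- move=> i; rewrite mxE -big_split mulr_sumr /=; apply: eq_bigr => l _.
  by rewrite mxE; ring.
- by move=> t tN; rewrite big1// => l _; rewrite rho0// mulr0.
by rewrite subr_lt0 -ltr_pdivlMl.
Qed.

(** Each G l is the coefficient sequence of one linear condition on r. *)
Lemma eigenvalue_ge_of_Tform (G : 'I_k -> nat -> R) :
  (forall r : nat -> R, (forall t, (N < t)%N -> r t = 0) ->
    (forall l, \sum_(t < N.+1) r t * G l t = 0) ->
    0 <= Tform N (pot nu N lam) r) ->
  lam^-1 <= (eigenvalues (L_matrix nu N.+1))`_k.
Proof.
move=> hT.
pose A : 'M[R]_(N.+1, N.+1) :=
  \matrix_(i, t) ((i <= N - t)%:R * (-1) ^+ (N - t)).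
pose D : 'M[R]_(N.+1, k) := A *m (\matrix_(t, l) G l t).
apply: (@eigenvalue_ge _ _ _ _ _ (L_sym nu N.+1) D) => // x xD.
pose X (i : nat) := x 0 (inord i).
pose r t := if (t <= N)%N then (-1) ^+ (N - t) * psum X (N - t).+1 else 0.
have r0 t : (N < t)%N -> r t = 0 by rewrite /r ltnNge => /negPf ->.
have rE (t : 'I_N.+1) : r t = (x *m A) 0 t.
  have tN : (t <= N)%N by rewrite -ltnS.
  rewrite /r tN mxE /psum mulr_sumr.
  rewrite (big_ord_widen_cond N.+1 predT (fun i => (-1) ^+ (N - t) * X i)) ?ltnS ?leq_subr//.
  rewrite big_mkcond; apply: eq_bigr => i _; rewrite mxE /X inord_val ltnS.
  by case: leqP => _; rewrite ?mul1r ?mul0r ?mulr0// mulrC.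
have := hT r r0; rewrite -(@T_form _ _ _ _ _ x) //.
  rewrite subr_ge0 => h; rewrite ler_pdivrMl//; apply: h => l.
  transitivity ((x *m D) 0 l); last by rewrite xD mxE.
  rewrite /D mulmxA [RHS]mxE; apply: eq_bigr => t _.
  by rewrite rE; congr (_ * _); rewrite mxE.
move=> i; have iN : (i <= N)%N by rewrite -ltnS.
have Xi : x 0 i = X i by rewrite /X inord_val.
rewrite Xi {1}/r leq_subr subKn// mulrDr mulrA -expr2 sqrr_sign mul1r.
case: (posnP i) => [i0|i1].
  by rewrite r0 ?i0 ?subn0// mulr0 addr0 /psum big_ord1.
rewrite /r ifT; last lia.
have -> : (N - (N.+1 - i))%N = i.-1 by lia.
rewrite prednK// mulrA -exprD (_ : (i + i.-1)%N = (i.-1).*2.+1); last lia.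
by rewrite exprS -muln2 exprM sqrr_sign /psum big_ord_recr /=; ring.
Qed.
End Criteria.

(** * Calculus on the real line *)

Section Calculus.
Variable R : realType.
Implicit Types (f g : R -> R) (x a b d e : R).

(** The rules of differentiation with the derivative as a parameter, for functions
    written pointwise. *)
Lemma isderD f g x d e : is_derive x 1 f d -> is_derive x 1 g e ->
  is_derive x 1 (fun y => f y + g y) (d + e).
Proof. move=> ? ?; exact: (is_deriveD (f := f) (g := g)). Qed.

Lemma isderB f g x d e : is_derive x 1 f d -> is_derive x 1 g e ->
  is_derive x 1 (fun y => f y - g y) (d - e).
Proof. move=> ? ?; exact: (is_deriveB (f := f) (g := g)). Qed.

Lemma isderN f x d : is_derive x 1 f d -> is_derive x 1 (fun y => - f y) (- d).
Proof. move=> ?; exact: (is_deriveN (f := f)). Qed.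

Lemma isderM f g x d e : is_derive x 1 f d -> is_derive x 1 g e ->
  is_derive x 1 (fun y => f y * g y) (d * g x + f x * e).
Proof.
move=> hf hg; apply: (is_derive_eq (is_deriveM hf hg)).
by rewrite /GRing.scale /= addrC mulrC.
Qed.

Lemma isderZ f x d c : is_derive x 1 f d ->
  is_derive x 1 (fun y => c * f y) (c * d).
Proof. by move=> ?; exact: (is_deriveZ (f := f)). Qed.

Lemma isder_cst x c : is_derive x 1 (fun _ : R => c : R) (0 : R).
Proof. exact: is_derive_cst. Qed.

Lemma isder_id x : is_derive x 1 (fun y : R => y : R) (1 : R).
Proof. exact: is_derive_id. Qed.

Lemma isderV f x d : f x != 0 -> is_derive x 1 f d ->
  is_derive x 1 (fun y => (f y)^-1) (- d / f x ^+ 2).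
Proof.
move=> fx df; apply: (is_derive_eq (is_deriveV fx df)).
by rewrite /GRing.scale /= mulNr mulNr mulrC.
Qed.

Lemma isder_comp f g x d e : is_derive x 1 g e -> is_derive (g x) 1 f d ->
  is_derive x 1 (fun y => f (g y)) (e * d).
Proof. by move=> dg df; apply: (is_derive_eq (is_derive1_comp df dg)); rewrite mulrC. Qed.

Lemma der_continuous f x d : is_derive x 1 f d -> {for x, continuous f}.
Proof. by move=> h; apply: differentiable_continuous; apply/derivable1_diffP. Qed.

Lemma mvt f (df : R -> R) a b : a <= b ->
  (forall x : R, a <= x <= b -> is_derive x 1 f (df x)) ->
  exists2 c : R, a <= c <= b & f b - f a = df c * (b - a).
Proof.
move=> ab h; have [||c] := @MVT_segment R f df a b ab.
- by move=> x; rewrite in_itv /= => /andP[/ltW ax /ltW xb]; apply: h; rewrite ax.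
- apply: continuous_in_subspaceT => x; rewrite inE /= in_itv /= => /h.
  exact: der_continuous.
- by rewrite in_itv /= => ? ?; exists c.
Qed.

Lemma ge0_der_le f (df : R -> R) a b : a <= b ->
  (forall x : R, a <= x <= b -> is_derive x 1 f (df x)) ->
  (forall x : R, a <= x <= b -> 0 <= df x) -> f a <= f b.
Proof.
move=> ab h h0; rewrite -subr_ge0; have [c cab ->] := mvt ab h.
by rewrite mulr_ge0 ?h0// subr_ge0.
Qed.

Lemma ge0_der_le_within f (df : R -> R) a b : a <= b ->
  (forall x : R, a < x < b -> is_derive x 1 f (df x)) ->
  (forall x : R, a <= x <= b -> {for x, continuous f}) ->
  (forall x : R, a < x < b -> 0 <= df x) -> f a <= f b.
Proof.
rewrite le_eqVlt => /predU1P[-> _ _ _|ab h hc h0]; first exact: lexx.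
rewrite -subr_ge0.
have hd x : x \in `]a, b[ -> is_derive x 1 f (df x).
  by rewrite in_itv /= => xab; exact: h.
have hw : {within `[a, b], continuous f}.
  by apply: continuous_in_subspaceT => x; rewrite inE /= in_itv /=; exact: hc.
have [c] := MVT ab hd hw.
by rewrite in_itv /= => cab ->; rewrite mulr_ge0 ?h0// subr_ge0; exact: ltW.
Qed.

Lemma bounded_on f a b : (forall x : R, a <= x <= b -> {for x, continuous f}) ->
  exists2 K : R, 0 < K & forall x : R, a <= x <= b -> `|f x| <= K.
Proof.
move=> hc.
have [N [_ /(_ (`|N| + 1))]] : bounded_set (f @` `[a, b]).
  apply: compact_bounded; apply: continuous_compact; last exact: segment_compact.
  apply: continuous_in_subspaceT => x; rewrite inE /= in_itv /=; exact: hc.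
move=> /(_ (le_lt_trans (ler_norm _) (ltr_pwDr ltr01 (lexx _)))) h.
exists (`|N| + 1) => [|x xab]; first by rewrite ltr_wpDl.
by apply: h; exists x => //; rewrite /= in_itv.
Qed.

End Calculus.

(** * A discrete Picone inequality *)

(** Throughout, f solves f'' = ((x - xi) / 3) f and has simple zeros, and
    w0 + w1 x is the affine function w of the current cell. *)
Section Picone.
Variables (R : realType) (xi : R) (f f' : R -> R).
Hypothesis df : forall x : R, is_derive x 1 f (f' x).
Hypothesis df' : forall x : R, is_derive x 1 f' ((x - xi) / 3 * f x).
Hypothesis simple_zero : forall x : R, f x = 0 -> f' x != 0.

(** At a zero z of f the quotient has value 0 by convention (f z)^-1 = 0; it is
    continuous there since w^2 vanishes to second order and f to first order. *)
Lemma picone_continuous (w0 w1 z : R) : (f z = 0 -> w0 + w1 * z = 0) ->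
  {for z, continuous (fun x => f' x / f x * (w0 + w1 * x) ^+ 2)}.
Proof.
move=> hz; have [fz|fz] := eqVneq (f z) 0; last first.
  apply: cvgM; last first.
    have dw : is_derive z 1 (fun x => w0 + w1 * x) w1.
      have := isderD (isder_cst z w0) (isderZ w1 (isder_id z)).
      by rewrite add0r mulr1.
    exact: (der_continuous (isderM dw dw)).
  apply: cvgM; first exact: (der_continuous (df' z)).
  by apply: cvgV => //; exact: (der_continuous (df z)).
have wz := hz fz; have f'z := simple_zero fz.
have h0 : 0 < `|f' z| / 2 by rewrite divr_gt0// normr_gt0.
have /cvgrPdist_lt/(_ _ h0)[e /= e0 he] := der_continuous (df' z).
apply/cvgrPdist_le => eps eps0 /=.
rewrite wz expr0n mulr0 /=.
pose K := 3 * w1 ^+ 2 + 1.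
have K0 : 0 < K by rewrite /K; have := sqr_ge0 w1; lra.
apply/nbhs_ballP; exists (Num.min e (eps / K)) => /=; first by rewrite lt_min e0 divr_gt0.
move=> x; rewrite /ball /= lt_min => /andP[xe xeps].
rewrite sub0r normrN.
have [->|xz] := eqVneq x z; first by rewrite wz expr0n mulr0 normr0 ltW.
have wx : w0 + w1 * x = w1 * (x - z) by rewrite mulrBr -[LHS]subr0 -wz; ring.
have hb c : `|z - c| < e -> `|f' z| / 2 <= `|f' c| <= 3 / 2 * `|f' z|.
  move=> /he /= /ltW h.
  have : `|f' c| - `|f' z| <= `|f' c - f' z| by exact: lerB_dist.
  have : `|f' z| - `|f' c| <= `|f' z - f' c| by exact: lerB_dist.
  rewrite (distrC (f' c)); lra.
have [c cxz fx] : exists2 c, `|z - c| < e & f x = f' c * (x - z).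
  have [xlt|xgt] := ltP x z.
    have [c /andP[c1 c2] e1] := mvt (ltW xlt) (fun y _ => df y).
    exists c; last by move: e1; rewrite fz; lra.
    by apply: le_lt_trans xe; rewrite !ger0_norm; lra.
  have [c /andP[c1 c2] e1] := mvt xgt (fun y _ => df y).
  exists c; last by move: e1; rewrite fz; lra.
  by apply: le_lt_trans xe; rewrite !ler0_norm; lra.
have /andP[b1 _] := hb _ cxz; have /andP[_ b2] := hb _ xe.
have c0 : 0 < `|f' c| by apply: lt_le_trans b1.
have xz0 : 0 < `|x - z| by rewrite normr_gt0 subr_eq0.
rewrite wx fx.
have -> : f' x / (f' c * (x - z)) * (w1 * (x - z)) ^+ 2 = f' x / f' c * (w1 ^+ 2 * (x - z)).
  have : f' c != 0 by rewrite -normr_gt0.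
  have : x - z != 0 by rewrite subr_eq0.
  by move=> ? ?; field; apply/andP.
rewrite (normrM (f' x / f' c)) (normrM (f' x)) normfV (normrM (w1 ^+ 2)) (ger0_norm (sqr_ge0 w1)).
have q3 : `|f' x| / `|f' c| <= 3 by rewrite ler_pdivrMr//; lra.
apply: (@le_trans _ _ (K * `|x - z|)).
  rewrite mulrA ler_wpM2r// /K.
  have : `|f' x| / `|f' c| * w1 ^+ 2 <= 3 * w1 ^+ 2 by rewrite ler_wpM2r ?sqr_ge0.
  lra.
by rewrite mulrC -ler_pdivlMr// distrC ltW.
Qed.

(** Picone's inequality on [a, b], where G is a primitive of
    w'^2 + ((x - xi) / 3) w^2: the derivative of G - (f'/f) w^2 is
    (w' - (f'/f) w)^2.  The affine function w has at most one zero unless it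
    vanishes identically, so at most one singular point has to be crossed. *)
Lemma picone (a b w0 w1 : R) (G : R -> R) : a <= b ->
  (forall x, a <= x <= b -> f x = 0 -> w0 + w1 * x = 0) ->
  (forall x : R, is_derive x 1 G (w1 ^+ 2 + (x - xi) / 3 * (w0 + w1 * x) ^+ 2)) ->
  f' b / f b * (w0 + w1 * b) ^+ 2 - f' a / f a * (w0 + w1 * a) ^+ 2 <= G b - G a.
Proof.
move=> ab hw dG.
pose H x := G x - f' x / f x * (w0 + w1 * x) ^+ 2.
suff : H a <= H b by rewrite /H; lra.
(* monotonicity on an interval without zeros of f in its interior *)
have seg c d : a <= c -> c <= d -> d <= b -> (forall x, c < x < d -> f x != 0) -> H c <= H d.
  move=> ac cd db nz.
  apply: (@ge0_der_le_within _ H (fun x => (w1 - f' x / f x * (w0 + w1 * x)) ^+ 2)) => //.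
  - move=> x /nz fx; rewrite /H.
    have dw : is_derive x 1 (fun x => w0 + w1 * x) w1.
      have := isderD (isder_cst x w0) (isderZ w1 (isder_id x)).
      by rewrite add0r mulr1.
    have := isderB (dG x) (isderM (isderM (df' x) (isderV fx (df x))) (isderM dw dw)).
    rewrite (_ : (fun y => _ - _) = H); last by apply/funext => y; rewrite /H expr2.
    move=> hd; apply: (is_derive_eq hd); field; exact: fx.
  - move=> x /andP[cx xd]; apply: cvgB; first exact: (der_continuous (dG x)).
    apply: picone_continuous; apply: hw; lra.
  - by move=> x _; exact: sqr_ge0.
have [[z /andP[az zb] fz]|nz] := pselect (exists2 z, a <= z <= b & f z = 0); last first.
  apply: seg => // x /andP[ax xb]; apply/eqP => fx; apply: nz; exists x => //; lra.
have wz := hw _ (introT andP (conj az zb)) fz.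
have [w10|w10] := eqVneq w1 0.
  have w00 : w0 = 0 by move: wz; rewrite w10 mul0r addr0.
  rewrite /H w10 w00 !mul0r addr0 expr0n !mulr0 !subr0.
  apply: (ge0_der_le ab (fun x _ => dG x)) => x _.
  by rewrite w10 w00 mul0r addr0 expr0n mulr0 addr0.
have uniq_z x : a <= x <= b -> f x = 0 -> x = z.
  move=> xab fx; have wx := hw _ xab fx.
  have : w1 * (x - z) = 0 by rewrite mulrBr; lra.
  by move/eqP; rewrite mulf_eq0 (negPf w10) subr_eq0 => /eqP.
apply: (@le_trans _ _ (H z)); apply: seg => //.
- move=> x /andP[ax xz]; apply/eqP => fx; have := uniq_z x; rewrite fx; lra.
- move=> x /andP[ax xz]; apply/eqP => fx; have := uniq_z x; rewrite fx; lra.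
Qed.
End Picone.

Section PiconeSum.
Variables (R : realType) (xi : R) (f f' : R -> R).
Hypothesis df : forall x : R, is_derive x 1 f (f' x).
Hypothesis df' : forall x : R, is_derive x 1 f' ((x - xi) / 3 * f x).
Hypothesis simple_zero : forall x : R, f x = 0 -> f' x != 0.
Variables (h : R) (h0 : 0 < h).

Let q (x : R) := f' x / f x.

(** Picone's inequality on the cell [h t, h (t + 1)] for the affine function with
    end values a and b.  The exact integral of the potential is replaced by an
    upper bound with the nodal values only: the error is h^2 / 3 times a
    nonnegative expression, up to the term h xi / 18 on (a - b)^2. *)
Lemma picone_cell (t : nat) (a b : R) :
  (forall x, h * t%:R <= x <= h * t.+1%:R -> f x = 0 ->
     a + (b - a) * (x / h - t%:R) = 0) ->
  q (h * t.+1%:R) * b ^+ 2 - q (h * t%:R) * a ^+ 2 <=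
  (a - b) ^+ 2 * (h^-1 + h * xi / 18) +
  h / 6 * (h * t.+1%:R - xi) * (a ^+ 2 + b ^+ 2).
Proof.
move=> hz; set T : R := t%:R in hz *.
have T0 : 0 <= T by rewrite /T.
have TS : t.+1%:R = T + 1 :> R by rewrite -natr1.
rewrite TS in hz *.
pose w1 := (b - a) / h; pose w0 := a - (b - a) * T.
have hn0 : h != 0 by rewrite gt_eqF.
have wE x : w0 + w1 * x = a + (b - a) * (x / h - T) by rewrite /w0 /w1; field.
pose G x := w1 ^+ 2 * x + 1 / 3 * (w0 ^+ 2 * (x * x / 2 - xi * x) +
   2 * w0 * w1 * (x * x * x / 3 - xi * (x * x) / 2) +
   w1 ^+ 2 * (x * x * x * x / 4 - xi * (x * x * x) / 3)).
have dG (x : R) : is_derive x 1 G (w1 ^+ 2 + (x - xi) / 3 * (w0 + w1 * x) ^+ 2).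
  have d1 := isder_id x; have d2 := isderM d1 d1; have d3 := isderM d2 d1.
  have d4 := isderM d3 d1.
  have := isderD (isderZ (w1 ^+ 2) d1) (isderZ (1 / 3) (isderD (isderD
     (isderZ (w0 ^+ 2) (isderB (isderZ (1 / 2) d2) (isderZ xi d1)))
     (isderZ (2 * w0 * w1) (isderB (isderZ (1 / 3) d3) (isderZ (xi / 2) d2))))
     (isderZ (w1 ^+ 2) (isderB (isderZ (1 / 4) d4) (isderZ (xi / 3) d3))))).
  rewrite (_ : (fun y => _ + _) = G); last by apply/funext => y; rewrite /G; field.
  by move=> hd; apply: (is_derive_eq hd); field.
have := @picone R xi f f' df df' simple_zero (h * T) (h * (T + 1)) w0 w1 G.
rewrite -/(q _) -/(q _) !wE.
have -> : a + (b - a) * (h * (T + 1) / h - T) = b by field.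
have -> : a + (b - a) * (h * T / h - T) = a by field.
move=> /(_ _ _ dG) hp; apply: (le_trans (hp _ _)).
- by rewrite ler_pM2l//; lra.
- by move=> x hx fx; rewrite wE; exact: hz.
rewrite -subr_ge0.
have -> : (a - b) ^+ 2 * (h^-1 + h * xi / 18) + h / 6 * (h * (T + 1) - xi) * (a ^+ 2 + b ^+ 2) -
  (G (h * (T + 1)) - G (h * T)) =
  h ^+ 2 / 3 * (T * (a - b) ^+ 2 / 6 + ((a - b) ^+ 2 + 4 * a ^+ 2 + 2 * b ^+ 2) / 12).
  rewrite /G /w0 /w1; field; exact: hn0.
have := sqr_ge0 h; have := sqr_ge0 (a - b); have := sqr_ge0 a; have := sqr_ge0 b.
move=> b2 a2 ab2 h2; apply: mulr_ge0; first lra.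
by apply: addr_ge0; [apply: divr_ge0 => //; exact: mulr_ge0 | lra].
Qed.

Variables (N : nat) (r : nat -> R).
Hypothesis r0 : forall t, (N < t)%N -> r t = 0.
Hypothesis hr : forall t x, h * t%:R <= x <= h * t.+1%:R -> f x = 0 ->
     r t + (r t.+1 - r t) * (x / h - t%:R) = 0.

(** Picone's inequality summed over all cells: the boundary terms telescope, the
    last one vanishes, and the first one enters the coefficient of r_0^2. *)
Lemma picone_sum :
  0 <= (1 + h ^+ 2 * xi / 18) * (\sum_(t < N.+1) (r t - r t.+1) ^+ 2) +
    \sum_(t < N.+1) (if (t : nat) is 0 then h ^+ 2 / 6 * (h - xi) + h * q 0 else
         h ^+ 2 / 3 * (h * t%:R + h / 2 - xi)) * r t ^+ 2.
Proof.
pose S n := \sum_(t < n) ((r t - r t.+1) ^+ 2 * (h^-1 + h * xi / 18) +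
  h / 6 * (h * t.+1%:R - xi) * (r t ^+ 2 + r t.+1 ^+ 2)).
have tele n : q (h * n%:R) * r n ^+ 2 - q 0 * r 0%N ^+ 2 <= S n.
  elim: n => [|n IH]; first by rewrite /S big_ord0 mulr0 subrr.
  rewrite /S big_ord_recr /= -/(S n).
  have := picone_cell (@hr n); lra.
have := tele N.+1; rewrite r0// expr0n mulr0 sub0r => hS.
have shift (g : nat -> R) : \sum_(t < N.+1) g t * r t.+1 ^+ 2 =
   \sum_(t < N.+1) (if (t : nat) is 0 then 0 else g t.-1) * r t ^+ 2.
  rewrite big_ord_recr /= r0// expr0n mulr0 addr0 big_ord_recl /= mul0r add0r.
  by apply: eq_bigr => t _.
have hn0 : h != 0 by rewrite gt_eqF.
have : 0 <= h * (S N.+1 + q 0 * r 0%N ^+ 2) by rewrite pmulr_rge0//; lra.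
congr (_ <= _); rewrite mulrDr /S.
have -> : \sum_(t < N.+1) ((r t - r t.+1) ^+ 2 * (h^-1 + h * xi / 18) +
    h / 6 * (h * t.+1%:R - xi) * (r t ^+ 2 + r t.+1 ^+ 2)) =
  (h^-1 + h * xi / 18) * (\sum_(t < N.+1) (r t - r t.+1) ^+ 2) +
  (\sum_(t < N.+1) h / 6 * (h * t.+1%:R - xi) * r t ^+ 2 +
   \sum_(t < N.+1) h / 6 * (h * t.+1%:R - xi) * r t.+1 ^+ 2).
  by rewrite mulr_sumr -!big_split /=; apply: eq_bigr => t _; ring.
rewrite (shift (fun t => h / 6 * (h * t.+1%:R - xi))).
set SD := \sum_(t < N.+1) (r t - r t.+1) ^+ 2; rewrite -big_split /=.
set SB := \sum_(_ < _) _; set SC := \sum_(_ < _) _.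
have -> : SC = h * SB + h * (q 0 * r 0%N ^+ 2).
  rewrite /SB /SC mulr_sumr !big_ord_recl /= addrAC; congr (_ + _); first by ring.
  by apply: eq_bigr => t _; rewrite /bump /= add1n -!natr1; field.
by field.
Qed.

Lemma Tform_ge0 (V : nat -> R) : 0 <= xi ->
  (h ^+ 2 / 6 * (h - xi) + h * q 0 <= (1 + h ^+ 2 * xi / 18) * V 0%N) ->
  (forall t, (0 < t <= N)%N ->
     h ^+ 2 / 3 * (h * t%:R + h / 2 - xi) <= (1 + h ^+ 2 * xi / 18) * V t) ->
  0 <= Tform N V r.
Proof.
move=> xi0 V0 Vt; have k0 : 0 < 1 + h ^+ 2 * xi / 18.
  by rewrite ltr_pwDl// divr_ge0// mulr_ge0// sqr_ge0.
rewrite -(pmulr_rge0 _ k0) /Tform mulrDr (le_trans picone_sum)// lerD2l.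
rewrite mulr_sumr; apply: ler_sum => -[[|t] /= tN] _; rewrite [leRHS]mulrA ler_wpM2r ?sqr_ge0//.
exact: Vt.
Qed.
End PiconeSum.

(** * Lower bound for the eigenvalues *)

Section PotentialLower.
Variables (R : realType) (nu xi h : R) (N : nat).
Hypotheses (nu0 : 0 < nu) (h0 : 0 < h) (hN : N.+1%:R * h ^+ 3 = 24).

(** The inverse of the eigenvalue predicted for the spectral parameter xi. *)
Definition lam_of : R := 4 * N.+1%:R ^+ 2 * (1 - h ^+ 2 * xi / 12).

(** The potential is at least its Airy approximation up to O(h^3). *)
Lemma pot_lower (t : nat) : 0 <= xi -> h ^+ 2 * xi / 12 <= 1 / 2 -> nu <= N.+1%:R ->
  (0 < t <= N)%N ->
  h ^+ 2 / 3 * (h * t%:R + h / 2 - h * nu - xi) - h ^+ 4 * xi ^+ 2 / 18 <=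
  pot nu N lam_of t.
Proof.
move=> xi0 eps_le nuN; case: t => // t /= tN.
have [nu1 h1] : 0 < nu /\ 0 < h by [].
rewrite /lam_of; set n : R := N.+1%:R in nuN *; have hN' : n * h ^+ 3 = 24 := hN.
set T : R := t.+1%:R; set e := h ^+ 2 * xi / 12 in eps_le *.
have kE : (N - t.+1)%:R = n - 1 - T :> R.
  by rewrite /n /T -[in RHS]natr1 addrK natrB.
have k0 : 0 <= n - 1 - T by rewrite -kE.
have T1 : 1 <= T by rewrite /T ler1n.
rewrite kE; set k := n - 1 - T in k0 *.
have n0 : 0 < n by rewrite /n.
(* the relative distance to n of the centre of the two factors of the denominator *)
pose rho := (T + 1 / 2 - nu) / n.
have kn : k + nu + 1 / 2 = n * (1 - rho) by rewrite /rho /k; field; rewrite gt_eqF.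
have r1 : rho < 1.
  have : 0 < n * (1 - rho) by rewrite -kn; lra.
  by rewrite pmulr_rgt0// subr_gt0.
have r2 : -1 <= rho by rewrite /rho ler_pdivlMr//; lra.
have e0 : 0 <= e by rewrite /e; apply: divr_ge0 => //; exact: mulr_ge0 (sqr_ge0 _) xi0.
have hh : h ^+ 3 = 24 / n by rewrite -hN'; field; rewrite gt_eqF.
have rhoE : 8 * rho = h ^+ 3 / 3 * (T + 1 / 2 - nu).
  by rewrite hh /rho; field; rewrite gt_eqF.
have -> : h ^+ 2 / 3 * (h * T + h / 2 - h * nu - xi) - h ^+ 4 * xi ^+ 2 / 18 =
  8 * rho - 4 * e - 8 * e ^+ 2 by rewrite rhoE /e; field.
rewrite lerBrDr.
have m0 : 0 < (k + nu) * (k + 1 + nu) by apply: mulr_gt0; lra.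
have n1 : 0 < n ^+ 2 by exact: exprn_gt0.
rewrite ler_pdivlMr//.
have b1 : (k + nu) * (k + 1 + nu) <= n ^+ 2 * (1 - rho) ^+ 2.
  by rewrite -exprMn -kn -subr_ge0 [leRHS](_ : _ = 1 / 4); [lra | field].
have b2 : 8 * rho - 4 * e - 8 * e ^+ 2 + 4 <= 4 * (1 - e) * (1 + rho) ^+ 2.
  rewrite -subr_ge0 (_ : _ - _ = 4 * ((1 / 2 - e) * rho ^+ 2 + (rho - 2 * e) ^+ 2 / 2)); last by field.
  have : 0 <= (1 / 2 - e) * rho ^+ 2 by apply: mulr_ge0; [lra | exact: sqr_ge0].
  by have := sqr_ge0 (rho - 2 * e); lra.
have b3 : (1 - rho) ^+ 2 * (1 + rho) ^+ 2 <= 1.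
  rewrite -exprMn (_ : (1 - rho) * (1 + rho) = 1 - rho ^+ 2); last by field.
  have : rho ^+ 2 <= 1 by rewrite expr2; nra.
  by have := sqr_ge0 rho; rewrite [X in X <= 1]expr2; nra.
apply: (@le_trans _ _ (4 * (1 - e) * (1 + rho) ^+ 2 * ((k + nu) * (k + 1 + nu)))).
  by rewrite ler_wpM2r// ltW.
apply: (@le_trans _ _ (4 * (1 - e) * (1 + rho) ^+ 2 * (n ^+ 2 * (1 - rho) ^+ 2))).
  by rewrite ler_wpM2l// mulr_ge0 ?sqr_ge0//; lra.
rewrite [leLHS](_ : _ = 4 * n ^+ 2 * (1 - e) * ((1 - rho) ^+ 2 * (1 + rho) ^+ 2)); last by ring.
rewrite ler_piMr//; apply: mulr_ge0; [apply: mulr_ge0 => //; exact: ltW | lra].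
Qed.

Lemma pot_lower0 : 0 <= xi -> h ^+ 2 * xi / 12 <= 1 / 2 -> nu <= N.+1%:R ->
  N.+1%:R - 2 <= pot nu N lam_of 0.
Proof.
move=> xi0 eps_le nuN; have nu1 : 0 < nu by []; rewrite /= lerD2r /lam_of.
have NE : N%:R = N.+1%:R - 1 :> R by rewrite -natr1 addrK.
rewrite NE; have n1 : 1 <= N.+1%:R :> R by rewrite ler1n.
set n : R := N.+1%:R in n1 nuN *; set e := _ / 12 in eps_le *.
rewrite ler_pdivlMr; last lra.
apply: (@le_trans _ _ (n * (2 * n))); first by rewrite ler_wpM2l; lra.
rewrite (_ : n * (2 * n) = 4 * n ^+ 2 * (1 / 2)); last by field.
rewrite ler_wpM2l; [by [] | | lra].
by apply: mulr_ge0 => //; exact: sqr_ge0.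
Qed.
End PotentialLower.

(** The z l are the nonnegative zeros of f; there may be fewer than k of them. *)
Section LowerBound.
Variables (R : realType) (nu xi xi' : R) (f f' : R -> R) (k : nat) (z : 'I_k -> R).
Hypotheses (nu0 : 0 < nu) (xi_ge0 : 0 <= xi) (xi_lt : xi < xi').
Hypothesis df : forall x : R, is_derive x 1 f (f' x).
Hypothesis df' : forall x : R, is_derive x 1 f' ((x - xi') / 3 * f x).
Hypothesis simple_zero : forall x : R, f x = 0 -> f' x != 0.
Hypothesis zeros : forall x, 0 <= x -> f x = 0 -> exists l, x = z l.

Lemma eigenvalue_lower_bound : exists2 h1 : R, 0 < h1 & forall (N : nat) (h : R),
  0 < h < h1 -> N.+1%:R * h ^+ 3 = 24 ->
  (lam_of xi h N)^-1 <= (eigenvalues (L_matrix nu N.+1))`_k.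
Proof.
have [nu1 [xi1 xi2]] : 0 < nu /\ 0 <= xi /\ xi < xi' by [].
pose K : R := 2 * nu + xi' * xi / 18 + xi ^+ 2 / 3 + 1.
have xi'0 : 0 <= xi' by lra.
have P0 : 0 <= xi' * xi by exact: mulr_ge0.
have P1 := sqr_ge0 xi.
have K0 : 0 < K by rewrite /K; lra.
pose Q := nu + `|f' 0 / f 0| + 2 * xi' + k%:R + 4.
have Q0 : 0 < Q by rewrite /Q; have := normr_ge0 (f' 0 / f 0); have := ler0n R k; lra.
exists (Num.min (1 / (xi + 1)) (Num.min 1 (Num.min (24 / Q) ((xi' - xi) / K)))).
  by rewrite !lt_min ltr01 !divr_gt0//; lra.
move=> N h /andP[h0]; rewrite !lt_min => /and4P[h_xi h_1 h_Q h_K] hN.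
have hxi : h * (xi + 1) < 1 by rewrite -ltr_pdivlMr//; lra.
have hQ : h * Q < 24 by rewrite -ltr_pdivlMr.
have hK : h * K < xi' - xi by rewrite -ltr_pdivlMr.
have h2 : 0 < h ^+ 2 by exact: exprn_gt0.
have h2h : h ^+ 2 <= h by rewrite expr2; nra.
have h3h : h ^+ 3 <= h by rewrite exprS; nra.
set n : R := N.+1%:R in hN *.
have nQ : Q <= n.
  have : h ^+ 3 * Q <= h ^+ 3 * n by rewrite [leRHS]mulrC hN; have := ler_wpM2r (ltW Q0) h3h; lra.
  by rewrite ler_pM2l// exprn_gt0.
have nuh : 0 <= h * nu by rewrite mulr_ge0 ?ltW.
have kN : (k <= N)%N.
  rewrite -ltnS -(ltr_nat R) -/n; move: nQ; rewrite /Q; have := normr_ge0 (f' 0 / f 0); lra.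
have nnu : nu <= n.
  move: nQ; rewrite /Q; have := normr_ge0 (f' 0 / f 0); have := ler0n R k; lra.
have eps : h ^+ 2 * xi / 12 <= 1 / 2.
  have : h ^+ 2 * xi <= h * xi by rewrite ler_wpM2r.
  by lra.
(* The condition G l says that the piecewise linear interpolation of r vanishes at
   z l, a point of the cell T l with relative position th l. *)
pose T l := Num.truncn (z l / h).
pose th l := z l / h - (T l)%:R.
pose G (l : 'I_k) (t : nat) : R :=
  (if t == T l then 1 - th l else 0) + (if t == (T l).+1 then th l else 0).
have lam0 : 0 < lam_of xi h N.
  by rewrite /lam_of mulr_gt0// ?mulr_gt0 ?exprn_gt0//; lra.
apply: (@eigenvalue_ge_of_Tform _ _ _ _ _ nu0 lam0 kN G).
move=> r r0 hG.
have sumG l : r (T l) * (1 - th l) + r (T l).+1 * th l = 0.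
  have one (u : nat) (c : R) : \sum_(t < N.+1) r t * (if (t : nat) == u then c else 0) = r u * c.
    have [uN|uN] := ltnP u N.+1.
      rewrite (bigD1 (Ordinal uN))//= eqxx big1 ?addr0// => t tu.
      by rewrite ifF ?mulr0//; apply/negbTE; apply: contra tu => /eqP e; apply/eqP/val_inj.
    rewrite (r0 u uN) mul0r big1// => t _.
    by rewrite ifF ?mulr0//; apply/eqP => e; move: uN; rewrite leqNgt -e ltn_ord.
  rewrite -!one -big_split /= -[RHS](hG l); apply: eq_bigr => t _.
  by rewrite /G mulrDr.
apply: (Tform_ge0 df df' simple_zero h0 r0) => //.
- move=> t x /andP[x1 x2] fx.
  have x0 : 0 <= x by apply: le_trans x1; rewrite mulr_ge0// ltW.
  have [l xl] := zeros x0 fx; have := sumG l; rewrite /th -xl.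
  have xh1 : t%:R <= x / h by rewrite ler_pdivlMr// mulrC.
  have xh2 : x / h <= t.+1%:R by rewrite ler_pdivrMr// mulrC.
  have [xlt|xge] := ltP (x / h) t.+1%:R.
    have -> : T l = t by rewrite /T -xl; apply: truncn_def; rewrite xh1.
    by move=> e; rewrite -e; ring.
  have xe : x / h = t.+1%:R by apply/le_anti; rewrite xh2.
  have -> : T l = t.+1 by rewrite /T -xl xe natrK.
  rewrite xe subrr subr0 mulr1 mulr0 addr0 => ->.
  by rewrite -natr1; ring.
- have pl : n - 2 <= pot nu N (lam_of xi h N) 0 by exact: pot_lower0.
  apply: (@le_trans _ _ (n - 2)); last first.
    apply: (le_trans pl); rewrite ler_peMl//; last by rewrite lerDl divr_ge0// mulr_ge0// ltW.
    by apply: le_trans pl; move: nQ; rewrite /Q; have := normr_ge0 (f' 0 / f 0); have := ler0n R k; lra.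
  have : h * (f' 0 / f 0) <= `|f' 0 / f 0|.
    apply: (le_trans (ler_norm _)); rewrite normrM gtr0_norm// ler_piMl//; lra.
  have : h ^+ 2 / 6 * (h - xi') <= 1.
    apply: (@le_trans _ _ (h ^+ 2 / 6 * h)); first by rewrite ler_wpM2l//; lra.
    by have := ler_wpM2l (ltW h0) h2h; nra.
  move: nQ; rewrite /Q; have := ler0n R k; lra.
move=> t tN; have := pot_lower nu0 h0 hN xi_ge0 eps nnu tN.
set V := pot _ _ _ _ => pl; set kap := 1 + _.
have hxx : h ^+ 2 * (xi' / 18) <= 1.
  have : h ^+ 2 * xi' <= h * xi' by rewrite ler_wpM2r.
  have : h * (2 * xi') <= h * (xi' + (Q - xi')) by rewrite ler_wpM2l// ?ltW//; rewrite /Q; have := normr_ge0 (f' 0 / f 0); have := ler0n R k; lra.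
  by rewrite (_ : xi' + _ = Q); [lra | ring].
have kap1 : 1 <= kap by rewrite lerDl divr_ge0// mulr_ge0// ltW.
have kap2 : kap <= 2 by rewrite /kap; lra.
apply: le_trans (ler_wpM2l (le_trans ler01 kap1) pl).
rewrite -subr_ge0 (_ : _ - _ = (kap - 1) * (h ^+ 2 / 3 * (h * t%:R + h / 2)) +
  h ^+ 2 / 3 * ((xi' - xi) - kap * (h * nu) - (kap - 1) * xi - kap * (h ^+ 2 * xi ^+ 2 / 6))); last by field.
have ht0 : 0 <= h * t%:R by apply: mulr_ge0; [exact: ltW | exact: ler0n].
apply: addr_ge0; first by apply: mulr_ge0; [lra | apply: mulr_ge0; lra].
apply: mulr_ge0; first by rewrite divr_ge0// ltW.
have c1 : kap * (h * nu) <= 2 * (h * nu) by rewrite ler_wpM2r.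
have c2 : (kap - 1) * xi <= h * (xi' * xi / 18).
  have : h ^+ 2 * (xi' * xi / 18) <= h * (xi' * xi / 18) by rewrite ler_wpM2r//; lra.
  by rewrite /kap; lra.
have c3 : kap * (h ^+ 2 * xi ^+ 2 / 6) <= h * (xi ^+ 2 / 3).
  apply: (@le_trans _ _ (2 * (h ^+ 2 * xi ^+ 2 / 6))).
    by rewrite ler_wpM2r// divr_ge0// mulr_ge0// ltW.
  have : h ^+ 2 * (xi ^+ 2 / 3) <= h * (xi ^+ 2 / 3) by rewrite ler_wpM2r//; lra.
  lra.
by move: hK; rewrite /K; lra.
Qed.
End LowerBound.

(** * Estimates for test vectors *)

Section Helpers.
Variable R : realType.

(** The second difference is close to h^2 f''(x) when f'' is Lipschitz. *)
Lemma second_difference (f f' f'' : R -> R) (a b L x h : R) :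
  (forall x : R, is_derive x 1 f (f' x)) ->
  (forall x : R, is_derive x 1 f' (f'' x)) ->
  (forall u v, a <= u <= b -> a <= v <= b -> `|f'' u - f'' v| <= L * `|u - v|) ->
  0 <= L -> 0 <= h -> a <= x - h -> x + h <= b ->
  h ^+ 2 * f'' x - 2 * L * h ^+ 3 <= f (x + h) - 2 * f x + f (x - h).
Proof.
move=> df df' lip L0 h0 ax xb.
pose D s := f (x + s) + f (x - s) - s * s * f'' x.
pose D' s := f' (x + s) - f' (x - s) - 2 * s * f'' x.
have dD (s : R) : is_derive s 1 D (D' s).
  have d1 := isder_comp (f := f) (isderD (isder_cst s x) (isder_id s)) (df (x + s)).
  have d2 := isder_comp (f := f) (isderB (isder_cst s x) (isder_id s)) (df (x - s)).
  have d3 := isderM (isderM (isder_id s) (isder_id s)) (isder_cst s (f'' x)).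
  by apply: (is_derive_eq (isderB (isderD d1 d2) d3)); rewrite /D'; ring.
have [s /andP[s0 sh] e] := mvt h0 (fun s _ => dD s).
have ss : x - s <= x + s by lra.
have [y /andP[y1 y2] e'] := mvt ss (fun y _ => df' y).
have lp : `|f'' y - f'' x| <= L * s.
  apply: (le_trans (lip _ _ _ _)); [lra | lra |].
  by rewrite ler_wpM2l// ler_norml; lra.
move: lp; rewrite ler_norml => /andP[lp _].
have D's : - (2 * L * h ^+ 2) <= D' s.
  have -> : D' s = 2 * s * (f'' y - f'' x) by rewrite /D' e'; ring.
  apply: (@le_trans _ _ (2 * s * - (L * s))); last by rewrite ler_wpM2l//; lra.
  rewrite mulrN lerN2 (_ : 2 * s * (L * s) = 2 * L * s ^+ 2); last by ring.
  by rewrite ler_wpM2l ?mulr_ge0// lerXn2r// nnegrE.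
have : D h - D 0 >= - (2 * L * h ^+ 2) * h by rewrite e subr0 ler_wpM2r.
by rewrite /D addr0 !subr0 mul0r mul0r subr0 => H; rewrite -subr_ge0; lra.
Qed.

Lemma sum_by_parts (phi g : nat -> R) (N : nat) : g 0%N = 0 -> g N.+1 = 0 ->
  \sum_(t < N.+1) (phi t - phi t.+1) * (g t - g t.+1) =
  \sum_(t < N.+1) g t * (2 * phi t - phi t.+1 - phi t.-1).
Proof.
move=> g0 gN.
transitivity (\sum_(t < N.+1) g t * (phi t - phi t.+1) - \sum_(t < N.+1) g t.+1 * (phi t - phi t.+1)).
  by rewrite -sumrB; apply: eq_bigr => t _; ring.
rewrite [X in _ - X]big_ord_recr /= gN mul0r addr0.
rewrite big_ord_recl [RHS]big_ord_recl /= g0 !mul0r !add0r -sumrB.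
by apply: eq_bigr => t _; rewrite /bump /= add1n /=; ring.
Qed.

Lemma pos_part_sq (p q : R) :
  (Num.max p 0 - Num.max q 0) ^+ 2 <= (p - q) * (Num.max p 0 - Num.max q 0).
Proof.
rewrite expr2; case: (leP p 0) => hp; case: (leP q 0) => hq; nra.
Qed.

(** The form is diagonal on sequences whose supports are disjoint and not
    adjacent. *)
Lemma Tform_block (V : nat -> R) (N k : nat) (rho : 'I_k -> nat -> R) (a : 'I_k -> R) :
  (forall l m t, l != m -> [/\ rho l t * rho m t = 0, rho l t * rho m t.+1 = 0 &
     rho l t.+1 * rho m t.+1 = 0]) ->
  Tform N V (fun t => \sum_l a l * rho l t) = \sum_l a l ^+ 2 * Tform N V (rho l).
Proof.
move=> disj.
have sq (x : 'I_k -> R) : (forall l m, l != m -> x l * x m = 0) ->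
   (\sum_l a l * x l) ^+ 2 = \sum_l a l ^+ 2 * x l ^+ 2.
  move=> hx; rewrite expr2 mulr_suml; apply: eq_bigr => l _.
  rewrite mulr_sumr (bigD1 l)//= big1 ?addr0; first by ring.
  move=> m ml; have := hx m l ml => e.
  by rewrite (_ : _ * _ = a l * a m * (x m * x l)); [rewrite e mulr0 | ring].
rewrite /Tform.
under [RHS]eq_bigr do rewrite mulrDr !mulr_sumr.
rewrite big_split /=; congr (_ + _).
  rewrite exchange_big /=; apply: eq_bigr => t _.
  transitivity ((\sum_l a l * (rho l t - rho l t.+1)) ^+ 2).
    by rewrite -sumrB; congr (_ ^+ 2); apply: eq_bigr => l _; rewrite mulrBr.
  apply: (sq (fun l => rho l t - rho l t.+1)) => l m lm.
  have [e1 e2 e3] := disj l m t lm; have [] := disj m l t; [by rewrite eq_sym | move=> _ e4 _].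
  rewrite mulrBl !mulrBr e1 e2 e3 (mulrC (rho l t.+1)) e4; ring.
rewrite exchange_big /=; apply: eq_bigr => t _.
rewrite sq => [|l m lm]; last by have [] := disj l m t lm.
by rewrite mulr_sumr; apply: eq_bigr => l _; ring.
Qed.

(** For h t bounded the potential is at most its Airy approximation up to O(h^3). *)
Lemma pot_upper (nu xi h X : R) (N t : nat) : 0 < nu -> 0 < h -> h <= 1 ->
  N.+1%:R * h ^+ 3 = 24 -> 0 <= xi -> h ^+ 2 * xi / 12 <= 1 ->
  (X + 1) * h ^+ 2 <= 3 -> (0 < t <= N)%N -> h * t%:R <= X ->
  pot nu N (lam_of xi h N) t <= h ^+ 2 / 3 * (h * t%:R - xi) + h ^+ 3 * (1 + (X + 1) ^+ 2).
Proof.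
move=> nu0 h0 h1 hN xi0 eps hX; case: t => // t /= tN tX.
rewrite /lam_of; set n : R := N.+1%:R in hN *.
set T : R := t.+1%:R in tX *; set e := h ^+ 2 * xi / 12 in eps *.
have kE : (N - t.+1)%:R = n - 1 - T :> R.
  by rewrite /n /T -[in RHS]natr1 addrK natrB.
have k0 : 0 <= n - 1 - T by rewrite -kE.
rewrite kE; set k := n - 1 - T in k0 *.
have n0 : 0 < n by rewrite /n.
have T0 : 0 <= h * T by rewrite mulr_ge0// ltW.
have nn : n != 0 by rewrite gt_eqF.
pose s := (T + 1) / n.
have hh : h ^+ 3 = 24 / n by rewrite -hN; field.
have sE : s = (h * T + h) * h ^+ 2 / 24.
  rewrite (_ : (h * T + h) * h ^+ 2 = (T + 1) * h ^+ 3); last by ring.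
  by rewrite hh /s; field.
have h2 : 0 <= h ^+ 2 by exact: sqr_ge0.
have s0 : 0 <= s by rewrite sE divr_ge0// mulr_ge0//; lra.
have s8 : s <= 1 / 8.
  have : (h * T + h) * h ^+ 2 <= (X + 1) * h ^+ 2 by rewrite ler_wpM2r//; lra.
  by rewrite sE; lra.
have ks : k = n * (1 - s) by rewrite /s /k; field.
have e0 : 0 <= e by rewrite /e; apply: divr_ge0 => //; exact: mulr_ge0.
apply: (@le_trans _ _ (8 * s + 16 * s ^+ 2 - 4 * e)); last first.
  have -> : 16 * s ^+ 2 = (h * T + h) ^+ 2 * h ^+ 4 / 36 by rewrite sE; field.
  have : (h * T + h) ^+ 2 * h ^+ 4 <= (X + 1) ^+ 2 * h ^+ 3.
    have hT : h * T + h <= X + 1 by lra.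
    apply: ler_pM; [exact: sqr_ge0 | exact: exprn_ge0 (ltW h0) | |].
      by apply: lerXn2r; rewrite ?nnegrE //; lra.
    rewrite exprS; apply: ler_piMl => //; exact: exprn_ge0 (ltW h0).
  have : 0 <= (X + 1) ^+ 2 * h ^+ 3 by rewrite mulr_ge0 ?sqr_ge0// exprn_ge0// ltW.
  have : 0 <= h ^+ 3 by rewrite exprn_ge0// ltW.
  have -> : 8 * s = h ^+ 2 / 3 * (h * T) + h ^+ 3 / 3 by rewrite sE; field.
  by rewrite /e; lra.
have k1 : 0 < k by rewrite ks mulr_gt0//; lra.
have m0 : 0 < (k + nu) * (k + 1 + nu) by apply: mulr_gt0; lra.
rewrite lerBlDr ler_pdivrMr//.
have b1 : n ^+ 2 * (1 - s) ^+ 2 <= (k + nu) * (k + 1 + nu).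
  rewrite -exprMn -ks -subr_ge0 (_ : _ - _ = nu * (2 * k + 1 + nu) + k); last by ring.
  by apply: addr_ge0; [apply: mulr_ge0; lra | exact: ltW].
have s2 := sqr_ge0 s.
have b2 : 1 <= (1 - s) ^+ 2 * (1 + 2 * s + 4 * s ^+ 2).
  rewrite -subr_ge0 (_ : _ - _ = s ^+ 2 * ((1 - 6 * s) + 4 * s ^+ 2)); last by ring.
  by apply: mulr_ge0 => //; lra.
have b3 : (1 - e) * (1 + 2 * s + 4 * s ^+ 2) * 4 <= 8 * s + 16 * s ^+ 2 - 4 * e + 4.
  have : 0 <= e * (2 * s + 4 * s ^+ 2) by apply: mulr_ge0 => //; lra.
  lra.
have b4 : 0 <= (1 - e) * (1 + 2 * s + 4 * s ^+ 2) * 4.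
  by rewrite !mulr_ge0//; lra.
have n2 : 0 <= n ^+ 2 by exact: sqr_ge0.
apply: (@le_trans _ _ ((1 - e) * (1 + 2 * s + 4 * s ^+ 2) * 4 * (n ^+ 2 * (1 - s) ^+ 2))).
  rewrite [leRHS](_ : _ = 4 * n ^+ 2 * (1 - e) * ((1 - s) ^+ 2 * (1 + 2 * s + 4 * s ^+ 2))); last by ring.
  by rewrite ler_peMr// mulr_ge0 ?mulr_ge0//; lra.
apply: (@le_trans _ _ ((1 - e) * (1 + 2 * s + 4 * s ^+ 2) * 4 * ((k + nu) * (k + 1 + nu)))).
  by rewrite ler_wpM2l.
by rewrite ler_wpM2r// ltW.
Qed.

(** A lower Riemann sum for the integral of P over [u, v]; the sum of the lengths
    telescopes after clamping the nodes to [u, v]. *)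
Lemma sum_clamp_lower (h u v : R) (N : nat) (P : nat -> R) (c : R) :
  0 <= c -> 0 <= h -> 0 <= u -> u <= v -> v <= h * N.+1%:R ->
  (forall t, 0 <= P t) ->
  (forall t, u - h <= h * t%:R <= v -> c <= P t) ->
  c * (v - u) <= \sum_(t < N.+1) h * P t.
Proof.
move=> c0 h0 u0 uv vN P0 hP.
pose cl x := Num.max u (Num.min x v).
have tele n : c * (cl (h * n%:R) - u) <= \sum_(t < n) h * P t.
  elim: n => [|n IH].
    rewrite big_ord0 mulr0 (_ : cl 0 = u) ?subrr ?mulr0//.
    by apply/max_idPl; rewrite ge_min u0.
  rewrite big_ord_recr /=.
  suff : c * (cl (h * n.+1%:R) - cl (h * n%:R)) <= h * P n by lra.
  have e : h * n.+1%:R = h * n%:R + h by rewrite -natr1; ring.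
  have hPn : 0 <= h * P n by exact: mulr_ge0.
  rewrite e; have [uh|uh] := ltP (h * n%:R) (u - h).
    have cu x : x <= u -> cl x = u.
      by move=> xu; apply/max_idPl; rewrite ge_min xu.
    by rewrite !cu ?subrr ?mulr0//; lra.
  have [vh|vh] := ltP v (h * n%:R).
    have cv x : v <= x -> cl x = v.
      by move=> xv; rewrite /cl (min_idPr xv); apply/max_idPr.
    by rewrite !cv ?subrr ?mulr0//; lra.
  apply: (@le_trans _ _ (c * h)); last by rewrite mulrC ler_wpM2l// hP// uh.
  rewrite ler_wpM2l// /cl.
  have mx y w : w <= y + h -> Num.max u w - Num.max u y <= h.
    by case: (leP u w) => a1; case: (leP u y) => a2; lra.
  apply: mx; set x := h * n%:R.
  by case: (leP (x + h) v) => a1; case: (leP x v) => a2; lra.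
suff : cl (h * N.+1%:R) = v by move=> <-; exact: tele.
by rewrite /cl (min_idPr vN); apply/max_idPr.
Qed.

Lemma sum_indicator_upper (h i : R) (n : nat) : 0 <= h -> 0 <= i ->
  \sum_(t < n) h * (if h * t%:R < i then 1 else 0) <= i + h.
Proof.
move=> h0 i0.
suff : \sum_(t < n) h * (if h * t%:R < i then 1 else 0) <= Num.min (h * n%:R) (i + h).
  by rewrite le_min => /andP[].
elim: n => [|n IH]; first by rewrite big_ord0 mulr0 le_min lexx addr_ge0.
rewrite big_ord_recr /= -natr1 mulrDr mulr1.
move: IH; rewrite !le_min => /andP[IH1 IH2].
by case: ltP => hn; rewrite ?mulr1 ?mulr0; apply/andP; split; lra.
Qed.
End Helpers.

Section Bump.
Variable R : realType.

Lemma near_lt (f : R -> R) (x c : R) : {for x, continuous f} -> f x < c ->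
  exists2 e : R, 0 < e & forall y : R, `|x - y| < e -> f y < c.
Proof.
move=> cf fx; have fxc : 0 < c - f x by rewrite subr_gt0.
have /cvgrPdist_lt/(_ _ fxc)[e /= e0 he] := cf.
exists e => // y /he /=; rewrite ltr_norml => /andP[h1 h2]; lra.
Qed.

(** Energy of the truncation G of f - c, where f solves the Airy equation with
    parameter i < xi.  The form is bounded by the mixed sum of (D phi)(D G), to
    which summation by parts and the differential equation apply. *)
Lemma bump_terms (xi i c X L M h B : R) (f f' : R -> R) (N : nat) (G : nat -> R)
  (phi := fun t : nat => f (h * t%:R) - c) (V : nat -> R) :
  (forall x : R, is_derive x 1 f (f' x)) ->
  (forall x : R, is_derive x 1 f' ((x - i) / 3 * f x)) ->
  (forall u v, -1 <= u <= X + 1 -> -1 <= v <= X + 1 ->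
     `|(u - i) / 3 * f u - (v - i) / 3 * f v| <= L * `|u - v|) ->
  0 <= L -> 0 <= B -> 0 < h -> h <= 1 -> G 0%N = 0 -> G N.+1 = 0 ->
  (forall t, 0 <= G t) -> (forall t, G t <= M) ->
  (forall t, (G t - G t.+1) ^+ 2 <= (phi t - phi t.+1) * (G t - G t.+1)) ->
  (forall t, (t <= N)%N -> G t != 0 -> 0 <= h * t%:R <= X /\ G t = phi t) ->
  (forall t, (0 < t <= N)%N -> h * t%:R <= X ->
     V t <= h ^+ 2 / 3 * (h * t%:R - xi) + h ^+ 3 * B) ->
  Tform N V G <= - (h / 3) * \sum_(t < N.+1)
    h * (G t * ((xi - i) * G t + c * (h * t%:R - i) - (6 * L + 3 * B * M) * h)).
Proof.
move=> df df' lip L0 B0 h0 h1 G0 GN Gp GM Gd Gphi hV.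
rewrite /Tform.
apply: (@le_trans _ _ (\sum_(t < N.+1) (phi t - phi t.+1) * (G t - G t.+1) + \sum_(t < N.+1) V t * G t ^+ 2)).
  by rewrite lerD2r; apply: ler_sum.
rewrite sum_by_parts// -big_split /= mulr_sumr; apply: ler_sum => t _.
have tN : (t <= N)%N by rewrite -ltnS.
have [->|Gt] := eqVneq (G t) 0; first by rewrite !mul0r expr0n !mulr0 addr0.
have [/andP[x0 xX] Gt'] := Gphi _ tN Gt.
have t0 : (0 < t)%N by rewrite lt0n; apply: contra_neq Gt => ->.
have tt : (0 < t <= N)%N by rewrite t0.
have hVt := hV t tt xX.
have xm : h * t%:R - h = h * t.-1%:R.
  by rewrite -[in LHS](prednK t0) -natr1; ring.
have xp : h * t%:R + h = h * t.+1%:R by rewrite -natr1; ring.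
have m1 : -1 <= h * t%:R - h by lra.
have p1 : h * t%:R + h <= X + 1 by lra.
have := second_difference df df' lip L0 (ltW h0) m1 p1.
rewrite xm xp => sd.
have gt0 := Gp t; have gM := GM t.
set x := h * t%:R in x0 xX hVt sd *.
have fx : f x = G t + c by rewrite Gt' /phi -/x; ring.
rewrite fx in sd.
set g := G t in gt0 gM sd fx *.
have b1 : g * (2 * phi t - phi t.+1 - phi t.-1) <=
  g * (2 * L * h ^+ 3 - h ^+ 2 * ((x - i) / 3 * (g + c))).
  by rewrite ler_wpM2l// /phi -/x fx; lra.
have b2 : V t * g ^+ 2 <= (h ^+ 2 / 3 * (x - xi) + h ^+ 3 * B) * g ^+ 2.
  by rewrite ler_wpM2r// sqr_ge0.
have b3 : h ^+ 3 * B * g * g <= h ^+ 3 * B * M * g.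
  rewrite ler_wpM2r// ler_wpM2l// mulr_ge0// exprn_ge0//; exact: ltW.
apply: (le_trans (lerD b1 b2)).
rewrite -subr_ge0.
rewrite (_ : _ - _ = h ^+ 3 * B * M * g - h ^+ 3 * B * g * g); last by field.
by rewrite subr_ge0.
Qed.

(** The sum in bump_terms is positive: d G^2 dominates, as G >= c0 on an interval
    of length 2 r, whereas c G (x - i) is negative for x < i only, where completing
    the square bounds it by a multiple of c^2, and the error C h is small. *)
Lemma bump_sum (d i c c0 C M X r m h : R) (N : nat) (G : nat -> R) :
  0 < d -> 0 <= i -> 0 < c -> 0 < c0 -> 0 <= C -> 0 <= M -> 0 <= X -> 0 < r -> 0 <= m - r ->
  0 < h -> h <= 1 -> m + r <= h * N.+1%:R ->
  c ^+ 2 * (i ^+ 2 * (i + 1)) <= d ^+ 2 * r * c0 ^+ 2 ->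
  h * (C * M * (X + 2)) < d * r * c0 ^+ 2 / 2 ->
  (forall t, 0 <= G t) -> (forall t, G t <= M) ->
  (forall t, X < h * t%:R -> G t = 0) ->
  (forall t, m - r - h <= h * t%:R <= m + r -> c0 <= G t) ->
  0 < \sum_(t < N.+1) h * (G t * (d * G t + c * (h * t%:R - i) - C * h)).
Proof.
move=> d0 i0 c_0 c00 C0 M0 X0 r0 mr h0 h1 mN hc hh Gp GM GX Gc.
have s1 : c0 ^+ 2 * (2 * r) <= \sum_(t < N.+1) h * G t ^+ 2.
  rewrite (_ : 2 * r = (m + r) - (m - r)); last by ring.
  apply: (@sum_clamp_lower R h (m - r) (m + r) N (fun t => G t ^+ 2) (c0 ^+ 2) (sqr_ge0 _) (ltW h0) mr _ mN); first lra.
  - by move=> t; exact: sqr_ge0.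
  - by move=> t ht; apply: lerXn2r; rewrite ?nnegrE ?(ltW c00)// Gc.
have s2 := @sum_indicator_upper R h i N.+1 (ltW h0) i0.
have X1 : 0 <= X + 1 by lra.
have s3 := @sum_indicator_upper R h (X + 1) N.+1 (ltW h0) X1.
pose I1 t : R := if h * t%:R < i then 1 else 0.
pose I2 t : R := if h * t%:R < X + 1 then 1 else 0.
pose K := c ^+ 2 * i ^+ 2 / (2 * d).
have K0 : 0 <= K by rewrite /K; apply: divr_ge0; [exact: mulr_ge0 (sqr_ge0 _) (sqr_ge0 _) | lra].
apply: (@lt_le_trans _ _ (d / 2 * (\sum_(t < N.+1) h * G t ^+ 2) - K * (\sum_(t < N.+1) h * I1 t)
   - C * h * M * (\sum_(t < N.+1) h * I2 t))); last first.
  rewrite !mulr_sumr -!sumrB; apply: ler_sum => t _.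
  set g := G t; set x := h * t%:R.
  have g0 : 0 <= g := Gp t. have gM : g <= M := GM t.
  have e1 : d / 2 * g ^+ 2 - K * I1 t <= g * (d * g + c * (x - i)).
    have q : 0 <= (d * g - c * i) ^+ 2 / (2 * d) by apply: divr_ge0; [exact: sqr_ge0 | lra].
    have xx0 : 0 <= x := mulr_ge0 (ltW h0) (ler0n _ t).
    have x0 : 0 <= c * x * g := mulr_ge0 (mulr_ge0 (ltW c_0) xx0) g0.
    rewrite /I1 -/x; case: ltP => xi.
      rewrite mulr1 -subr_ge0 (_ : _ - _ = c * x * g + (d * g - c * i) ^+ 2 / (2 * d)).
        exact: addr_ge0.
      by rewrite /K; field; rewrite gt_eqF.
    have : 0 <= c * (x - i) * g.
      by apply: mulr_ge0 => //; apply: mulr_ge0; [exact: ltW | rewrite subr_ge0].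
    have : 0 <= d * g ^+ 2 := mulr_ge0 (ltW d0) (sqr_ge0 g).
    rewrite mulr0; lra.
  have e2 : g <= M * I2 t.
    rewrite /I2 -/x; case: ltP => xX; rewrite ?mulr1 ?mulr0//.
    by rewrite /g GX// -/x; lra.
  have e3 : h * (C * h * g) <= C * h * M * (h * I2 t).
    rewrite [leRHS](_ : _ = h * (C * h * (M * I2 t))); last by ring.
    apply: ler_wpM2l; first exact: ltW.
    by apply: ler_wpM2l => //; apply: mulr_ge0 => //; exact: ltW.
  have e4 := ler_wpM2l (ltW h0) e1.
  lra.
have t1 : K * (\sum_(t < N.+1) h * I1 t) <= d * r * c0 ^+ 2 / 2.
  apply: (@le_trans _ _ (K * (i + 1))); first by rewrite ler_wpM2l// (le_trans s2)//; lra.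
  rewrite /K -subr_ge0 (_ : _ - _ = (d ^+ 2 * r * c0 ^+ 2 - c ^+ 2 * (i ^+ 2 * (i + 1))) / (2 * d)).
    by rewrite divr_ge0 ?subr_ge0//; lra.
  by field; rewrite gt_eqF.
have t2 : C * h * M * (\sum_(t < N.+1) h * I2 t) <= h * (C * M * (X + 2)).
  rewrite [leRHS](_ : _ = C * h * M * (X + 2)); last by ring.
  apply: ler_wpM2l; first by apply: mulr_ge0 => //; apply: mulr_ge0 => //; exact: ltW.
  by apply: (le_trans s3); lra.
have t3 : d * r * c0 ^+ 2 <= d / 2 * (\sum_(t < N.+1) h * G t ^+ 2).
  rewrite [leLHS](_ : _ = d / 2 * (c0 ^+ 2 * (2 * r))); last by field.
  by rewrite ler_wpM2l//; lra.
lra.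
Qed.
End Bump.

Section BumpExists.
Variable R : realType.

(** The part above the level c of f, restricted to [a, X]. *)
Definition cutoff (f : R -> R) (c a X x : R) : R :=
  if (a <= x) && (x <= X) then Num.max (f x - c) 0 else 0.

Lemma cutoff_ge0 f c a X x : 0 <= cutoff f c a X x.
Proof. by rewrite /cutoff; case: ifP => // _; rewrite le_max lexx orbT. Qed.

Lemma cutoff_le f c a X x M : 0 <= c -> 0 <= M ->
  (a <= x <= X -> `|f x| <= M) -> cutoff f c a X x <= M.
Proof.
move=> c0 M0 hM; rewrite /cutoff; case: ifP => // /hM h.
by rewrite ge_max M0 andbT; have := ler_norm (f x); lra.
Qed.

(** If f < c at both ends of [a, X], the support of the truncation keeps a distance
    from the ends, and the restriction is not felt near X. *)
Lemma cutoff_margin (f : R -> R) (c a X : R) :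
  {for a, continuous f} -> {for X, continuous f} -> f a < c -> f X < c -> a <= X ->
  exists2 gam : R, 0 < gam &
    (forall x, cutoff f c a X x != 0 ->
       [/\ a + 2 * gam < x, x < X - 2 * gam & cutoff f c a X x = f x - c]) /\
    (forall x, a <= x <= X + 2 * gam -> cutoff f c a X x = Num.max (f x - c) 0).
Proof.
move=> ca cX fa fX aX.
have [e1 e10 he1] := near_lt ca fa.
have [e2 e20 he2] := near_lt cX fX.
pose gam := Num.min (e1 / 4) (e2 / 4).
have gam0 : 0 < gam by rewrite lt_min; apply/andP; split; lra.
have gam1 : gam <= e1 / 4 by rewrite ge_min lexx.
have gam2 : gam <= e2 / 4 by rewrite ge_min lexx orbT.
clearbody gam.
have fa2 x : a - 2 * gam <= x <= a + 2 * gam -> f x < c.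
  by move=> hx; apply: he1; rewrite ltr_norml; lra.
have fX2 x : X - 2 * gam <= x <= X + 2 * gam -> f x < c.
  by move=> hx; apply: he2; rewrite ltr_norml; lra.
exists gam => //; split => x; last first.
  move=> /andP[ax xX]; rewrite /cutoff ax /=; case: leP => // xX'.
  have /fX2 fc : X - 2 * gam <= x <= X + 2 * gam by lra.
  by apply/esym/max_idPr; lra.
rewrite /cutoff; case: ifP => [/andP[ax xX]|]; last by rewrite eqxx.
case: (leP (f x - c) 0) => [_|fc _]; first by rewrite eqxx.
split => //; rewrite ltNge; apply/negP => hx.
  have /fa2 : a - 2 * gam <= x <= a + 2 * gam by lra.
  by lra.
have /fX2 : X - 2 * gam <= x <= X + 2 * gam by lra.
by lra.
Qed.

Lemma cutoff_diff (f : R -> R) (c a X gam h x : R) : 0 < h -> h < gam ->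
  (forall x, cutoff f c a X x != 0 ->
       [/\ a + 2 * gam < x, x < X - 2 * gam & cutoff f c a X x = f x - c]) ->
  (forall x, a <= x <= X + 2 * gam -> cutoff f c a X x = Num.max (f x - c) 0) ->
  (cutoff f c a X x - cutoff f c a X (x + h)) ^+ 2 <=
    ((f x - c) - (f (x + h) - c)) * (cutoff f c a X x - cutoff f c a X (x + h)).
Proof.
move=> h0 hg gn gE.
have [e|ne] := eqVneq (cutoff f c a X x) 0; last first.
  have [q1 q2 _] := gn _ ne; rewrite !gE; [exact: pos_part_sq | lra | lra].
have [e'|ne'] := eqVneq (cutoff f c a X (x + h)) 0.
  by rewrite e e' subrr expr0n mulr0.
have [q1 q2 _] := gn _ ne'; rewrite !gE; [exact: pos_part_sq | lra | lra].
Qed.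

(** As n h^3 = 24, the rescaled length h n = 24 / h^2 of the grid is large when h is
    small. *)
Lemma small_step (h K : R) (N : nat) : 0 < h -> h < 1 -> h * K < 1 -> 0 < K ->
  N.+1%:R * h ^+ 3 = 24 ->
  K < h * N.+1%:R /\ forall y, 0 <= y <= K -> h ^+ 2 * y < 1.
Proof.
move=> h0 h1 hK K0 hN.
have h2 : 0 < h ^+ 2 := exprn_gt0 _ h0.
have h2h : h ^+ 2 <= h by rewrite expr2 ler_piMl// ltW.
have hb y : 0 <= y <= K -> h ^+ 2 * y < 1.
  move=> /andP[y0 yK]; have : h * y <= h * K by rewrite ler_wpM2l// ltW.
  have : h ^+ 2 * y <= h * y by rewrite ler_wpM2r.
  lra.
split => //; rewrite -(ltr_pM2l h2) [ltRHS](_ : _ = N.+1%:R * h ^+ 3); last by ring.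
by rewrite hN; have := hb K; rewrite ltW//= lexx => /(_ isT); lra.
Qed.

Lemma airy_rhs_lipschitz (f f' : R -> R) (i a b : R) :
  (forall x : R, is_derive x 1 f (f' x)) ->
  (forall x : R, is_derive x 1 f' ((x - i) / 3 * f x)) ->
  exists2 L : R, 0 < L & forall u v : R, a <= u <= b -> a <= v <= b ->
     `|(u - i) / 3 * f u - (v - i) / 3 * f v| <= L * `|u - v|.
Proof.
move=> df df'.
pose F3 x := 1 / 3 * (f x + (x - i) * f' x).
have dF2 (x : R) : is_derive x 1 (fun y => (y - i) / 3 * f y) (F3 x).
  have := isderM (isderZ (1 / 3) (isderB (isder_id x) (isder_cst x i))) (df x).
  rewrite (_ : (fun y => _) = (fun y => (y - i) / 3 * f y)); last first.
    by apply/funext => y; field.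
  by move=> hd; apply: (is_derive_eq hd); rewrite /F3; field.
have cF3 (x : R) : {for x, continuous F3}.
  exact: (der_continuous (isderZ (1 / 3) (isderD (df x) (isderM (isderB (isder_id x) (isder_cst x i)) (df' x))))).
have [L L0 hL] := bounded_on (a := a) (b := b) (fun x _ => cF3 x).
exists L => // u v.
wlog uv : u v / v <= u.
  move=> H hu hv; have [uv|/ltW vu] := leP v u; first exact: H.
  by rewrite distrC (distrC u); exact: H.
move=> hu hv; have [y hy ->] := mvt uv (fun y _ => dF2 y).
by rewrite normrM ler_wpM2r// hL//; lra.
Qed.

(** The truncation of f at level c has negative energy for all small h.  The
    interval [m - 2 r, m + r], where f >= 2 c0, lies in the nodal interval, and M
    and L bound f and the Lipschitz constant of f'' near [a, X]. *)
Lemma bump_negative (nu xi i a m r c0 c X gam L M h : R) (f f' : R -> R) (N : nat) :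
  let C := 6 * L + 3 * (1 + (X + 1) ^+ 2) * M in
  let K := xi + X + m + r + 1 in
  0 < nu -> 0 <= i -> i < xi ->
  (forall x : R, is_derive x 1 f (f' x)) ->
  (forall x : R, is_derive x 1 f' ((x - i) / 3 * f x)) ->
  0 <= a -> 0 < r -> 0 < c0 -> a <= m - 2 * r ->
  (forall x : R, m - 2 * r <= x <= m + r -> 2 * c0 <= f x) ->
  0 < c -> c <= c0 ->
  c ^+ 2 * (i ^+ 2 * (i + 1)) <= (xi - i) ^+ 2 * r * c0 ^+ 2 ->
  m + r < X -> 0 < gam ->
  (forall x, cutoff f c a X x != 0 ->
       [/\ a + 2 * gam < x, x < X - 2 * gam & cutoff f c a X x = f x - c]) ->
  (forall x, a <= x <= X + 2 * gam -> cutoff f c a X x = Num.max (f x - c) 0) ->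
  0 <= L ->
  (forall u v : R, -1 <= u <= X + 1 -> -1 <= v <= X + 1 ->
     `|(u - i) / 3 * f u - (v - i) / 3 * f v| <= L * `|u - v|) ->
  0 <= M -> (forall x, cutoff f c a X x <= M) ->
  0 < h -> h < 1 -> h < r -> h < gam -> h * K < 1 ->
  h * (C * M * (X + 2)) < (xi - i) * r * c0 ^+ 2 / 2 ->
  N.+1%:R * h ^+ 3 = 24 ->
  X < h * N.+1%:R /\
  Tform N (pot nu N (lam_of xi h N)) (fun t => cutoff f c a X (h * t%:R)) < 0.
Proof.
move=> C K nu0 i0 ixi df df' a0 r0 c00 am fm c_0 cc0 hc mX gam0 gn gE L0 lip M0 gM
  h0 h1 hr hgam hK hC hN.
have K0 : 0 < K by clear -am a0 r0 mX ixi i0; rewrite /K; lra.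
have [KN hb] := small_step h0 h1 hK K0 hN.
have X0 : 0 <= X by clear -mX am a0 r0; lra.
have XK : 0 <= X + 1 <= K by clear -mX am a0 r0 ixi i0; rewrite /K; lra.
have mrK : m + r <= K by clear -mX am a0 r0 ixi i0; rewrite /K; lra.
have XN : X < h * N.+1%:R by clear -KN XK; lra.
split => //.
set g := cutoff f c a X in gn gE gM *.
pose G t := g (h * t%:R).
have gX x : X < x -> g x = 0.
  move=> xX; apply/eqP; apply: contraT => /gn [_ h3 _].
  by clear -h3 xX gam0; lra.
have gz : g 0 = 0.
  apply/eqP; apply: contraT => /gn [h3 _ _].
  by clear -h3 a0 gam0; lra.
have xi0 : 0 <= xi by clear -i0 ixi; lra.
have epsb : h ^+ 2 * xi < 1 by apply: hb; clear -mX am a0 r0 ixi i0; rewrite /K; lra.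
have eps : h ^+ 2 * xi / 12 <= 1 by clear -epsb; lra.
have Xh : (X + 1) * h ^+ 2 <= 3 by have := hb _ XK; clear; rewrite mulrC; lra.
have hV t : (0 < t <= N)%N -> h * t%:R <= X ->
   pot nu N (lam_of xi h N) t <=
   h ^+ 2 / 3 * (h * t%:R - xi) + h ^+ 3 * (1 + (X + 1) ^+ 2).
  by move=> tN tX; exact: (pot_upper nu0 h0 (ltW h1) hN xi0 eps Xh).
have Gd t : (G t - G t.+1) ^+ 2 <=
    ((f (h * t%:R) - c) - (f (h * t.+1%:R) - c)) * (G t - G t.+1).
  have hS : h * t.+1%:R = h * t%:R + h by rewrite -natr1; ring.
  by rewrite /G hS; exact: cutoff_diff hgam gn gE.
have Gphi t : (t <= N)%N -> G t != 0 -> 0 <= h * t%:R <= X /\ G t = f (h * t%:R) - c.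
  by move=> _ /gn [q1 q2 q3]; split => //; clear -q1 q2 a0 gam0; lra.
have G0 : G 0%N = 0 by rewrite /G mulr0.
have GN : G N.+1 = 0 by rewrite /G gX.
have B0 : 0 <= 1 + (X + 1) ^+ 2 by rewrite addr_ge0 ?sqr_ge0.
have := @bump_terms R xi i c X L M h (1 + (X + 1) ^+ 2) f f' N G _ df df' lip L0 B0 h0 (ltW h1) G0 GN
  (fun t => cutoff_ge0 _ _ _ _ _) (fun t => gM _) Gd Gphi hV.
move=> /le_lt_trans; apply.
rewrite mulNr oppr_lt0; apply: mulr_gt0; first by clear -h0; lra.
have C0 : 0 <= C.
  have : 0 <= (1 + (X + 1) ^+ 2) * M by exact: mulr_ge0.
  by clear -L0; rewrite /C; lra.
apply: (@bump_sum R (xi - i) i c c0 C M X r m h N G) => //.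
- by clear -ixi; lra.
- by clear -am a0 r0; lra.
- exact: ltW.
- by clear -KN mrK; lra.
- by move=> t; exact: cutoff_ge0.
- by move=> t; exact: gM.
- by move=> t; exact: gX.
move=> t ht.
have ht' : m - 2 * r <= h * t%:R <= m + r by clear -ht hr; lra.
have hf := fm _ ht'; rewrite /G gE; last by clear -ht' am r0 mX gam0; lra.
by rewrite le_max; apply/orP; left; clear -hf cc0; lra.
Qed.

(** On a nodal interval with left end a, where f gets arbitrarily small towards
    the right end, some truncation level c meets all requirements. *)
Lemma bump_exists (nu xi i a m r c0 : R) (f f' : R -> R) :
  0 < nu -> 0 <= i -> i < xi ->
  (forall x : R, is_derive x 1 f (f' x)) ->
  (forall x : R, is_derive x 1 f' ((x - i) / 3 * f x)) ->
  0 <= a -> f a <= 0 -> 0 < r -> 0 < c0 -> a <= m - 2 * r ->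
  (forall x : R, m - 2 * r <= x <= m + r -> 2 * c0 <= f x) ->
  (forall c : R, 0 < c -> exists X : R,
     [/\ m + r < X, f X < c & forall x : R, a < x <= X -> 0 < f x]) ->
  exists (g : R -> R) (lo hi h1 : R),
    [/\ a < lo, 0 < h1, forall x : R, a < x <= hi -> 0 < f x,
        forall x : R, g x != 0 -> lo <= x <= hi &
        forall (h : R) (N : nat), 0 < h < h1 -> N.+1%:R * h ^+ 3 = 24 ->
          hi < h * N.+1%:R /\
          Tform N (pot nu N (lam_of xi h N)) (fun t => g (h * t%:R)) < 0].
Proof.
move=> nu0 i0 ixi df df' a0 fa r0 c00 am fm esc.
pose d := xi - i; have d0 : 0 < d by rewrite /d; lra.
have S0 := sqr_ge0 i.
have S1 : 0 <= i ^+ 2 * (i + 1) by apply: mulr_ge0 => //; lra.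
(* the ratio c / c0 of the truncation level to the height of f *)
pose kap := Num.min 1 (d ^+ 2 * r / (i ^+ 2 * (i + 1) + 1)).
have D2 : 0 < d ^+ 2 * r by apply: mulr_gt0 => //; exact: exprn_gt0.
have kap0 : 0 < kap by rewrite lt_min ltr01 divr_gt0//; lra.
have kap1 : kap <= 1 by rewrite ge_min lexx.
have kapd : kap * (i ^+ 2 * (i + 1)) <= d ^+ 2 * r.
  have : kap <= d ^+ 2 * r / (i ^+ 2 * (i + 1) + 1) by rewrite ge_min lexx orbT.
  rewrite ler_pdivlMr; lra.
pose c := c0 * kap.
have c_0 : 0 < c by exact: mulr_gt0.
have cc0 : c <= c0 by rewrite ler_piMr// ltW.
have hc : c ^+ 2 * (i ^+ 2 * (i + 1)) <= d ^+ 2 * r * c0 ^+ 2.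
  rewrite [leLHS](_ : _ = c0 ^+ 2 * (kap ^+ 2 * (i ^+ 2 * (i + 1)))); last by rewrite /c; ring.
  rewrite [leRHS]mulrC; apply: ler_wpM2l; first exact: sqr_ge0.
  apply: (le_trans _ kapd); rewrite ler_wpM2r// expr2 ler_piMl//; exact: ltW.
clearbody c; clear kapd kap1 kap0 kap S0 S1 D2.
have [X [mX fX fpos]] := esc _ c_0.
have aX : a <= X by lra.
have cf (x : R) : {for x, continuous f} := der_continuous (df x).
have [gam gam0 [gn gE]] := cutoff_margin (cf a) (cf X) (le_lt_trans fa c_0) fX aX.
have [M M0 hM] := bounded_on (a := -1) (b := X + 1) (fun x _ => cf x).
have [L L0 lip] := airy_rhs_lipschitz (-1) (X + 1) df df'.
have gM x : cutoff f c a X x <= M.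
  apply: cutoff_le; [exact: ltW | exact: ltW |].
  by move=> /andP[ax xX]; apply: hM; clear -ax xX a0; lra.
pose C := 6 * L + 3 * (1 + (X + 1) ^+ 2) * M.
pose K := xi + X + m + r + 1.
have X0 : 0 <= X by clear -mX am a0 r0; lra.
have CMX : 0 <= C * M * (X + 2).
  have : 0 <= (1 + (X + 1) ^+ 2) * M.
    by apply: mulr_ge0; [apply: addr_ge0 => //; exact: sqr_ge0 | exact: ltW].
  move=> BM; apply: mulr_ge0; last by clear -X0; lra.
  by apply: mulr_ge0; [clear -L0 BM; rewrite /C; lra | exact: ltW].
have dr : 0 < d * r * c0 ^+ 2 / 2.
  by apply: divr_gt0 => //; apply: mulr_gt0; [exact: mulr_gt0 | exact: exprn_gt0].
have K0 : 0 < K by clear -am a0 r0 mX ixi i0; rewrite /K; lra.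
have CM1 : 0 < C * M * (X + 2) + 1 by clear -CMX; lra.
exists (cutoff f c a X), (a + gam), X,
  (Num.min (Num.min 1 r) (Num.min gam (Num.min (1 / K) ((d * r * c0 ^+ 2 / 2) / (C * M * (X + 2) + 1))))).
split => //.
- by rewrite ltrDl.
- by rewrite !lt_min ltr01 r0 gam0 (divr_gt0 ltr01 K0) (divr_gt0 dr CM1).
- by move=> x /gn [q1 q2 _]; clear -q1 q2 gam0; lra.
move=> h N /andP[h0]; rewrite !lt_min => /andP[/andP[h1 hr] /and3P[hgam hK hC]] hN.
apply: (@bump_negative nu xi i a m r c0 c X gam L M h f f' N) => //; try exact: ltW.
  by move: hK; rewrite ltr_pdivlMr.
by move: hC; rewrite ltr_pdivlMr// -/C -/d; clear -h0; lra.
Qed.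
End BumpExists.

(** * Upper bound for the eigenvalues *)

Section UpperBound.
Variable R : realType.

Lemma fin_lower_bound (I : finType) (u : I -> R) : (forall i, 0 < u i) ->
  exists2 e : R, 0 < e & forall i, e <= u i.
Proof.
move=> u0; exists (\big[Num.min/1]_i u i); last by move=> i; exact: bigmin_le.
by apply: (big_ind (fun x : R => 0 < x)) => // x y x0 y0; rewrite lt_min x0.
Qed.

(** A test function g, supported in [lo, hi] with a < lo, whose samples have
    negative energy for all steps h < h1.  The positivity of f on (a, hi] locates
    the support before the next zero of f to the right of a. *)
Definition negative_bump (nu xi a : R) (f : R -> R) (p : (R -> R) * R * R * R) : Prop :=
  let: (g, lo, hi, h1) := p in
  [/\ a < lo, 0 < h1, forall x : R, a < x <= hi -> 0 < f x,
      forall x : R, g x != 0 -> lo <= x <= hi &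
      forall (h : R) (N : nat), 0 < h < h1 -> N.+1%:R * h ^+ 3 = 24 ->
        hi < h * N.+1%:R /\
        Tform N (pot nu N (lam_of xi h N)) (fun t => g (h * t%:R)) < 0].

(** The k + 1 test functions are separated, since F l is not positive at the start
    of any later one; so their samples span a space of dimension k + 1 on which
    the form is negative definite once h is below all gaps. *)
Lemma eigenvalue_upper_of_bumps (nu xi : R) (k : nat) (a : 'I_k.+1 -> R)
    (F : 'I_k.+1 -> R -> R) :
  0 < nu -> 0 <= xi ->
  (forall l m : 'I_k.+1, (l < m)%N -> a l < a m /\ F l (a m) <= 0) ->
  (forall l, exists p, negative_bump nu xi (a l) (F l) p) ->
  exists2 h1 : R, 0 < h1 & forall (N : nat) (h : R),
    0 < h < h1 -> N.+1%:R * h ^+ 3 = 24 ->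
    (eigenvalues (L_matrix nu N.+1))`_k < (lam_of xi h N)^-1.
Proof.
move=> nu0 xi0 aF /choice[p hp].
pose g l := (p l).1.1.1; pose lo l := (p l).1.1.2; pose hi l := (p l).1.2.
pose hh l := (p l).2.
have {}hp l : [/\ a l < lo l, 0 < hh l, forall x : R, a l < x <= hi l -> 0 < F l x,
      forall x : R, g l x != 0 -> lo l <= x <= hi l &
      forall (h : R) (N : nat), 0 < h < hh l -> N.+1%:R * h ^+ 3 = 24 ->
        hi l < h * N.+1%:R /\
        Tform N (pot nu N (lam_of xi h N)) (fun t => g l (h * t%:R)) < 0].
  by have := hp l; rewrite /negative_bump /g /lo /hi /hh; case: (p l) => [[[? ?] ?] ?].
have sep (l m : 'I_k.+1) : (l < m)%N -> hi l < lo m.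
  move=> lm; have [am Fm] := aF _ _ lm; have [_ _ pos _ _] := hp l.
  have [lom _ _ _ _] := hp m; apply: le_lt_trans lom; rewrite leNgt; apply/negP => ham.
  by have := pos (a m); rewrite am (ltW ham) => /(_ isT); rewrite ltNge Fm.
have [e1 e10 he1] := fin_lower_bound (u := hh) (fun l => let: And5 _ q _ _ _ := hp l in q).
pose gp (lm : 'I_k.+1 * 'I_k.+1) := if (lm.1 < lm.2)%N then lo lm.2 - hi lm.1 else 1.
have gp0 lm : 0 < gp lm by rewrite /gp; case: ifP => // /sep; rewrite subr_gt0.
have [e2 e20 he2] := fin_lower_bound gp0.
pose K := xi + k%:R + 1.
have k0 : 0 <= k%:R :> R by [].
have K0 : 0 < K by rewrite /K; lra.
exists (Num.min (Num.min e1 e2) (Num.min (1 / 2) (1 / K))).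
  by rewrite !lt_min e10 e20 !divr_gt0.
move=> N h /andP[h0]; rewrite !lt_min => /andP[/andP[h_1 h_2] /andP[h_3 h_4]] hN.
have h1 : h < 1 by lra.
have hK : h * K < 1 by move: h_4; rewrite ltr_pdivlMr.
have [KN hb] := small_step h0 h1 hK K0 hN.
have kN : (k <= N)%N.
  rewrite -ltnS -(ltr_nat R); have : h * N.+1%:R <= N.+1%:R by rewrite ler_piMl// ltW.
  by move: KN xi0; rewrite /K; clear; lra.
have lam0 : 0 < lam_of xi h N.
  have hx : h ^+ 2 * xi < 1.
    by apply: hb; move: xi0 k0; rewrite /K; clear; lra.
  rewrite /lam_of; apply: mulr_gt0; last by clear -hx; lra.
  by apply: mulr_gt0 => //; exact: exprn_gt0.
pose rho l t := g l (h * t%:R).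
have hl l : 0 < h < hh l by rewrite h0 (lt_le_trans h_1).
apply: (@eigenvalue_lt_of_Tform _ _ _ _ _ nu0 lam0 kN rho).
  move=> l t tN; have [_ _ _ supp /(_ _ _ (hl l) hN)[hiN _]] := hp l.
  apply/eqP; apply: contraT => /supp /andP[_ xh]; move: hiN; rewrite ltNge => /negP; case.
  by apply: le_trans xh; rewrite ler_wpM2l ?ler_nat// ltW.
have far l m x y : l != m -> `|x - y| <= h -> g l x * g m y = 0.
  move=> lm xy; apply/eqP; rewrite mulf_eq0; apply/negPn; rewrite negb_or.
  apply/negP => /andP[gx gy].
  have [_ _ _ /(_ _ gx) sx _] := hp l; have [_ _ _ /(_ _ gy) sy _] := hp m.
  move: xy; rewrite ler_norml => xy.
  case: (ltngtP l m) => [lt|gt|eq]; last by move/val_inj: eq lm => ->; rewrite eqxx.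
    have := he2 (l, m); rewrite /gp /= lt => q; clear -q sx sy xy h_2; lra.
  have := he2 (m, l); rewrite /gp /= gt => q; clear -q sx sy xy h_2; lra.
move=> b b0; rewrite (@Tform_block R _ N k.+1 rho (fun l => b 0 l)); last first.
  move=> l m t lm.
  have hS : h * t.+1%:R = h * t%:R + h by rewrite -natr1; ring.
  split; apply: far => //; rewrite ?hS ?subrr ?normr0 ?(ltW h0)//.
  by rewrite opprD addNKr normrN gtr0_norm.
have neg l : Tform N (pot nu N (lam_of xi h N)) (rho l) < 0.
  by have [_ _ _ _ /(_ _ _ (hl l) hN)[_ hneg]] := hp l.
have [l bl] : exists l, b 0 l != 0.
  apply/existsP; apply: contraNT b0 => /existsPn H; apply/eqP/rowP => l.
  by rewrite mxE; apply/eqP; have := H l; rewrite negbK.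
rewrite (bigD1 l)//= -[ltRHS]addr0; apply: ltr_leD.
  by rewrite nmulr_llt0// exprn_even_gt0.
apply: sumr_le0 => m _; apply: mulr_ge0_le0; [exact: sqr_ge0 | exact: ltW].
Qed.
End UpperBound.

(** * Entire power series and the equation u'' = (x / 3) u *)

Section EntireSeries.
Variable R : realType.
Implicit Types (c d : nat -> R) (x y : R).

(** Coefficient sequences decaying faster than every geometric sequence: the
    power series converges everywhere. *)
Definition superdecay c := forall rho : R, 0 < rho ->
  exists2 C : R, 0 <= C & forall e, `|c e| <= C * rho ^+ e.

(** The sum of the power series with coefficients c at x. *)
Definition psersum c x : R := limn (pseries c x).

Lemma superdecay_cvg c x : superdecay c -> cvgn (pseries c x).
Proof.
move=> hc; pose rho := (2 * (`|x| + 1))^-1.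
have x1 : 0 < `|x| + 1 by rewrite ltr_wpDl.
have rho0 : 0 < rho by rewrite invr_gt0 mulr_gt0.
have [C C0 hC] := hc rho rho0.
apply: normed_cvg.
apply: (@series_le_cvg _ _ (geometric C (1 / 2))).
- by move=> n; exact: normr_ge0.
- by move=> n; exact: geometric_ge0.
- move=> n; rewrite /= normrM normrX.
  have -> : (1 / 2 : R) = rho * (`|x| + 1) by rewrite /rho; field; rewrite gt_eqF.
  rewrite exprMn mulrA; apply: ler_pM => //.
  by apply: lerXn2r; rewrite ?nnegrE ?(ltW x1)//; lra.
- by apply: is_cvg_geometric_series; rewrite ger0_norm//; lra.
Qed.

Lemma superdecay_diffs c : superdecay c -> superdecay (pseries_diffs c).
Proof.
move=> hc rho rho0; have r2 : 0 < rho / 2 by rewrite divr_gt0.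
have [C C0 hC] := hc _ r2; exists (C * rho) => [|e]; first by rewrite mulr_ge0// ltW.
rewrite /pseries_diffs normrM ger0_norm//.
apply: (@le_trans _ _ (e.+1%:R * (C * (rho / 2) ^+ e.+1))); first by rewrite ler_wpM2l.
have -> : C * rho * rho ^+ e = C * rho ^+ e.+1 by rewrite exprS; ring.
rewrite expr_div_n [leLHS](_ : _ = C * rho ^+ e.+1 * (e.+1%:R / 2 ^+ e.+1)); last first.
  by field; rewrite expf_neq0.
rewrite ler_piMr ?mulr_ge0 ?exprn_ge0 ?(ltW rho0)//.
rewrite ler_pdivrMr ?exprn_gt0// mul1r -natrX ler_nat; exact/ltnW/ltn_expl.
Qed.

Lemma superdecayD c d : superdecay c -> superdecay d -> superdecay (fun e => c e + d e).
Proof.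
move=> hc hd rho rho0; have [C C0 hC] := hc _ rho0; have [D D0 hD] := hd _ rho0.
exists (C + D) => [|e]; first exact: addr_ge0.
by rewrite mulrDl (le_trans (ler_normD _ _))// lerD.
Qed.

Lemma superdecayZ a c : superdecay c -> superdecay (fun e => a * c e).
Proof.
move=> hc rho rho0; have [C C0 hC] := hc _ rho0.
exists (`|a| * C) => [|e]; first exact: mulr_ge0.
by rewrite normrM -mulrA ler_wpM2l.
Qed.

(** The coefficients of x times the power series c. *)
Definition shift1 c e : R := if e is e'.+1 then c e' else 0.

Lemma superdecay_shift c : superdecay c -> superdecay (shift1 c).
Proof.
move=> hc rho rho0; have [C C0 hC] := hc _ rho0.
exists (C / rho) => [|[|e]]; first by rewrite divr_ge0// ltW.
  by rewrite normr0 mulr1 divr_ge0// ltW.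
by rewrite exprS mulrA divfK ?gt_eqF//; exact: hC.
Qed.

Lemma psersum_derive c x : superdecay c ->
  is_derive x 1 (psersum c) (psersum (pseries_diffs c) x).
Proof.
move=> hc; have hd := superdecay_diffs hc; have hdd := superdecay_diffs hd.
apply: (pseries_snd_diffs (K := `|x| + 1)); try exact: superdecay_cvg.
by rewrite [ltRHS]ger0_norm ?addr_ge0// ltrDl.
Qed.

Lemma psersumD c d x : superdecay c -> superdecay d ->
  psersum (fun e => c e + d e) x = psersum c x + psersum d x.
Proof.
move=> hc hd; apply: cvg_lim => //.
rewrite (_ : pseries _ x = pseries c x + pseries d x); last first.
  apply/funext => n; rewrite /pseries /series /= -[RHS]big_split /=.
  by apply: eq_bigr => e _; rewrite mulrDl.
by apply: cvgD; exact: superdecay_cvg.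
Qed.

Lemma psersumZ a c x : superdecay c ->
  psersum (fun e => a * c e) x = a * psersum c x.
Proof.
move=> hc; apply: cvg_lim => //.
rewrite (_ : pseries _ x = fun n => a * pseries c x n); last first.
  apply/funext => n; rewrite /pseries /series /= mulr_sumr.
  by apply: eq_bigr => e _; rewrite mulrA.
by apply: cvgMr; exact: superdecay_cvg.
Qed.

Lemma psersum_shift c x : superdecay c -> psersum (shift1 c) x = x * psersum c x.
Proof.
move=> hc; apply: cvg_lim => //; rewrite -(cvg_shiftS (pseries (shift1 c) x)).
rewrite (_ : [sequence _]_n = fun n => x * pseries c x n); last first.
  apply/funext => n; rewrite /= /pseries /series /= big_nat_recl//= mul0r add0r mulr_sumr.
  by apply: eq_bigr => e _; rewrite exprS; ring.
by apply: cvgMr; exact: superdecay_cvg.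
Qed.

Lemma psersum_ge c x n : superdecay c -> (forall e, 0 <= c e * x ^+ e) ->
  \sum_(0 <= e < n) c e * x ^+ e <= psersum c x.
Proof.
move=> hc h0; have nd : nondecreasing_seq (pseries c x).
  by apply: (@nondecreasing_series _ (fun e => c e * x ^+ e)) => e _ _; exact: h0.
exact: (nondecreasing_cvgn_le nd (superdecay_cvg (x := x) hc) n).
Qed.

Lemma psersum_ge0 c x : superdecay c -> (forall e, 0 <= c e * x ^+ e) -> 0 <= psersum c x.
Proof. by move=> hc h0; have := psersum_ge 0 hc h0; rewrite big_nil. Qed.

Lemma psersum0 c : superdecay c -> psersum c 0 = c 0%N.
Proof.
move=> hc; apply: cvg_lim => //; rewrite -(cvg_shiftS (pseries c 0)).
rewrite (_ : [sequence _]_n = fun n => c 0%N); first exact: cvg_cst.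
apply/funext => n; rewrite /= /pseries /series /= big_nat_recl//= mulr1 big1 ?addr0// => e _.
by rewrite expr0n mulr0.
Qed.

(** The Taylor coefficients of the solution of u'' = (x / 3) u with u(0) = p and
    u'(0) = q. *)
Fixpoint airy_coef (p q : R) (e : nat) : R :=
  match e with
  | 0 => p | 1 => q | 2 => 0
  | (e'.+3)%N => airy_coef p q e' / (3 * e'.+3%:R * e'.+2%:R)
  end.

Lemma airy_coef_superdecay p q : superdecay (airy_coef p q).
Proof.
move=> rho rho0; set b := airy_coef p q.
have r3 : 0 < rho ^+ 3 by exact: exprn_gt0.
pose n0 := (Num.truncn (rho ^- 3)).+1.
pose C := \sum_(e < n0.+3) `|b e| / rho ^+ e.
have C0 : 0 <= C by apply: sumr_ge0 => e _; rewrite divr_ge0// exprn_ge0// ltW.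
exists C => // e; have [m] := ubnP e; elim: m e => // m IH e; rewrite ltnS => em.
have [en|] := ltnP e n0.+3.
  rewrite -ler_pdivrMr ?exprn_gt0// /C (bigD1 (Ordinal en))//= lerDl.
  by apply: sumr_ge0 => k _; rewrite divr_ge0// exprn_ge0// ltW.
case: e em => [|[|[|e]]] // em en.
have {}IH := IH e (leq_trans (leqnSn _) (ltnW em)).
have D1 : 0 < 3 * e.+3%:R * e.+2%:R :> R by rewrite !mulr_gt0.
rewrite /b /= -/b normrM normfV (gtr0_norm D1) ler_pdivrMr//.
apply: (le_trans IH).
rewrite [leRHS](_ : _ = C * rho ^+ e * (rho ^+ 3 * (3 * e.+3%:R * e.+2%:R))); last first.
  by rewrite -[in LHS]addn3 exprD; ring.
rewrite ler_peMr ?mulr_ge0 ?exprn_ge0 ?(ltW rho0)//.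
rewrite -ler_pdivrMl// mulr1.
have : rho ^- 3 <= n0%:R by apply/ltW; rewrite /n0 truncnS_gt.
move=> /le_trans; apply; rewrite -!natrM ler_nat.
have : (n0 <= e)%N by rewrite !ltnS in en.
nia.
Qed.

Lemma airy_coef_diffs2 p q :
  pseries_diffs (pseries_diffs (airy_coef p q)) = shift1 (fun e => 1 / 3 * airy_coef p q e).
Proof.
apply/funext => -[|e]; rewrite /pseries_diffs /=; first by rewrite !mulr0.
have : e.+2%:R != 0 :> R by rewrite pnatr_eq0.
have : e.+3%:R != 0 :> R by rewrite pnatr_eq0.
by move=> h1 h2; field; apply/andP.
Qed.

(** The solution of u'' = (x / 3) u with u(0) = p and u'(0) = q, and its
    derivative. *)
Definition airyS p q := psersum (airy_coef p q).
Definition airyS' p q := psersum (pseries_diffs (airy_coef p q)).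

Lemma airyS_derive p q x : is_derive x 1 (airyS p q) (airyS' p q x).
Proof. exact/psersum_derive/airy_coef_superdecay. Qed.

Lemma airyS'_derive p q x : is_derive x 1 (airyS' p q) (x / 3 * airyS p q x).
Proof.
have h := airy_coef_superdecay p q.
apply: (is_derive_eq (psersum_derive x (superdecay_diffs h))).
rewrite airy_coef_diffs2 psersum_shift; last exact: superdecayZ.
by rewrite psersumZ// mulrA; congr (_ * _); field.
Qed.

Lemma airyS0 p q : airyS p q 0 = p.
Proof. by rewrite /airyS psersum0//; exact: airy_coef_superdecay. Qed.

Lemma airyS'0 p q : airyS' p q 0 = q.
Proof.
rewrite /airyS' psersum0; last exact/superdecay_diffs/airy_coef_superdecay.
by rewrite /pseries_diffs /= mul1r.
Qed.

Lemma airy_coef_lin p q e : airy_coef p q e = airy_coef p 0 e + airy_coef 0 q e.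
Proof.
have [m] := ubnP e; elim: m e => // m IH [|[|[|e]]] em /=; rewrite ?addr0 ?add0r//.
by rewrite IH ?mulrDl// -ltnS ltnW// ltnW.
Qed.

Lemma airy_coefZ a p q e : airy_coef (a * p) (a * q) e = a * airy_coef p q e.
Proof.
have [m] := ubnP e; elim: m e => // m IH [|[|[|e]]] em /=; rewrite ?mulr0//.
by rewrite IH ?mulrA// -ltnS ltnW// ltnW.
Qed.

Lemma airyS_split p q x : airyS p (- q) x = airyS p 0 x - airyS 0 q x.
Proof.
have h1 := airy_coef_superdecay p 0; have h2 := airy_coef_superdecay 0 q.
rewrite /airyS -[X in _ - X]mul1r -mulNr -psersumZ// -psersumD//; last exact: superdecayZ.
congr psersum; apply/funext => e.
by rewrite airy_coef_lin -airy_coefZ mulr0 mulN1r.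
Qed.

Lemma airy_coef_ge0 p q e : 0 <= p -> 0 <= q -> 0 <= airy_coef p q e.
Proof.
move=> p0 q0; have [m] := ubnP e; elim: m e => // m IH [|[|[|e]]] em //=.
by rewrite divr_ge0 ?mulr_ge0// IH// -ltnS ltnW// ltnW.
Qed.

Lemma airyS_ge0 p q x : 0 <= p -> 0 <= q -> 0 <= x -> p + q * x <= airyS p q x.
Proof.
move=> p0 q0 x0; have := @psersum_ge _ x 2 (airy_coef_superdecay p q).
rewrite !big_nat_recr//= big_geq// add0r mulr1; apply => e.
by apply: mulr_ge0; [exact: airy_coef_ge0 | exact: exprn_ge0].
Qed.

Lemma airyS'_ge0 p q x : 0 <= p -> 0 <= q -> 0 <= x -> q <= airyS' p q x.
Proof.
move=> p0 q0 x0; have := @psersum_ge _ x 1 (superdecay_diffs (airy_coef_superdecay p q)).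
rewrite big_nat1 /pseries_diffs /= mul1r mulr1; apply => e.
apply: mulr_ge0; last exact: exprn_ge0.
by apply: mulr_ge0 => //; exact: (airy_coef_ge0 (p := p) (q := q) e.+1).
Qed.
End EntireSeries.

(** * Comparison of the two basic solutions *)

Section Ratio.
Variable R : realType.

(** Weighted AM-GM, 3 t + s >= 4 (s t^3)^(1/4). *)
Lemma amgm1 (t s : R) : 0 <= t -> 0 <= s -> 1 <= s * t ^+ 3 -> 4 / 3 - s / 3 <= t.
Proof.
move=> t0 s0 h; rewrite leNgt; apply/negP => ht.
have s4 : 0 < (4 - s) / 3 by lra.
have t3 : t ^+ 3 < ((4 - s) / 3) ^+ 3 by apply: ltrXn2r => //; rewrite ?nnegrE; lra.
have sp : 0 < s by rewrite lt_def s0 andbT; apply: contraTneq h => ->; rewrite mul0r -ltNge.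
have : s * t ^+ 3 < s * ((4 - s) / 3) ^+ 3 by rewrite ltr_pM2l.
have : 0 <= (s - 1) ^+ 2 * ((s - 5) ^+ 2 + 2).
  by apply: mulr_ge0; [exact: sqr_ge0 | apply: addr_ge0 => //; exact: sqr_ge0].
rewrite (_ : _ * (_ + 2) = 27 * (1 - s * ((4 - s) / 3) ^+ 3)); last by field.
by move: h; clear; lra.
Qed.

(** Weighted AM-GM, 3 w + 2 u >= 5 (w^3 u^2)^(1/5). *)
Lemma amgm2 (w u : R) : 0 <= w -> 0 <= u -> 1 <= w ^+ 3 * u ^+ 2 -> 5 / 3 - 2 * u / 3 <= w.
Proof.
move=> w0 u0 h; rewrite leNgt; apply/negP => hw.
have u4 : 0 < (5 - 2 * u) / 3 by lra.
have t3 : w ^+ 3 < ((5 - 2 * u) / 3) ^+ 3 by apply: ltrXn2r => //; rewrite ?nnegrE; lra.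
have up : 0 < u by rewrite lt_def u0 andbT; apply: contraTneq h => ->; rewrite expr0n mulr0 -ltNge.
have : w ^+ 3 * u ^+ 2 < ((5 - 2 * u) / 3) ^+ 3 * u ^+ 2 by rewrite ltr_pM2r// exprn_gt0.
have : 0 <= (u - 1) ^+ 2 * (8 * u * (u - 11 / 4) ^+ 2 + (27 - 13 / 2 * u)).
  apply: mulr_ge0; first exact: sqr_ge0.
  apply: addr_ge0; last lra.
  by apply: mulr_ge0; [lra | exact: sqr_ge0].
rewrite (_ : _ * (_ + _) = 27 * (1 - ((5 - 2 * u) / 3) ^+ 3 * u ^+ 2)); last by field.
by move: h; clear; lra.
Qed.

(** The coefficients of the power series c without its constant term, divided
    by x. *)
Definition tail1 (c : nat -> R) e := c e.+1.

Lemma superdecay_tail c : superdecay c -> superdecay (tail1 c).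
Proof.
move=> hc rho rho0; have [C C0 hC] := hc _ rho0.
exists (C * rho) => [|e]; first by rewrite mulr_ge0// ltW.
by rewrite -mulrA -exprS; exact: hC.
Qed.

Lemma psersum_tail c (x : R) : superdecay c ->
  psersum c x = c 0%N + x * psersum (tail1 c) x.
Proof.
move=> hc; apply: cvg_lim => //; rewrite -(cvg_shiftS (pseries c x)).
rewrite (_ : [sequence _]_n = fun n => c 0%N + x * pseries (tail1 c) x n); last first.
  apply/funext => n; rewrite /= /pseries /series /= big_nat_recl//= mulr1 mulr_sumr.
  by congr (_ + _); apply: eq_bigr => e _; rewrite exprS /tail1; ring.
apply: cvgD; first exact: cvg_cst.
by apply: cvgMr; exact/superdecay_cvg/superdecay_tail.
Qed.

(** The weights (e + 3) (e + 2) are those of the second derivative of x^3 u, so the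
    series is computed by the differential equation of u. *)
Definition weighted (c : nat -> R) e := e.+3%:R * e.+2%:R * c e.

Lemma weightedE c : weighted c =
  fun e => shift1 (shift1 (pseries_diffs (pseries_diffs c))) e +
    (6 * shift1 (pseries_diffs c) e + 6 * c e).
Proof.
apply/funext => -[|[|e]]; rewrite /weighted /pseries_diffs /=; first by ring.
  by ring.
rewrite -!natr1; ring.
Qed.

Lemma superdecay_weighted c : superdecay c -> superdecay (weighted c).
Proof.
move=> hc; rewrite weightedE; have hd := superdecay_diffs hc.
apply: superdecayD; first exact/superdecay_shift/superdecay_shift/superdecay_diffs.
by apply: superdecayD; apply: superdecayZ => //; exact: superdecay_shift.
Qed.

Lemma psersum_weighted p q (x : R) : psersum (weighted (airy_coef p q)) x =
  x ^+ 3 / 3 * airyS p q x + 6 * x * airyS' p q x + 6 * airyS p q x.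
Proof.
have hc := airy_coef_superdecay p q; have hd := superdecay_diffs hc.
have hdd := superdecay_diffs hd.
rewrite weightedE psersumD; first last.
- by apply: superdecayD; apply: superdecayZ => //; exact: superdecay_shift.
- exact/superdecay_shift/superdecay_shift.
rewrite psersumD; first last.
- exact: superdecayZ.
- exact/superdecayZ/superdecay_shift.
rewrite !psersumZ//; last exact: superdecay_shift.
rewrite !psersum_shift//; last exact: superdecay_shift.
rewrite airy_coef_diffs2 psersum_shift; last exact: superdecayZ.
by rewrite psersumZ// -/(airyS p q x) -/(airyS' p q x); field.
Qed.

Lemma airy_coef_p q0 e (p : R) : q0 = 0 :> R -> (e %% 3 != 0)%N -> airy_coef p q0 e = 0.
Proof.
move=> ->; have [m] := ubnP e; elim: m e => // m IH [|[|[|e]]] em he //.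
have em' : (e < m)%N by lia.
have he' : (e %% 3 != 0)%N by move: he; rewrite -addn3 modnDr.
by rewrite /= IH ?mul0r.
Qed.

Lemma airy_coef_q p e (q : R) : p = 0 :> R -> (e %% 3 != 1)%N -> airy_coef p q e = 0.
Proof.
move=> ->; have [m] := ubnP e; elim: m e => // m IH [|[|[|e]]] em he //.
have em' : (e < m)%N by lia.
have he' : (e %% 3 != 1)%N by move: he; rewrite -addn3 modnDr.
by rewrite /= IH ?mul0r.
Qed.

(** P, with coefficients pc, has only exponents 0 mod 3, and Q, with coefficients
    qc, only exponents 1 mod 3.  The two hypotheses compare neighbouring
    coefficients; for the Airy function they follow from log-convexity of Gamma. *)
Section Comparison.
Variables p0 q0 : R.
Hypotheses (p0_gt0 : 0 < p0) (q0_gt0 : 0 < q0).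
Let pc := airy_coef p0 0.
Let qc := airy_coef 0 q0.
Hypothesis coefI : forall m : nat,
  pc (3 * m)%N ^+ 3 <= 27 * (m%:R + 2 / 3) ^+ 2 * qc (3 * m).+1 ^+ 3.
Hypothesis coefII : forall m : nat,
  qc (3 * m).+1 ^+ 3 <= 729 * (m%:R + 1) ^+ 3 * (m%:R + 4 / 3) * pc (3 * m).+3 ^+ 3.

Let pc_ge0 e : 0 <= pc e. Proof. by apply: airy_coef_ge0 => //; exact: ltW. Qed.
Let qc_ge0 e : 0 <= qc e. Proof. by apply: airy_coef_ge0 => //; exact: ltW. Qed.

(** Termwise form of ratioI.  For e = 3 m the ratio t = y qc(e + 1) / pc(e) satisfies
    s t^3 >= 1 with s of order e^2 / y^3; the AM-GM bound on t is linear in s, hence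
    quadratic in e, and the quadratic weight absorbs it. *)
Lemma termI (y : R) e : 0 < y ->
  0 <= y * tail1 qc e + (- (4 / 3) * pc e + y ^- 3 * weighted pc e).
Proof.
move=> y0; rewrite /tail1 /weighted.
have y3 : 0 < y ^+ 3 := exprn_gt0 3 y0.
have [he|he] := eqVneq (e %% 3)%N 0%N; last first.
  by rewrite /pc airy_coef_p// !mulr0 !addr0 mulr_ge0// ltW.
have e3 : e = (3 * (e %/ 3))%N by have := divn_eq e 3; rewrite he; lia.
move: (e %/ 3)%N e3 => m ->.
have := coefI m; have := qc_ge0 (3 * m).+1; have := pc_ge0 (3 * m)%N.
set a := pc _; set b := qc _ => a0 b0 hab.
have [->|an] := eqVneq a 0; first by rewrite !mulr0 !addr0 mulr_ge0// ltW.
have ap : 0 < a by rewrite lt_def an.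
pose M : R := m%:R; have M0 : 0 <= M by rewrite /M.
rewrite -/M in hab.
have -> : (3 * m).+3%:R = 3 * M + 3 :> R by rewrite /M -!natr1 natrM; ring.
have -> : (3 * m).+2%:R = 3 * M + 2 :> R by rewrite /M -!natr1 natrM; ring.
pose s := 27 * (M + 2 / 3) ^+ 2 / y ^+ 3.
have s0 : 0 <= s.
  by apply: divr_ge0; [apply: mulr_ge0 => //; exact: sqr_ge0 | exact: ltW].
have t0 : 0 <= y * b / a by apply: divr_ge0 => //; apply: mulr_ge0 => //; exact: ltW.
have st : 1 <= s * (y * b / a) ^+ 3.
  rewrite (_ : s * _ = 27 * (M + 2 / 3) ^+ 2 * b ^+ 3 / a ^+ 3).
    by rewrite ler_pdivlMr ?exprn_gt0// mul1r.
  by rewrite /s; field; rewrite an gt_eqF.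
have := amgm1 t0 s0 st; rewrite ler_pdivlMr// => h.
apply: (@le_trans _ _ (y * b - (4 / 3 - s / 3) * a)); first by rewrite subr_ge0.
rewrite -subr_ge0 (_ : _ - _ = a * (3 * M + 2) / y ^+ 3).
  by apply: divr_ge0; [apply: mulr_ge0 => //; lra | exact: ltW].
by rewrite /s; field; rewrite gt_eqF.
Qed.

(** Termwise form of ratioII; here t = y^2 pc(e + 2) / qc(e) for e = 3 m + 1. *)
Lemma termII (y : R) e : 0 < y ->
  0 <= y ^+ 2 * tail1 (tail1 pc) e + (- (5 / 3) * qc e + 2 * y ^- 3 * weighted qc e).
Proof.
move=> y0; rewrite /tail1 /weighted.
have y3 : 0 < y ^+ 3 := exprn_gt0 3 y0.
have y2 : 0 <= y ^+ 2 := sqr_ge0 y.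
have [he|he] := eqVneq (e %% 3)%N 1%N; last first.
  by rewrite /qc airy_coef_q// !mulr0 !addr0 mulr_ge0.
have e3 : e = (3 * (e %/ 3)).+1%N by have := divn_eq e 3; rewrite he; lia.
move: (e %/ 3)%N e3 => m ->.
have := coefII m; have := qc_ge0 (3 * m).+1; have := pc_ge0 (3 * m).+3%N.
set a := pc _; set b := qc _ => a0 b0 hab.
have [->|bn] := eqVneq b 0; first by rewrite !mulr0 !addr0 mulr_ge0.
have bp : 0 < b by rewrite lt_def bn.
pose M : R := m%:R; have M0 : 0 <= M by rewrite /M.
rewrite -/M in hab.
have -> : (3 * m).+4%:R = 3 * M + 4 :> R by rewrite /M -!natr1 natrM; ring.
have -> : (3 * m).+3%:R = 3 * M + 3 :> R by rewrite /M -!natr1 natrM; ring.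
pose u := 27 * (M + 4 / 3) * (M + 1) / y ^+ 3.
have u0 : 0 <= u by apply: divr_ge0; [apply: mulr_ge0; lra | exact: ltW].
have w0 : 0 <= y ^+ 2 * a / b by apply: divr_ge0 => //; exact: mulr_ge0.
have a3 : 0 <= a ^+ 3 by exact: exprn_ge0.
have st : 1 <= (y ^+ 2 * a / b) ^+ 3 * u ^+ 2.
  rewrite (_ : _ * u ^+ 2 = 729 * (M + 4 / 3) ^+ 2 * (M + 1) ^+ 2 * a ^+ 3 / b ^+ 3).
    rewrite ler_pdivlMr ?exprn_gt0// mul1r (le_trans hab)//.
    rewrite -subr_ge0 (_ : _ - _ = 243 * (M + 4 / 3) * (M + 1) ^+ 2 * a ^+ 3); last by field.
    by apply: mulr_ge0 => //; apply: mulr_ge0; [lra | exact: sqr_ge0].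
  by rewrite /u; field; rewrite bn gt_eqF.
have := amgm2 w0 u0 st; rewrite ler_pdivlMr// => h.
rewrite (_ : _ + _ = y ^+ 2 * a - (5 / 3 - 2 * u / 3) * b); first by rewrite subr_ge0.
by rewrite /u; field; rewrite gt_eqF.
Qed.

Let P := airyS p0 0. Let P' := airyS' p0 0.
Let Q := airyS 0 q0. Let Q' := airyS' 0 q0.

Lemma ratioI (y : R) : 0 < y -> P y - 6 * P' y / y ^+ 2 - 6 * P y / y ^+ 3 <= Q y.
Proof.
move=> y0; have hp := airy_coef_superdecay p0 0; have hq := airy_coef_superdecay 0 q0.
have ht := superdecay_tail hq; have hw := superdecay_weighted hp.
pose c e := y * tail1 qc e + (- (4 / 3) * pc e + y ^- 3 * weighted pc e).
have hc : superdecay c.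
  by apply: superdecayD; [|apply: superdecayD]; exact: superdecayZ.
have : 0 <= psersum c y.
  by apply: psersum_ge0 => // e; apply: mulr_ge0; [exact: termI | exact/exprn_ge0/ltW].
rewrite psersumD; [|exact: superdecayZ|by apply: superdecayD; exact: superdecayZ].
rewrite psersumD; [|exact: superdecayZ|exact: superdecayZ].
have eQ : Q y = y * psersum (tail1 qc) y by rewrite /Q /airyS psersum_tail// add0r.
rewrite !psersumZ// psersum_weighted -eQ -[psersum pc y]/(P y) -/(P y) -/(P' y) => h; rewrite -subr_ge0.
apply: (le_trans h); rewrite le_eqVlt; apply/orP; left; apply/eqP.
by field; rewrite gt_eqF.
Qed.

Lemma ratioII (y : R) : 0 < y -> Q y - 12 * Q' y / y ^+ 2 - 12 * Q y / y ^+ 3 <= P y.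
Proof.
move=> y0; have hp := airy_coef_superdecay p0 0; have hq := airy_coef_superdecay 0 q0.
have ht := superdecay_tail hp; have htt := superdecay_tail ht; have hw := superdecay_weighted hq.
pose c e := y ^+ 2 * tail1 (tail1 pc) e + (- (5 / 3) * qc e + 2 * y ^- 3 * weighted qc e).
have hc : superdecay c.
  by apply: superdecayD; [|apply: superdecayD]; exact: superdecayZ.
have : 0 <= psersum c y.
  by apply: psersum_ge0 => // e; apply: mulr_ge0; [exact: termII | exact/exprn_ge0/ltW].
rewrite psersumD; [|exact: superdecayZ|by apply: superdecayD; exact: superdecayZ].
rewrite psersumD; [|exact: superdecayZ|exact: superdecayZ].
rewrite !psersumZ// psersum_weighted -/(Q y) -/(Q' y) -[psersum qc y]/(Q y).
have -> : P y = p0 + y ^+ 2 * psersum (tail1 (tail1 pc)) y.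
  by rewrite /P /airyS psersum_tail// psersum_tail// /tail1 /= add0r expr2 mulrA.
set T := psersum _ y => h; rewrite -subr_ge0.
apply: (le_trans h).
rewrite -subr_ge0 [leRHS](_ : _ = p0); first exact: ltW.
by field; rewrite gt_eqF.
Qed.
End Comparison.
End Ratio.

(** * The recessive solution *)

Section Recessive.
Variable R : realType.

(** A function that never exceeds its value at y and has a nonnegative lower limit
    at +oo is nonnegative at y. *)
Lemma nonincreasing_lim_ge0 (u : R -> R) (y C : R) : 0 <= y -> 0 <= C ->
  (forall z, y <= z -> u z <= u y) -> (forall z, 48 <= z -> - (C / z) <= u z) ->
  0 <= u y.
Proof.
move=> y0 C0 hu hC; rewrite leNgt; apply/negP => uy.
pose z := y + 48 + C / (- u y).
have e0 : 0 < - u y by lra.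
have q0 : 0 <= C / (- u y) by rewrite divr_ge0// ltW.
have z0 : 0 < z by rewrite /z; lra.
have /hu h1 : y <= z by rewrite /z; lra.
have /hC h2 : 48 <= z by rewrite /z; lra.
have h3 : - u y <= C / z by lra.
move: h3; rewrite ler_pdivlMr// /z mulrDr (mulrC (- u y) (C / _)) divfK ?gt_eqF//.
have : 0 < - u y * (y + 48) by apply: mulr_gt0 => //; lra.
lra.
Qed.

Variables p0 q0 : R.
Hypotheses (p0_gt0 : 0 < p0) (q0_gt0 : 0 < q0).
Hypothesis coefI : forall m : nat, airy_coef p0 0 (3 * m)%N ^+ 3 <=
  27 * (m%:R + 2 / 3) ^+ 2 * airy_coef 0 q0 (3 * m).+1 ^+ 3.
Hypothesis coefII : forall m : nat, airy_coef 0 q0 (3 * m).+1 ^+ 3 <=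
  729 * (m%:R + 1) ^+ 3 * (m%:R + 4 / 3) * airy_coef p0 0 (3 * m).+3 ^+ 3.

(** From the energy (x / 3) u^2 - u'^2, which is nondecreasing. *)
Lemma airyS'_le p q (y : R) : 0 <= p -> 0 <= q -> 0 <= y ->
  airyS' p q y <= (1 + y) * airyS p q y + q.
Proof.
move=> p_ge0 q_ge0 y0.
have S0 : 0 <= airyS p q y.
  by apply: le_trans (airyS_ge0 p_ge0 q_ge0 y0); rewrite addr_ge0// mulr_ge0.
have S'0 : 0 <= airyS' p q y by apply: le_trans (airyS'_ge0 p_ge0 q_ge0 y0).
pose E x := x / 3 * (airyS p q x * airyS p q x) - airyS' p q x * airyS' p q x.
have dE (x : R) : is_derive x 1 E (airyS p q x ^+ 2 / 3).
  have dS := airyS_derive p q x; have dS' := airyS'_derive p q x.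
  have := isderB (isderM (isderZ (1 / 3) (isder_id x)) (isderM dS dS)) (isderM dS' dS').
  rewrite (_ : (fun y => _) = E); last by apply/funext => z; rewrite /E; field.
  by move=> h; apply: (is_derive_eq h); field.
have : E 0 <= E y.
  apply: (ge0_der_le y0 (fun x _ => dE x)) => x _.
  by apply: divr_ge0 => //; exact: sqr_ge0.
rewrite /E mul0r mul0r sub0r airyS'0 => h.
set S := airyS p q y in S0 h *; set S' := airyS' p q y in S'0 h *.
have B0 : 0 <= (1 + y) * S + q by apply: addr_ge0 => //; apply: mulr_ge0 => //; lra.
rewrite -(ler_pXn2r (n := 2)) ?nnegrE//.
have yS : 0 <= y * S by exact: mulr_ge0.
have a1 : 0 <= q * (S + y * S) by apply: mulr_ge0 => //; lra.
have a2 : 0 <= S * S by exact: mulr_ge0.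
have a3 : 0 <= y * (S * S) by exact: mulr_ge0.
have a4 : 0 <= y * (y * (S * S)) by apply: mulr_ge0 => //.
rewrite -subr_ge0 (_ : _ - _ = S * S + 2 * (y * (S * S)) + y * (y * (S * S)) + 2 * (q * (S + y * S)) + q * q - S' * S'); last by ring.
lra.
Qed.

Let P := airyS p0 0. Let Q := airyS 0 q0. Let Q' := airyS' 0 q0.
Let f := airyS p0 (- q0). Let f' := airyS' p0 (- q0).

Lemma airyS_PQ (y : R) : f y = P y - Q y. Proof. exact: airyS_split. Qed.

Lemma Q_ge (y : R) : 0 <= y -> q0 * y <= Q y.
Proof. by move=> y0; have := airyS_ge0 (lexx 0) (ltW q0_gt0) y0; rewrite add0r. Qed.

Lemma Q_gt0 (y : R) : 0 < y -> 0 < Q y.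
Proof. by move=> y0; apply: lt_le_trans (Q_ge (ltW y0)); exact: mulr_gt0. Qed.

(** By airyS'_le the error terms in ratioI and ratioII are O(P / y) and O(Q / y). *)
Lemma ratio_bound (y : R) : 48 <= y -> - (48 / y) <= f y / Q y <= 48 / y.
Proof.
move=> y48; have y0 : 0 < y by lra. have y1 : 1 <= y by lra.
have [pp qq] : 0 < p0 /\ 0 < q0 by [].
have hI := ratioI p0_gt0 q0_gt0 coefI y0.
have hII := ratioII p0_gt0 q0_gt0 coefII y0.
have Qy := Q_gt0 y0; have Qg := Q_ge (ltW y0).
have Py : 0 < P y.
  by apply: lt_le_trans (airyS_ge0 (ltW p0_gt0) (lexx 0) (ltW y0)); rewrite mul0r addr0.
have P'y := airyS'_le (ltW p0_gt0) (lexx 0) (ltW y0).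
have Q'y := airyS'_le (lexx 0) (ltW q0_gt0) (ltW y0).
rewrite -/(P y) -/(Q y) in hI hII P'y Q'y.
have y2 : 0 < y ^+ 2 := exprn_gt0 2 y0.
have y3 : 0 < y ^+ 3 := exprn_gt0 3 y0.
have yy : y ^+ 2 <= y ^+ 3 by rewrite [leRHS]exprS ler_peMl// ltW.
have y12 : y <= y ^+ 2 by rewrite expr2 ler_peMl// ltW.
have PI : P y - 24 / y * P y <= Q y.
  apply: le_trans hI; rewrite -subr_ge0.
  rewrite (_ : _ - _ = (24 * y ^+ 2 * P y - 6 * y * airyS' p0 0 y - 6 * P y) / y ^+ 3); last first.
    by field; rewrite gt_eqF.
  apply: divr_ge0 (ltW y3).
  have a1 : y * airyS' p0 0 y <= y * ((1 + y) * P y + 0) by rewrite ler_wpM2l// ltW.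
  have a2 : y * P y <= y ^+ 2 * P y by rewrite ler_wpM2r// ltW.
  have a3 : P y <= y ^+ 2 * P y by rewrite ler_peMl ?(ltW Py)//; lra.
  rewrite addr0 mulrA in a1.
  have a4 : y * (1 + y) * P y = y * P y + y ^+ 2 * P y by ring.
  lra.
have PII : Q y - 48 / y * Q y <= P y.
  apply: le_trans hII; rewrite -subr_ge0.
  rewrite (_ : _ - _ = (48 * y ^+ 2 * Q y - 12 * y * airyS' 0 q0 y - 12 * Q y) / y ^+ 3); last first.
    by field; rewrite gt_eqF.
  apply: divr_ge0 (ltW y3).
  have a0 : q0 <= Q y by apply: le_trans Qg; rewrite ler_peMr// ltW.
  have a1 : y * airyS' 0 q0 y <= y * ((1 + y) * Q y + Q y).
    by rewrite ler_wpM2l ?(ltW y0)// (le_trans Q'y)// lerD2l.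
  have a2 : y * Q y <= y ^+ 2 * Q y by rewrite ler_wpM2r// ltW.
  have a3 : Q y <= y ^+ 2 * Q y by rewrite ler_peMl ?(ltW Qy)//; lra.
  have a4 : y * ((1 + y) * Q y + Q y) = 2 * (y * Q y) + y ^+ 2 * Q y by ring.
  lra.
have fE := airyS_PQ y.
apply/andP; split; first by rewrite ler_pdivlMr// fE; lra.
rewrite ler_pdivrMr// fE.
have i24 : 24 / y <= 1 / 2 by rewrite ler_pdivrMr//; lra.
have a1 : 24 / y * P y <= 1 / 2 * P y by rewrite ler_wpM2r// ltW.
have P2 : P y <= 2 * Q y by lra.
have : 24 / y * P y <= 24 / y * (2 * Q y).
  by rewrite ler_wpM2l// divr_ge0// ltW.
lra.
Qed.

Lemma wronskian (x : R) : f' x * Q x - f x * Q' x = - (p0 * q0).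
Proof.
pose W x := f' x * Q x - f x * Q' x.
have dW (y : R) : is_derive y 1 W 0.
  have := isderB (isderM (airyS'_derive p0 (- q0) y) (airyS_derive 0 q0 y))
     (isderM (airyS_derive p0 (- q0) y) (airyS'_derive 0 q0 y)).
  by move=> h; apply: (is_derive_eq h); rewrite /f /f'; ring.
have W0 : W 0 = - (p0 * q0).
  by rewrite /W /f /f' /Q /Q' !airyS0 !airyS'0 mulr0 sub0r.
rewrite -W0 -/(W x); have [h|/ltW h] := leP 0 x.
  have [c _] := mvt h (fun y _ => dW y); rewrite mul0r; lra.
have [c _] := mvt h (fun y _ => dW y); rewrite mul0r; lra.
Qed.

Lemma recessive_simple (x : R) : f x = 0 -> f' x != 0.
Proof.
move=> fx; apply/eqP => f'x; have := wronskian x.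
by rewrite fx f'x !mul0r subr0 => /eqP; rewrite eq_sym oppr_eq0 mulf_eq0 !gt_eqF.
Qed.

Let dratio (y : R) : 0 < y -> is_derive y 1 (fun x => f x / Q x) (- (p0 * q0) / Q y ^+ 2).
Proof.
move=> y0; have Qn : Q y != 0 by rewrite gt_eqF// Q_gt0.
have := isderM (airyS_derive p0 (- q0) y) (isderV Qn (airyS_derive 0 q0 y)).
move=> h; apply: (is_derive_eq h); rewrite -(wronskian y) -/(f y) -/(f' y) -/(Q' y) -/(Q y).
by field.
Qed.

Lemma recessive_ratio_decr (y z : R) : 0 < y -> y < z -> f z / Q z < f y / Q y.
Proof.
move=> y0 yz; have dr (x : R) : y <= x <= z -> is_derive x 1 (fun x => f x / Q x) (- (p0 * q0) / Q x ^+ 2).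
  by move=> /andP[yx _]; apply: dratio; exact: lt_le_trans yx.
have [c /andP[yc _] e] := mvt (ltW yz) dr.
rewrite -subr_lt0 e pmulr_llt0 ?subr_gt0// mulNr oppr_lt0.
apply: divr_gt0; first exact: mulr_gt0.
by apply/exprn_gt0/Q_gt0; exact: lt_le_trans yc.
Qed.

(** f / Q is strictly decreasing and tends to 0. *)
Lemma recessive_gt0 (y : R) : 0 <= y -> 0 < f y.
Proof.
rewrite le_eqVlt => /predU1P[<-|y0]; first by rewrite /f airyS0.
have ge z : 0 < z -> 0 <= f z / Q z.
  move=> z0; apply: (@nonincreasing_lim_ge0 (fun x => f x / Q x) z 48) => //; first exact: ltW.
    move=> x; rewrite le_eqVlt => /predU1P[->//|zx]; exact/ltW/recessive_ratio_decr.
  by move=> x /ratio_bound /andP[].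
have y1 : 0 < y + 1 by rewrite addr_gt0.
have := le_lt_trans (ge _ y1) (recessive_ratio_decr y0 (ltr_pwDr ltr01 (lexx y))).
by rewrite pmulr_lgt0// invr_gt0 Q_gt0.
Qed.

(** As Q' increases, (f / Q)' = - p0 q0 / Q^2 is at least the derivative of
    (p0 q0 / Q'(y)) / Q on x >= y; both functions tend to 0 at +oo. *)
Lemma recessive_le (y : R) : 0 < y -> f y * Q' y <= p0 * q0.
Proof.
move=> y0; have Q'0 : 0 < Q' y by apply: lt_le_trans (airyS'_ge0 (lexx 0) (ltW q0_gt0) (ltW y0)).
pose h x := p0 * q0 / Q' y * (Q x)^-1 - f x / Q x.
have pq : 0 < p0 * q0 by exact: mulr_gt0.
suff : 0 <= h y.
  rewrite /h -mulrBl pmulr_lge0 ?invr_gt0 ?Q_gt0// subr_ge0 ler_pdivlMr//.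
have Q'mono x : y <= x -> Q' y <= Q' x.
  move=> yx; apply: (ge0_der_le yx (fun z _ => airyS'_derive 0 q0 z)) => z /andP[yz _].
  have z0 : 0 < z by exact: lt_le_trans yz.
  by apply: mulr_ge0; [rewrite divr_ge0// ltW | exact/ltW/Q_gt0].
apply: (@nonincreasing_lim_ge0 h y 48) => //; first exact: ltW.
  move=> z yz; rewrite -lerN2.
  pose dh x := - (p0 * q0 / Q' y * (- Q' x / Q x ^+ 2) - - (p0 * q0) / Q x ^+ 2).
  apply: (@ge0_der_le _ (fun x => - h x) dh y z yz) => x /andP[yx _].
    have x0 : 0 < x by exact: lt_le_trans yx.
    have Qn : Q x != 0 by rewrite gt_eqF// Q_gt0.
    exact: (isderN (isderB (isderZ (p0 * q0 / Q' y) (isderV Qn (airyS_derive 0 q0 x))) (dratio x0))).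
  have x0 : 0 < x by exact: lt_le_trans yx.
  have Qp := Q_gt0 x0.
  rewrite /dh (_ : - _ = p0 * q0 / Q x ^+ 2 * ((Q' x - Q' y) / Q' y)); last first.
    by field; rewrite !gt_eqF.
  apply: mulr_ge0; first by rewrite divr_ge0 ?sqr_ge0// ltW.
  by rewrite divr_ge0 ?(ltW Q'0)// subr_ge0 Q'mono.
move=> z z48; have z0 : 0 < z by lra.
have /andP[_ h2] := ratio_bound z48.
have h3 : 0 <= p0 * q0 / Q' y * (Q z)^-1.
  by rewrite mulr_ge0 ?invr_ge0 ?(ltW (Q_gt0 z0))// divr_ge0// ltW.
by rewrite /h; lra.
Qed.

Lemma recessive_small (c : R) : 0 < c -> exists2 Y : R, 0 < Y & forall y, Y <= y -> f y < c.
Proof.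
move=> c0; exists (1 + 9 * p0 / c) => [|y hy].
  by apply: addr_gt0 => //; apply: divr_gt0 => //; apply: mulr_gt0.
have r0 : 0 < 9 * p0 / c by apply: divr_gt0 => //; apply: mulr_gt0.
have y1 : 1 <= y by lra. have y0 : 0 < y by lra.
(* Q'' = (x / 3) Q >= q0 x^2 / 3 gives a cubic lower bound for Q', and y >= 1 *)
have Q'y : q0 * (y / 9) <= Q' y.
  have : q0 * (y * y * y / 9) <= Q' y.
    rewrite -subr_ge0; pose D x := Q' x - q0 / 9 * (x * x * x).
    have dD (x : R) : is_derive x 1 D (x / 3 * Q x - q0 / 3 * x ^+ 2).
      have d1 := isder_id x.
      have := isderB (airyS'_derive 0 q0 x) (isderZ (q0 / 9) (isderM (isderM d1 d1) d1)).
      by move=> h; apply: (is_derive_eq h); rewrite /Q; field.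
    have := ge0_der_le (ltW y0) (fun x _ => dD x).
    rewrite /D /Q' airyS'0 mul0r mul0r mulr0 subr0 => h.
    have : q0 <= airyS' 0 q0 y - q0 / 9 * (y * y * y).
      apply: h => x /andP[x0 _]; have := ler_wpM2l x0 (Q_ge x0).
      by lra.
    by have : 0 < q0 by []; lra.
  apply: le_trans; rewrite ler_wpM2l ?(ltW q0_gt0)// ler_wpM2r//.
  by rewrite -mulrA ler_peMr ?(ltW y0)//; rewrite -[leLHS]mulr1; apply: ler_pM.
have fy := recessive_gt0 (ltW y0).
have h1 : f y * (q0 * (y / 9)) <= p0 * q0.
  by apply: le_trans (recessive_le y0); rewrite ler_wpM2l// ltW.
have h2 : f y * y <= 9 * p0.
  rewrite -(ler_pM2r q0_gt0); lra.
have h3 : 9 * p0 < c * y.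
  have : 9 * p0 / c < y by lra.
  by rewrite ltr_pdivrMr// (mulrC y).
by rewrite -(ltr_pM2r y0); lra.
Qed.
End Recessive.

(** * Euler's integral *)

Section GammaFacts.
Variable R : realType.
Notation mu := (@lebesgue_measure R).

(** The integrand of Euler's integral. *)
Definition gamf (s t : R) : R := t `^ (s - 1) * expR (- t).

Lemma gamf_ge0 (s t : R) : 0 <= gamf s t.
Proof. by rewrite mulr_ge0 ?powR_ge0 ?expR_ge0. Qed.

(** The derivative behind the recurrence of Gamma: integration by parts amounts to
    integrating this formula. *)
Lemma gamf_succ_derive (s t : R) : 0 < t ->
  is_derive t 1 (gamf (s + 1)) (s * gamf s t - gamf (s + 1) t).
Proof.
move=> t0; have de : is_derive t 1 (fun x => expR (- x)) (- expR (- t)).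
  have := isder_comp (isderN (isder_id t)) (is_derive_expR (- t)).
  by rewrite mulN1r.
have := isderM (is_derive1_powR (s + 1 - 1) t0) de.
by move=> h; apply: (is_derive_eq h); rewrite /gamf addrK; ring.
Qed.

Lemma gamf_continuous (s t : R) : 0 < t -> {for t, continuous (gamf s)}.
Proof.
by move=> t0; have := der_continuous (gamf_succ_derive (s - 1) t0); rewrite subrK.
Qed.

Lemma gamf_within (s a b : R) : 0 < a -> {within `[a, b], continuous (gamf s)}.
Proof.
move=> a0; apply: continuous_in_subspaceT => x; rewrite inE /= in_itv /= => /andP[ax _].
by apply: gamf_continuous; exact: lt_le_trans ax.
Qed.

Lemma gamf_integrable_cc (s a b : R) : 0 < a ->
  mu.-integrable `[a, b] (EFin \o gamf s).
Proof.
move=> a0; apply: continuous_compact_integrable; first exact: segment_compact.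
exact: gamf_within.
Qed.

(** The part of Euler's integral over [a, b]. *)
Definition gampart (s a b : R) : R := \int[mu]_(t in `[a, b]) gamf s t.

(** The fundamental theorem of calculus for functions differentiable on the closed
    interval. *)
Lemma ftc2 (f F : R -> R) (a b : R) : a < b ->
  (forall x : R, a <= x <= b -> is_derive x 1 F (f x)) ->
  (forall x : R, a <= x <= b -> {for x, continuous f}) ->
  \int[mu]_(t in `[a, b]) f t = F b - F a.
Proof.
move=> ab dF cf; rewrite /Rintegral (@continuous_FTC2 _ f F a b ab) -?EFinD//.
- apply: continuous_in_subspaceT => x; rewrite inE /= in_itv /=; exact: cf.
- have cF (x : R) : a <= x <= b -> {for x, continuous F}.
    by move=> xab; exact: der_continuous (dF x xab).
  split.
  + move=> x; rewrite in_itv /= => /andP[/ltW ax /ltW xb].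
    by have [] := dF x (introT andP (conj ax xb)).
  + by apply: cvg_at_right_filter; apply: cF; rewrite lexx ltW.
  + by apply: cvg_at_left_filter; apply: cF; rewrite lexx andbT ltW.
- move=> x; rewrite in_itv /= => /andP[/ltW ax /ltW xb].
  by have [_ <-] := dF x (introT andP (conj ax xb)); rewrite derive1E.
Qed.

Lemma gampart_rec (s a b : R) : 0 < a -> a < b ->
  gampart (s + 1) a b = s * gampart s a b - (gamf (s + 1) b - gamf (s + 1) a).
Proof.
move=> a0 ab.
have : \int[mu]_(t in `[a, b]) (s * gamf s t - gamf (s + 1) t) = gamf (s + 1) b - gamf (s + 1) a.
  apply: ftc2 => // x /andP[ax _]; have x0 : 0 < x by exact: lt_le_trans ax.
    exact: gamf_succ_derive.
  apply: cvgB; last exact: gamf_continuous.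
  by apply: cvgMr; exact: gamf_continuous.
rewrite RintegralB//; first last.
- exact: gamf_integrable_cc.
- have := @integrableZl _ _ _ mu `[a, b]%classic (measurable_itv _) s _ (gamf_integrable_cc s b a0).
  by apply: eq_integrable.
rewrite RintegralZl//; last exact: gamf_integrable_cc.
by rewrite /gampart => <-; ring.
Qed.

Lemma gamf_bound (s : R) : exists2 C : R, 0 < C & forall t : R, 0 < t -> 1 <= s -> gamf s t <= C * expR (- (t / 2)).
Proof.
pose k := Num.truncn s.
pose K : R := k.+1`!%:R * 2 ^+ k.+1.
have K0 : 0 <= K by rewrite mulr_ge0 ?exprn_ge0.
exists (1 + K) => [|t t0 s1]; first by lra.
have t2 : 0 <= t / 2 by lra.
have e1 := expR_ge1Dxn k t2.
have p1 : t `^ (s - 1) <= 1 + t ^+ k.+1.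
  have [t1|t1] := leP t 1.
    have : t `^ (s - 1) <= t `^ 0 by rewrite ger_powR ?t0//; lra.
    rewrite powRr0; have : 0 <= t ^+ k.+1 by rewrite exprn_ge0// ltW.
    lra.
  have : t `^ (s - 1) <= t `^ k.+1%:R.
    rewrite ler_powR ?(ltW t1)//; have := truncnS_gt s; rewrite -/k; lra.
  by rewrite powR_mulrn ?(ltW t0)//; lra.
have f0 : 0 < k.+1`!%:R :> R by rewrite ltr0n fact_gt0.
have p2 : t ^+ k.+1 <= K * expR (t / 2).
  have : (t / 2) ^+ k.+1 / k.+1`!%:R <= expR (t / 2) by lra.
  rewrite ler_pdivrMr// expr_div_n ler_pdivrMr ?exprn_gt0// => h.
  by rewrite (le_trans h)// le_eqVlt; apply/orP; left; apply/eqP; rewrite /K; ring.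
have p3 : 1 <= expR (t / 2) by have := expR_ge1Dx (t / 2); lra.
have -> : expR (- (t / 2)) = expR (t / 2) * expR (- t) by rewrite -expRD; congr expR; field.
rewrite /gamf mulrA ler_wpM2r ?expR_ge0//; lra.
Qed.

(** The partial integrals are bounded: for exponents at least 1 by an integrable
    exponential, and for s > 0 by the recurrence from s + 1. *)
Lemma gampart_le (s : R) : 0 < s -> exists K : R, forall a b : R, 0 < a -> a < b -> gampart s a b <= K.
Proof.
have big (r : R) : 1 <= r -> exists2 K : R, 0 <= K & forall a b : R, 0 < a -> a < b -> gampart r a b <= K.
  move=> r1; have [C C0 hC] := gamf_bound r.
  exists (2 * C) => [|a b a0 ab]; first by rewrite mulr_ge0// ltW.
  pose F x := - (2 * C) * expR (- (1 / 2 * x)); pose f x := C * expR (- (x / 2)).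
  have dF (x : R) : is_derive x 1 F (f x).
    have := isderZ (- (2 * C)) (isder_comp (isderN (isderZ (1 / 2) (isder_id x))) (is_derive_expR (- (1 / 2 * x)))).
    move=> h; apply: (is_derive_eq h); rewrite /f.
    have -> : - (1 / 2 * x) = - (x / 2) by field.
    by field.
  have cf (x : R) : {for x, continuous f}.
    have := der_continuous (isderZ (- (1 / 2)) (dF x)).
    rewrite (_ : (fun y => _) = f)//; apply/funext => y; rewrite /F /f.
    have -> : - (1 / 2 * y) = - (y / 2) by field.
    by field.
  have If : \int[mu]_(t in `[a, b]) f t = F b - F a by apply: ftc2.
  apply: (@le_trans _ _ (\int[mu]_(t in `[a, b]) f t)).
    apply: le_Rintegral => //; first exact: gamf_integrable_cc.
      apply: continuous_compact_integrable; first exact: segment_compact.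
      by apply: continuous_in_subspaceT => x _; exact: cf.
    move=> x /=; rewrite in_itv /= => /andP[ax _]; apply: hC => //; exact: lt_le_trans ax.
  rewrite If /F.
  have e1 : 0 <= expR (- (1 / 2 * b)) by exact: expR_ge0.
  have e2 : expR (- (1 / 2 * a)) <= 1 by rewrite -[leRHS]expR0 ler_expR; lra.
  have : 0 <= C * expR (- (1 / 2 * b)) by rewrite mulr_ge0// ltW.
  have : C * expR (- (1 / 2 * a)) <= C * 1 by rewrite ler_wpM2l// ltW.
  lra.
move=> s0; have s1 : 1 <= s + 1 by lra.
have [K K0 hK] := big _ s1; have [C C0 hC] := gamf_bound (s + 1).
exists ((K + C) / s) => a b a0 ab; rewrite ler_pdivlMr//.
have h1 := gampart_rec s a0 ab; have h2 := hK a b a0 ab.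
have b0 : 0 < b by lra.
have h3 := hC b b0 s1; have h4 := gamf_ge0 (s + 1) a.
have h5 : C * expR (- (b / 2)) <= C * 1.
  by rewrite ler_wpM2l ?(ltW C0)// -[leRHS]expR0 ler_expR; lra.
lra.
Qed.

(* The intervals [1 / (n + 2), n + 2] exhaust the positive half-line. *)
Let an (n : nat) : R := n.+2%:R^-1.
Let bn (n : nat) : R := n.+2%:R.
Let F (n : nat) : set R := `[an n, bn n]%classic.

Let an0 n : 0 < an n. Proof. by rewrite invr_gt0. Qed.
Let anbn n : an n < bn n.
Proof.
have h : 2 <= n.+2%:R :> R by rewrite ler_nat.
apply: (@lt_trans _ _ 1); last by rewrite /bn; lra.
by rewrite invf_lt1; lra.
Qed.

Let bigcupF : \bigcup_n F n = `]0, +oo[%classic.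
Proof.
apply/seteqP; split => x /=.
  move=> [n _]; rewrite /F /= !in_itv /= andbT => /andP[h _]; exact: lt_le_trans h.
rewrite in_itv /= andbT => x0.
exists (Num.truncn (x + x^-1)) => //; rewrite /F /= in_itv /=.
have ix : 0 < x^-1 by rewrite invr_gt0.
have := truncnS_gt (x + x^-1).
set m := Num.truncn _ => hm.
have hm2 : x + x^-1 <= m.+2%:R by apply: (le_trans (ltW hm)); rewrite ler_nat.
apply/andP; split; last by rewrite /bn; lra.
rewrite /an -[leRHS]invrK lef_pV2 ?posrE//; lra.
Qed.

Lemma gamf_measurable (s : R) : measurable_fun (`]0%R, +oo[%classic : set R) (gamf s).
Proof.
apply: open_continuous_measurable_fun; first exact: interval_open.
by move=> x; rewrite inE /= in_itv /= andbT => x0; exact: gamf_continuous.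
Qed.

Let subF n : F n `<=` (`]0%R, +oo[%classic : set R).
Proof. by rewrite -bigcupF; exact: bigcup_sup. Qed.

Let cvg_ereal (s : R) : (\int[mu]_(t in F n) (gamf s t)%:E)%E @[n --> \oo] -->
  (\int[mu]_(t in `]0%R, +oo[) (gamf s t)%:E)%E.
Proof.
rewrite -bigcupF; apply: ge0_nondecreasing_set_cvg_integral.
- apply/nondecreasing_seqP => n; apply/subsetPset => x; rewrite /F /= !in_itv /= => /andP[h1 h2].
  apply/andP; split; last by apply: (le_trans h2); rewrite /bn ler_nat.
  by apply: le_trans h1; rewrite /an lef_pV2 ?posrE// ler_nat.
- by move=> n; exact: measurable_itv.
- move=> n; apply/measurable_EFinP; apply: measurable_funS (gamf_measurable s) => //.
- by move=> n x _; rewrite lee_fin gamf_ge0.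
Qed.

Let fin_part (s : R) n : (\int[mu]_(t in F n) (gamf s t)%:E)%E = (gampart s (an n) (bn n))%:E.
Proof.
rewrite /gampart /Rintegral fineK//; apply: integrable_fin_num => //.
exact: gamf_integrable_cc.
Qed.

Lemma gamf_integrable (s : R) : 0 < s -> mu.-integrable `]0%R, +oo[ (EFin \o gamf s).
Proof.
move=> s0; have [K hK] := gampart_le s0.
apply/integrableP; split; first by apply/measurable_EFinP; exact: gamf_measurable.
apply: (@le_lt_trans _ _ K%:E); last exact: ltry.
under eq_integral => t _ do rewrite /= ger0_norm ?gamf_ge0//.
have h := @cvg_ereal s.
rewrite -(cvg_lim _ h)//; apply: lime_le; first exact: cvgP h.
by apply: nearW => n; rewrite fin_part lee_fin hK.
Qed.

Lemma gampart_cvg (s : R) : 0 < s -> gampart s (an n) (bn n) @[n --> \oo] --> Gamma s.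
Proof.
move=> s0; have h := @cvg_ereal s.
rewrite /Gamma /Rintegral -/(gamf s).
have -> : (fun n => gampart s (an n) (bn n)) =
    fine \o (fun n => (\int[mu]_(t in F n) (gamf s t)%:E)%E).
  by apply/funext => n /=; rewrite fin_part.
apply: fine_cvg; rewrite fineK//.
by apply: integrable_fin_num => //; exact: gamf_integrable.
Qed.

Lemma Gamma_rec (s : R) : 0 < s -> Gamma (s + 1) = s * Gamma s.
Proof.
move=> s0; have s1 : 0 < s + 1 by lra.
have h1 := gampart_cvg s1.
have an_0 : an n @[n --> \oo] --> (0 : R).
  have := @cvg_harmonic R; rewrite -(cvg_shiftS (@harmonic R)); exact.
have h2 : (s * gampart s (an n) (bn n) - (gamf (s + 1) (bn n) - gamf (s + 1) (an n)))
    @[n --> \oo] --> s * Gamma s - (0 - 0).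
  apply: cvgB; first by apply: cvgMr; exact: gampart_cvg.
  apply: cvgB.
    have [C C0 hC] := gamf_bound (s + 1).
    apply: (@squeeze_cvgr _ _ _ _ (fun=> 0) (fun n => 2 * C * an n)); last first.
    - by rewrite -[0](mulr0 (2 * C)); apply: cvgMr.
    - exact: cvg_cst.
    apply: nearW => n; rewrite gamf_ge0 /=.
    have b0 : 0 < bn n by rewrite /bn.
    apply: (le_trans (hC _ b0 _)); first by lra.
    rewrite [leRHS](_ : _ = C * (bn n / 2)^-1); last first.
      by rewrite (_ : an n = (bn n)^-1)//; move: b0; set b := bn n; clearbody b => b0; field; rewrite gt_eqF.
    rewrite ler_wpM2l ?(ltW C0)// expRN lef_pV2 ?posrE ?expR_gt0 ?divr_gt0//.
    by have := expR_ge1Dx (bn n / 2); lra.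
  apply: (@squeeze_cvgr _ _ _ _ (fun=> 0) (fun n => an n `^ s)).
  - apply: nearW => n; rewrite gamf_ge0 /= /gamf addrK ler_piMr ?powR_ge0//.
    by rewrite -[leRHS]expR0 ler_expR oppr_le0 ltW.
  - exact: cvg_cst.
  - by have /cvg_at_rightP := powR_cvg0 s0; apply; split.
rewrite subrr subr0 in h2.
apply: (cvg_unique _ h1) => //.
apply: cvg_trans h2; apply: near_eq_cvg; apply: nearW => n.
by rewrite gampart_rec.
Qed.

Lemma Gamma_gt0 (s : R) : 0 < s -> 0 < Gamma s.
Proof.
move=> s0.
pose c : R := 1 / 2 * expR (- 2).
have c0 : 0 < c by rewrite mulr_gt0 ?expR_gt0.
apply: (lt_le_trans c0).
have h1 : c <= gampart s 1 2.
  apply: (@le_trans _ _ (\int[mu]_(t in `[1, 2]) c)).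
    have -> : \int[mu]_(t in `[1%R, 2]) c = c * 2 - c * 1.
      apply: (@ftc2 (fun=> c) (fun x => c * x)); first lra.
        by move=> x _; have := isderZ c (isder_id x); rewrite mulr1.
      by move=> x _; exact: cvg_cst.
    lra.
  apply: le_Rintegral => //; last 2 first.
  - by apply: gamf_integrable_cc.
  - move=> x /=; rewrite in_itv /= => /andP[x1 x2].
    rewrite /c /gamf; apply: ler_pM; rewrite ?expR_ge0//; last by rewrite ler_expR; lra.
    apply: (@le_trans _ _ (x `^ (- 1))); last by rewrite ler_powR//; lra.
    by rewrite powR_inv1 ?mul1r ?lef_pV2 ?posrE//; lra.
  - apply: continuous_compact_integrable; first exact: segment_compact.
    by apply: continuous_in_subspaceT => x _; exact: cvg_cst.
apply: (le_trans h1); rewrite /Gamma /gampart /Rintegral -/(gamf s).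
apply: fine_le.
- by apply: integrable_fin_num => //; exact: gamf_integrable_cc.
- by apply: integrable_fin_num => //; exact: gamf_integrable.
apply: ge0_subset_integral => //.
- by apply/measurable_EFinP; exact: gamf_measurable.
- by move=> x _; rewrite lee_fin gamf_ge0.
- by move=> x /=; rewrite !in_itv /= andbT => /andP[h _]; lra.
Qed.

(** A linear bound on t^e1 integrates to a bound on Gamma(s + e1). *)
Lemma Gamma_combine (s a b e1 : R) : 0 < s -> 0 < e1 ->
  (forall t : R, 0 < t -> t `^ e1 <= a + b * t) ->
  Gamma (s + e1) <= a * Gamma s + b * Gamma (s + 1).
Proof.
move=> s0 e0 h; have s1 : 0 < s + 1 by lra. have se : 0 < s + e1 by lra.
have i0 := gamf_integrable s0; have i1 := gamf_integrable s1.
have j0 : mu.-integrable `]0%R, +oo[ (EFin \o (fun t => a * gamf s t)).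
  have := @integrableZl _ _ _ mu `]0%R, +oo[%classic (measurable_itv _) a _ i0.
  by apply: eq_integrable.
have j1 : mu.-integrable `]0%R, +oo[ (EFin \o (fun t => b * gamf (s + 1) t)).
  have := @integrableZl _ _ _ mu `]0%R, +oo[%classic (measurable_itv _) b _ i1.
  by apply: eq_integrable.
rewrite /Gamma -/(gamf s) -/(gamf (s + 1)) -/(gamf (s + e1)).
rewrite -RintegralZl// -[X in _ <= _ + X]RintegralZl// -RintegralD//.
apply: le_Rintegral => //; first exact: gamf_integrable.
  have := @integrableD _ _ _ mu `]0%R, +oo[%classic (measurable_itv _) _ _ j0 j1.
  by apply: eq_integrable.
move=> t /=; rewrite in_itv /= andbT => t0.
have tn : t != 0 by rewrite gt_eqF.
rewrite /gamf addrK (_ : s + e1 - 1 = (s - 1) + e1); last by ring.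
rewrite powRD ?tn ?implybT//.
have -> : t `^ s = t `^ (s - 1) * t.
  by rewrite -[X in _ * X](powRr1 (ltW t0)) -powRD ?subrK// tn implybT.
have p0 : 0 <= t `^ (s - 1) * expR (- t) by rewrite mulr_ge0 ?powR_ge0 ?expR_ge0.
have := ler_wpM2l p0 (h t t0); lra.
Qed.

Lemma cube_root (s : R) : 0 < s -> exists2 x : R, 0 < x & x ^+ 3 = s /\ x = s `^ (1 / 3).
Proof.
move=> s0; exists (s `^ (1 / 3)); first exact: powR_gt0.
split => //; rewrite -powR_mulrn ?powR_ge0// -powRrM.
by rewrite (_ : 1 / 3 * 3%:R = 1) ?powRr1 ?(ltW s0)//; field.
Qed.

(** Log-convexity of Gamma between s and s + 1, cubed.  The linear bound on t^(2/3)
    is its tangent at t = s. *)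
Lemma Gamma_two_thirds (s : R) : 0 < s -> Gamma (s + 2 / 3) ^+ 3 <= s ^+ 2 * Gamma s ^+ 3.
Proof.
move=> s0; have [x x0 [x3 _]] := cube_root s0.
have h : Gamma (s + 2 / 3) <= x ^+ 2 / 3 * Gamma s + 2 / (3 * x) * Gamma (s + 1).
  apply: Gamma_combine => // t t0.
  have [y y0 [y3 ye]] := cube_root t0.
  have -> : t `^ (2 / 3) = y ^+ 2.
    by rewrite ye -powR_mulrn ?powR_ge0// -powRrM; congr (_ `^ _); field.
  rewrite -y3 -subr_ge0 (_ : _ - _ = (x - y) ^+ 2 * (x + 2 * y) / (3 * x)); last first.
    by field; rewrite gt_eqF.
  by apply: divr_ge0; [apply: mulr_ge0; [exact: sqr_ge0 | lra] | lra].
have G0 := Gamma_gt0 s0; have s2 : 0 < s + 2 / 3 by lra.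
have -> : s ^+ 2 * Gamma s ^+ 3 = (x ^+ 2 * Gamma s) ^+ 3 by rewrite -x3; ring.
apply: lerXn2r; rewrite ?nnegrE; first exact/ltW/Gamma_gt0.
  by rewrite mulr_ge0 ?sqr_ge0// ltW.
apply: (le_trans h); rewrite Gamma_rec// -x3 le_eqVlt; apply/orP; left; apply/eqP.
by field; rewrite gt_eqF.
Qed.

(** As above, with the tangent of t^(1/3) at t = s. *)
Lemma Gamma_one_third (s : R) : 0 < s -> Gamma (s + 1 / 3) ^+ 3 <= s * Gamma s ^+ 3.
Proof.
move=> s0; have [x x0 [x3 _]] := cube_root s0.
have h : Gamma (s + 1 / 3) <= 2 * x / 3 * Gamma s + 1 / (3 * x ^+ 2) * Gamma (s + 1).
  apply: Gamma_combine => // t t0.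
  have [y y0 [y3 ye]] := cube_root t0.
  rewrite -ye -y3 -subr_ge0 (_ : _ - _ = (x - y) ^+ 2 * (2 * x + y) / (3 * x ^+ 2)); last first.
    by field; rewrite gt_eqF.
  apply: divr_ge0; first by apply: mulr_ge0; [exact: sqr_ge0 | lra].
  by apply: mulr_ge0 => //; exact: sqr_ge0.
have G0 := Gamma_gt0 s0; have s2 : 0 < s + 1 / 3 by lra.
have -> : s * Gamma s ^+ 3 = (x * Gamma s) ^+ 3 by rewrite -x3; ring.
apply: lerXn2r; rewrite ?nnegrE; first exact/ltW/Gamma_gt0.
  by rewrite mulr_ge0 ?(ltW x0)// ltW.
apply: (le_trans h); rewrite Gamma_rec// -x3 le_eqVlt; apply/orP; left; apply/eqP.
by field; rewrite gt_eqF.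
Qed.
End GammaFacts.

(** * The function A *)

Section AiryA.
Variable R : realType.

Let p0 : R := (Gamma (2 / 3 : R))^-1.
Let q0 : R := (3 * Gamma (4 / 3 : R))^-1.

Let s23 m : 0 < m%:R + 2 / 3 :> R.
Proof. by have : 0 <= m%:R :> R by []; lra. Qed.
Let s43 m : 0 < m%:R + 4 / 3 :> R.
Proof. by have : 0 <= m%:R :> R by []; lra. Qed.

Lemma airy_coefSSS (p q : R) e :
  airy_coef p q e.+3 = airy_coef p q e / (3 * e.+3%:R * e.+2%:R).
Proof. by []. Qed.

Lemma coef_p m : airy_coef p0 0 (3 * m)%N =
  (27 ^+ m * m`!%:R * Gamma (m%:R + 2 / 3 : R))^-1.
Proof.
elim: m => [|m IH]; first by rewrite muln0 /= expr0 fact0 !mul1r add0r.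
have -> : (3 * m.+1)%N = (3 * m).+3 by lia.
rewrite airy_coefSSS IH factS natrM exprS.
have -> : m.+1%:R + 2 / 3 = (m%:R + 2 / 3) + 1 :> R by rewrite -natr1; ring.
rewrite Gamma_rec//.
have -> : (3 * m).+3%:R = 3 * m%:R + 3 :> R by rewrite -!natr1 natrM; ring.
have -> : (3 * m).+2%:R = 3 * m%:R + 2 :> R by rewrite -!natr1 natrM; ring.
rewrite -[m.+1%:R]natr1.
have G0 := Gamma_gt0 (s23 m); have f0 : 0 < m`!%:R :> R by rewrite ltr0n fact_gt0.
have e0 : 0 < 27 ^+ m :> R by exact: exprn_gt0.
have M0 : 0 <= m%:R :> R by [].
clear IH; move: G0 f0 e0 M0; set G := Gamma _; set f := m`!%:R; set e := 27 ^+ m; set M := m%:R.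
clearbody G f e M => G0 f0 e0 M0; field; rewrite !gt_eqF//; lra.
Qed.

Lemma coef_q m : airy_coef 0 q0 (3 * m).+1%N =
  (3 * 27 ^+ m * m`!%:R * Gamma (m%:R + 4 / 3 : R))^-1.
Proof.
elim: m => [|m IH]; first by rewrite muln0 /= expr0 fact0 !mulr1 add0r.
have -> : (3 * m.+1).+1%N = (3 * m).+1.+3 by lia.
rewrite airy_coefSSS IH factS natrM exprS.
have -> : m.+1%:R + 4 / 3 = (m%:R + 4 / 3) + 1 :> R by rewrite -natr1; ring.
rewrite Gamma_rec//.
have -> : (3 * m).+4%:R = 3 * m%:R + 4 :> R by rewrite -!natr1 natrM; ring.
have -> : (3 * m).+3%:R = 3 * m%:R + 3 :> R by rewrite -!natr1 natrM; ring.
rewrite -[m.+1%:R]natr1.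
have G0 := Gamma_gt0 (s43 m); have f0 : 0 < m`!%:R :> R by rewrite ltr0n fact_gt0.
have e0 : 0 < 27 ^+ m :> R by exact: exprn_gt0.
have M0 : 0 <= m%:R :> R by [].
clear IH; move: G0 f0 e0 M0; set G := Gamma _; set f := m`!%:R; set e := 27 ^+ m; set M := m%:R.
clearbody G f e M => G0 f0 e0 M0; field; rewrite !gt_eqF//; lra.
Qed.

Lemma airy_coefI m : airy_coef p0 0 (3 * m)%N ^+ 3 <=
  27 * (m%:R + 2 / 3) ^+ 2 * airy_coef 0 q0 (3 * m).+1 ^+ 3.
Proof.
rewrite coef_p coef_q.
have -> : m%:R + 4 / 3 = (m%:R + 2 / 3) + 2 / 3 :> R by field.
have h := Gamma_two_thirds (s23 m).
have G0 := Gamma_gt0 (s23 m).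
have G1 : 0 < Gamma (m%:R + 2 / 3 + 2 / 3 : R) by apply: Gamma_gt0; have := s23 m; lra.
have f0 : 0 < 27 ^+ m * m`!%:R :> R by rewrite mulr_gt0 ?exprn_gt0// ltr0n fact_gt0.
have -> : 3 * 27 ^+ m * m`!%:R = 3 * (27 ^+ m * m`!%:R) :> R by rewrite mulrA.
move: h G0 G1 f0; set G := Gamma (m%:R + 2 / 3); set H := Gamma _; set s := m%:R + 2 / 3.
set f := 27 ^+ m * _; clearbody G H s f => h G0 G1 f0.
rewrite [leRHS](_ : _ = s ^+ 2 / (f ^+ 3 * H ^+ 3)); last by field; rewrite !gt_eqF.
rewrite [leLHS](_ : _ = (f ^+ 3 * G ^+ 3)^-1); last by field; rewrite !gt_eqF.
have F3 : 0 < f ^+ 3 := exprn_gt0 _ f0.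
rewrite ler_pdivlMr ?mulr_gt0 ?exprn_gt0// ler_pdivrMl ?mulr_gt0 ?exprn_gt0//.
rewrite [leRHS](_ : _ = f ^+ 3 * (s ^+ 2 * G ^+ 3)); last by ring.
by rewrite ler_pM2l.
Qed.

Lemma airy_coefII m : airy_coef 0 q0 (3 * m).+1 ^+ 3 <=
  729 * (m%:R + 1) ^+ 3 * (m%:R + 4 / 3) * airy_coef p0 0 (3 * m).+3 ^+ 3.
Proof.
have -> : (3 * m).+3 = (3 * m.+1)%N by lia.
rewrite coef_p coef_q factS natrM (exprS 27 m).
have -> : m.+1%:R + 2 / 3 = (m%:R + 4 / 3) + 1 / 3 :> R by rewrite -natr1; field.
have h := Gamma_one_third (s43 m).
have G0 := Gamma_gt0 (s43 m).
have G1 : 0 < Gamma (m%:R + 4 / 3 + 1 / 3 : R) by apply: Gamma_gt0; have := s43 m; lra.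
have f0 : 0 < 27 ^+ m * m`!%:R :> R by rewrite mulr_gt0 ?exprn_gt0// ltr0n fact_gt0.
have M0 : 0 < m%:R + 1 :> R by rewrite natr1.
rewrite -[m.+1%:R]natr1.
have -> : 3 * 27 ^+ m * m`!%:R = 3 * (27 ^+ m * m`!%:R) :> R by rewrite mulrA.
have -> : 27 * 27 ^+ m * ((m%:R + 1) * m`!%:R) = 27 * (m%:R + 1) * (27 ^+ m * m`!%:R) :> R by ring.
move: h G0 G1 f0 M0; set G := Gamma (m%:R + 4 / 3); set H := Gamma _; set s := m%:R + 4 / 3.
set f := 27 ^+ m * _; set M := m%:R + 1; clearbody G H s f M => h G0 G1 f0 M0.
rewrite [leRHS](_ : _ = s / 27 / (f ^+ 3 * H ^+ 3)); last by field; rewrite !gt_eqF.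
rewrite [leLHS](_ : _ = (27 * (f ^+ 3 * G ^+ 3))^-1); last by field; rewrite !gt_eqF.
have F3 : 0 < f ^+ 3 := exprn_gt0 _ f0.
have G3 : 0 < G ^+ 3 := exprn_gt0 _ G0.
have H3 : 0 < H ^+ 3 := exprn_gt0 _ G1.
rewrite ler_pdivlMr ?mulr_gt0// ler_pdivrMl ?mulr_gt0//.
rewrite [leRHS](_ : _ = f ^+ 3 * (s * G ^+ 3)); last by field.
by rewrite ler_pM2l.
Qed.

Arguments airy_coef : simpl never.

(** The m-th term of the series defining A collects the exponents 3 m and 3 m + 1;
    the exponents 3 m + 2 do not occur. *)
Lemma airyAE (x : R) : airyA x = pi / 3 * airyS p0 (- q0) (- x).
Proof.
rewrite /airyA; congr (_ * _).
have hc := airy_coef_superdecay p0 (- q0).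
apply: cvg_lim => //.
rewrite (_ : series _ = (pseries (airy_coef p0 (- q0)) (- x)) \o (fun n => 3 * n)%N); last first.
  apply/funext => n /=; rewrite /pseries /series /=.
  elim: n => [|n IH]; first by rewrite muln0 !big_geq.
  have -> : (3 * n.+1)%N = (3 * n).+3 by lia.
  rewrite !big_nat_recr//= IH -!addrA; congr (_ + _).
  have lin e : airy_coef p0 (- q0) e = airy_coef p0 0 e - airy_coef 0 q0 e.
    by rewrite airy_coef_lin -[in RHS]mulN1r -airy_coefZ mulr0 mulN1r.
  rewrite !lin.
  have m1 : ((3 * n).+1 %% 3 = 1)%N by rewrite mulnC -addn1 modnMDl.
  have m2 : ((3 * n).+2 %% 3 = 2)%N by rewrite mulnC -addn2 modnMDl.
  have m0 : (3 * n %% 3 = 0)%N by rewrite modnMr.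
  have z1 : airy_coef p0 0 (3 * n).+1 = 0 by apply: airy_coef_p => //; rewrite m1.
  have z2 : airy_coef p0 0 (3 * n).+2 = 0 by apply: airy_coef_p => //; rewrite m2.
  have z3 : airy_coef 0 q0 (3 * n)%N = 0 by apply: airy_coef_q => //; rewrite m0.
  have z4 : airy_coef 0 q0 (3 * n).+2 = 0 by apply: airy_coef_q => //; rewrite m2.
  rewrite z1 z2 z3 z4.
  rewrite coef_p coef_q !sub0r subr0 oppr0 mul0r addr0.
  rewrite (exprSr (- x) (3 * n)) (exprM (- x) 3 n) (exprM (- x / 3) 3 n).
  have -> : (- x / 3) ^+ 3 = (- x) ^+ 3 / 27 by field.
  rewrite expr_div_n.
  have G0 := Gamma_gt0 (s23 n); have G1 := Gamma_gt0 (s43 n).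
  have f0 : 0 < n`!%:R :> R by rewrite ltr0n fact_gt0.
  have e0 : 0 < 27 ^+ n :> R by exact: exprn_gt0.
  move: G0 G1 f0 e0; set G := Gamma _; set H := Gamma _; set f := _`!%:R; set e := 27 ^+ n.
  set y := ((- x) ^+ 3) ^+ n; clearbody G H f e y => G0 G1 f0 e0; field; rewrite !gt_eqF//.
have hcv : pseries (airy_coef p0 (- q0)) (- x) @ \oo --> airyS p0 (- q0) (- x).
  exact: superdecay_cvg (- x) hc.
apply: cvg_comp hcv.
apply/cvgnyPge => A; near=> n.
rewrite (@leq_trans n)//; first by near: n; exact: nbhs_infty_ge.
by rewrite leq_pmull.
Unshelve. all: end_near. Qed.

Let pg : 0 < p0. Proof. by rewrite invr_gt0 Gamma_gt0//; lra. Qed.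
Let qg : 0 < q0. Proof. by rewrite invr_gt0 mulr_gt0 ?Gamma_gt0//; lra. Qed.

(** The function F(y) = (3 / pi) A(- y) and its derivative. *)
Definition airyF : R -> R := airyS p0 (- q0).
Definition airyF' : R -> R := airyS' p0 (- q0).

Lemma airyF_derive (x : R) : is_derive x 1 airyF (airyF' x).
Proof. exact: airyS_derive. Qed.

Lemma airyF'_derive (x : R) : is_derive x 1 airyF' (x / 3 * airyF x).
Proof. exact: airyS'_derive. Qed.

Lemma airyF_gt0 (y : R) : 0 <= y -> 0 < airyF y.
Proof. exact: (recessive_gt0 pg qg airy_coefI airy_coefII). Qed.

Lemma airyF_small (c : R) : 0 < c -> exists2 Y : R, 0 < Y & forall y, Y <= y -> airyF y < c.
Proof. exact: (recessive_small pg qg airy_coefI airy_coefII). Qed.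

Lemma airyF_simple (x : R) : airyF x = 0 -> airyF' x != 0.
Proof. exact: (recessive_simple pg qg). Qed.

Lemma airyA_eq0 (x : R) : (airyA x == 0) = (airyF (- x) == 0).
Proof.
rewrite airyAE; have h : 0 < pi / 3 :> R by rewrite divr_gt0 ?pi_gt0.
by rewrite mulf_eq0 (gt_eqF h).
Qed.
End AiryA.

(** * Nodal intervals *)

Section Nodal.
Variable R : realType.

Lemma ivt_sign (f : R -> R) (a b : R) : (forall x : R, {for x, continuous f}) ->
  a <= b -> f a * f b <= 0 -> exists2 x : R, a <= x <= b & f x = 0.
Proof.
move=> cf ab fab.
have [||x] := @IVT R f a b 0 ab.
- by apply: continuous_in_subspaceT => x _; exact: cf.
- have [fa|fa] := leP 0 (f a); have [fb|fb] := leP 0 (f b).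
  + have : f a * f b = 0 by apply/le_anti; rewrite fab mulr_ge0.
    move=> /eqP; rewrite mulf_eq0 => /orP[] /eqP e; rewrite e.
      by rewrite le_max lexx andbT ge_min lexx.
    by rewrite le_max lexx orbT andbT ge_min lexx orbT.
  + by rewrite ge_min (ltW fb) orbT le_max fa.
  + by rewrite ge_min (ltW fa) le_max fb orbT.
  + by move: fab; rewrite leNgt nmulr_rgt0// fb.
by rewrite in_itv /= => xab fx; exists x.
Qed.

Lemma same_sign (f : R -> R) (x y : R) : (forall x : R, {for x, continuous f}) ->
  (forall z, Num.min x y <= z <= Num.max x y -> f z != 0) -> 0 < f x -> 0 < f y.
Proof.
move=> cf nz fx; rewrite ltNge; apply/negP => fy.
have fxy : f x * f y <= 0 by rewrite mulr_ge0_le0// ltW.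
have [xy|/ltW yx] := leP x y.
  have [z zxy fz] := ivt_sign cf xy fxy; have := nz z.
  by rewrite (min_idPl xy) (max_idPr xy) zxy fz eqxx => /(_ isT).
rewrite mulrC in fxy; have [z zxy fz] := ivt_sign cf yx fxy; have := nz z.
by rewrite (min_idPr yx) (max_idPl yx) zxy fz eqxx => /(_ isT).
Qed.

Lemma positive_lower_bound (f : R -> R) (a b : R) : (forall x : R, {for x, continuous f}) ->
  (forall x, a <= x <= b -> 0 < f x) ->
  exists2 c : R, 0 < c & forall x, a <= x <= b -> 2 * c <= f x.
Proof.
move=> cf f0.
have ci x : a <= x <= b -> {for x, continuous (fun y => (f y)^-1)}.
  by move=> /f0 fx; apply: cvgV; [rewrite gt_eqF | exact: cf].
have [K K0 hK] := bounded_on ci.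
exists (1 / (2 * K)) => [|x xab]; first by rewrite divr_gt0// mulr_gt0.
have fx := f0 x xab; have := hK x xab.
rewrite gtr0_norm ?invr_gt0// => h.
have -> : 2 * (1 / (2 * K)) = K^-1 by field; rewrite gt_eqF.
by rewrite -[leRHS]invrK lef_pV2 ?posrE ?invr_gt0.
Qed.

(** A bump exists on the nodal interval (a, b) if f gets arbitrarily small at points
    near or beyond b with f positive up to there. *)
Lemma nodal_bump (nu xi i a b : R) (f f' : R -> R) :
  0 < nu -> 0 <= i -> i < xi ->
  (forall x : R, is_derive x 1 f (f' x)) ->
  (forall x : R, is_derive x 1 f' ((x - i) / 3 * f x)) ->
  0 <= a -> a < b -> f a <= 0 -> (forall x, a < x < b -> 0 < f x) ->
  (forall c : R, 0 < c -> forall y, y < b -> exists X : R,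
     [/\ y < X, f X < c & forall x : R, a < x <= X -> 0 < f x]) ->
  exists p, negative_bump nu xi a f p.
Proof.
move=> nu0 i0 ixi df df' a0 ab fa fpos esc.
have cf (x : R) : {for x, continuous f} := der_continuous (df x).
pose r := (b - a) / 8; pose m := (a + b) / 2.
have r0 : 0 < r by rewrite /r; lra.
have [c0 c00 hc0] : exists2 c : R, 0 < c & forall x, m - 2 * r <= x <= m + r -> 2 * c <= f x.
  apply: positive_lower_bound => // x hx; apply: fpos; move: hx; rewrite /m /r; lra.
have am : a <= m - 2 * r by rewrite /m /r; lra.
have mb : m + r < b by rewrite /m /r; lra.
have [g [lo [hi [h1 H]]]] := bump_exists nu0 i0 ixi df df' a0 fa r0 c00 am hc0
  (fun c hc => esc c hc (m + r) mb).
by exists (g, lo, hi, h1).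
Qed.

Lemma escape_finite (f : R -> R) (a b : R) : (forall x : R, {for x, continuous f}) ->
  a < b -> f b <= 0 -> (forall x, a < x < b -> 0 < f x) ->
  forall c : R, 0 < c -> forall y, y < b -> exists X : R,
     [/\ y < X, f X < c & forall x : R, a < x <= X -> 0 < f x].
Proof.
move=> cf ab fb fpos c c0 y yb.
have [e e0 he] := near_lt (cf b) (le_lt_trans fb c0).
pose d := Num.min (e / 2) ((b - y) / 2).
have d0 : 0 < d by rewrite lt_min; apply/andP; split; lra.
have d1 : d <= e / 2 by rewrite ge_min lexx.
have d2 : d <= (b - y) / 2 by rewrite ge_min lexx orbT.
exists (b - d); split; first lra.
  by apply: he; rewrite gtr0_norm; lra.
by move=> x /andP[ax xb]; apply: fpos; lra.
Qed.
End Nodal.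

(** * Eigenvalues and the zeros of A *)

Section Zeros.
Variables (R : realType) (i : nat -> R).
Hypothesis hi : lists_positive_zeros (@airyA R) i.

Lemma zero_pos k : (0 < k)%N -> 0 < i k.
Proof. by move=> k0; have [/(_ k k0)[]] := hi. Qed.

Lemma zero_airyF k : (0 < k)%N -> airyF (- i k) = 0.
Proof.
by move=> k0; have [/(_ k k0)[_ /eqP]] := hi; rewrite airyA_eq0 => /eqP.
Qed.

Lemma zero_lt k l : (0 < k)%N -> (0 < l)%N -> (i k < i l) = (k < l)%N.
Proof.
move=> k0 l0; have [_ mono _] := hi.
case: (ltngtP k l) => [kl|lk|->]; last by rewrite ltxx.
  by rewrite mono.
by apply/negbTE; rewrite -leNgt ltW// mono.
Qed.

Lemma airyF_zero (u : R) : airyF (- u) = 0 -> exists2 k, (0 < k)%N & u = i k.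
Proof.
move=> Fu; have [_ _ all] := hi; apply: all; last by apply/eqP; rewrite airyA_eq0 Fu.
rewrite ltNge; apply/negP => u0; have u1 : 0 <= - u by rewrite oppr_ge0.
by have := airyF_gt0 u1; rewrite Fu ltxx.
Qed.

Lemma shifted_derive (c x : R) : is_derive x 1 (fun y => airyF (y - c)) (airyF' (x - c)).
Proof.
have := isder_comp (isderB (isder_id x) (isder_cst x c)) (airyF_derive (x - c)).
by rewrite subr0 mul1r.
Qed.

Lemma shifted_derive' (c x : R) :
  is_derive x 1 (fun y => airyF' (y - c)) ((x - c) / 3 * airyF (x - c)).
Proof.
have := isder_comp (isderB (isder_id x) (isder_cst x c)) (airyF'_derive (x - c)).
by rewrite subr0 mul1r.
Qed.

(** The lower bound is applied to A(xi' - x) with xi < xi' < i_(k+1) and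
    xi' > i_k, so that its zeros in x >= 0 are xi' - i_1, ..., xi' - i_k. *)
Lemma eigenvalue_ge_eventually (nu xi : R) (k : nat) : 0 < nu -> 0 <= xi -> xi < i k.+1 ->
  exists2 h1 : R, 0 < h1 & forall (N : nat) (h : R),
    0 < h < h1 -> N.+1%:R * h ^+ 3 = 24 ->
    (lam_of xi h N)^-1 <= (eigenvalues (L_matrix nu N.+1))`_k.
Proof.
move=> nu0 xi0 xik.
pose lo := if k is 0 then xi else Num.max xi (i k).
have lok : lo < i k.+1 by rewrite /lo; case: (k) xik => // k' h; rewrite gt_max h zero_lt ?ltnSn.
have xilo : xi <= lo by rewrite /lo; case: (k) => // k'; rewrite le_max lexx.
pose xi' := (lo + i k.+1) / 2.
have xx' : xi < xi' by rewrite /xi'; lra.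
have x'k : xi' < i k.+1 by rewrite /xi'; lra.
have lox : lo < xi' by rewrite /xi'; lra.
apply: (@eigenvalue_lower_bound R nu xi xi' (fun y => airyF (y - xi')) (fun y => airyF' (y - xi'))
  k (fun l => xi' - i l.+1)) => //.
- exact: shifted_derive.
- exact: shifted_derive'.
- by move=> x; exact: airyF_simple.
move=> x x0 fx; have : airyF (- (xi' - x)) = 0 by rewrite opprB.
move=> /airyF_zero[l l0 e].
have lk : (l < k.+1)%N by rewrite -(zero_lt l0)// -e; lra.
have l1 : (l.-1 < k)%N by rewrite -ltnS prednK.
by exists (Ordinal l1) => /=; rewrite prednK// -e; ring.
Qed.

(** The upper bound is applied to f(x) = A(i_(k+1) - x), whose l-th nodal interval
    starts at a l = i_(k+1) - i_(k+1-l), with the sign of f at the interior point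
    mid l. *)
Lemma eigenvalue_lt_eventually (nu xi : R) (k : nat) : 0 < nu -> i k.+1 < xi ->
  exists2 h1 : R, 0 < h1 & forall (N : nat) (h : R),
    0 < h < h1 -> N.+1%:R * h ^+ 3 = 24 ->
    (eigenvalues (L_matrix nu N.+1))`_k < (lam_of xi h N)^-1.
Proof.
move=> nu0 xik.
pose c := i k.+1; have c0 : 0 < c by exact: zero_pos.
have xi0 : 0 <= xi by rewrite -/c in xik; lra.
pose a (l : 'I_k.+1) := c - i (k.+1 - l)%N.
have kl (l : 'I_k.+1) : (0 < k.+1 - l)%N by have := ltn_ord l; lia.
pose f x := airyF (x - c); pose f' x := airyF' (x - c).
have df (x : R) : is_derive x 1 f (f' x) by exact: shifted_derive.
have df' (x : R) : is_derive x 1 f' ((x - c) / 3 * f x) by exact: shifted_derive'.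
have fa l : f (a l) = 0 by rewrite /f /a addrAC subrr sub0r zero_airyF.
have cf (x : R) : {for x, continuous f} := der_continuous (df x).
pose mid (l : 'I_k.+1) := if (l < k)%N then c - (i (k.+1 - l)%N + i (k - l)%N) / 2 else c.
pose F l x := Num.sg (f (mid l)) * f x.
apply: (@eigenvalue_upper_of_bumps R nu xi k a F) => //.
  move=> l m lm; split; last by rewrite /F fa mulr0.
  have h : i (k.+1 - m)%N < i (k.+1 - l)%N by rewrite zero_lt//; have := ltn_ord m; lia.
  by rewrite /a; lra.
move=> l.
have dF (x : R) : is_derive x 1 (F l) (Num.sg (f (mid l)) * f' x) by exact: isderZ.
have dF' (x : R) : is_derive x 1 (fun y => Num.sg (f (mid l)) * f' y) ((x - c) / 3 * F l x).
  by apply: (is_derive_eq (isderZ _ (df' x))); rewrite /F; ring.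
have cF (x : R) : {for x, continuous (F l)} := der_continuous (dF x).
have a0 : 0 <= a l.
  rewrite /a subr_ge0 /c; case: (posnP l) => [->|l0]; first by rewrite subn0.
  by apply: ltW; rewrite zero_lt//; have := ltn_ord l; lia.
have Fa : F l (a l) <= 0 by rewrite /F fa mulr0.
have [lk|kl'] := ltnP l k.
  (* a bounded nodal interval, ending at the next zero *)
  pose b := c - i (k - l)%N.
  have kl0 : (0 < k - l)%N by lia.
  have ii : i (k - l)%N < i (k.+1 - l)%N by rewrite zero_lt//; lia.
  have ab : a l < b by rewrite /a /b; lra.
  have midE : mid l = (a l + b) / 2 by rewrite /mid lk /a /b; field.
  have fnz x : a l < x < b -> f x != 0.
    move=> /andP[ax xb]; apply/eqP => fx.
    have : airyF (- (c - x)) = 0 by rewrite opprB.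
    move=> /airyF_zero[n n0 e].
    have n1 : (n < k.+1 - l)%N by rewrite -(zero_lt n0)// -e; move: ax; rewrite /a; lra.
    have n2 : (k - l < n)%N by rewrite -(zero_lt _ n0)// -e; move: xb; rewrite /b; lra.
    lia.
  have midin : a l < mid l < b by rewrite midE; lra.
  have Fpos x : a l < x < b -> 0 < F l x.
    move=> xab; apply: (same_sign (x := mid l)) cF _ _.
      move=> z hz; rewrite /F mulf_neq0// ?sgr_eq0 ?fnz//.
      move: hz; rewrite ge_min le_max => /andP[/orP[] h1 /orP[] h2]; lra.
    by rewrite /F -normrEsg normr_gt0 fnz.
  apply: (@nodal_bump R nu xi c (a l) b (F l) _ nu0 (ltW c0) xik dF dF') => //.
  apply: escape_finite => //; rewrite /F /f /b addrAC subrr sub0r zero_airyF ?mulr0//.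
(* the last nodal interval is unbounded; there the function decays *)
have lE : l = k :> nat by apply/eqP; rewrite eqn_leq -ltnS ltn_ord.
have i1 : 0 < i 1%N by exact: zero_pos.
have aE : a l = c - i 1%N by rewrite /a lE subSnn.
have fc : 0 < f c by rewrite /f subrr airyF_gt0.
have FE x : F l x = f x by rewrite /F /mid lE ltnn gtr0_sg// mul1r.
have fnz x : a l < x -> f x != 0.
  move=> ax; apply/eqP => fx.
  have : airyF (- (c - x)) = 0 by rewrite opprB.
  move=> /airyF_zero[n n0 e].
  have : (n < 1)%N by rewrite -(zero_lt n0)// -e; move: ax; rewrite aE; lra.
  lia.
have Fpos x : a l < x -> 0 < F l x.
  move=> ax; rewrite FE; apply: (same_sign (x := c)) cf _ fc => z /andP[hz _].
  by apply: fnz; move: hz; rewrite ge_min aE; rewrite aE in ax; case/orP; lra.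
have ab : a l < c + 1 by rewrite aE; lra.
apply: (@nodal_bump R nu xi c (a l) (c + 1) (F l) _ nu0 (ltW c0) xik dF dF') => //.
  by move=> x /andP[/Fpos].
move=> e e0 y yc.
have [Y Y0 hY] := airyF_small e0.
exists (Num.max (y + 1) (Y + c)); split; first by rewrite lt_max ltrDl ltr01.
  by rewrite FE; apply: hY; rewrite lerBrDr le_max lexx orbT.
by move=> x /andP[/Fpos].
Qed.

(** The two bounds with xi = i_(k+1) -+ eta, and 1 / (1 - h^2 xi / 12) expanded to
    first order. *)
Lemma eigenvalue_asymptotics (nu e : R) (k : nat) : 0 < nu -> 0 < e ->
  exists2 h1 : R, 0 < h1 & forall (N : nat) (h : R),
    0 < h < h1 -> N.+1%:R * h ^+ 3 = 24 ->
    `|4 * N.+1%:R ^+ 2 * (eigenvalues (L_matrix nu N.+1))`_k - 1 - i k.+1 * (h ^+ 2 / 12)|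
      <= e * h ^+ 2.
Proof.
move=> nu0 e0; pose c := i k.+1; have c0 : 0 < c by exact: zero_pos.
pose eta := Num.min e (c / 2).
have eta0 : 0 < eta by rewrite lt_min e0 divr_gt0.
have eta1 : eta <= e by rewrite ge_min lexx.
have eta2 : eta <= c / 2 by rewrite ge_min lexx orbT.
clearbody eta.
have x1 : 0 <= c - eta by lra. have x2 : c - eta < i k.+1 by rewrite -/c; lra.
have x3 : i k.+1 < c + eta by rewrite -/c; lra.
have [ha ha0 Ha] := eigenvalue_ge_eventually nu0 x1 x2.
have [hb hb0 Hb] := eigenvalue_lt_eventually nu0 x3.
pose x := c + eta; have x0 : 0 < x by rewrite /x; lra.
have xx : 0 < x ^+ 2 + x + 1 by apply: addr_gt0 => //; apply: addr_gt0 => //; exact: exprn_gt0.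
exists (Num.min (Num.min ha hb) (Num.min 1 (Num.min (1 / (x ^+ 2 + x + 1)) (eta / (x ^+ 2 + x + 1))))).
  by rewrite !lt_min ha0 hb0 ltr01 !divr_gt0.
move=> N h /andP[h0]; rewrite !lt_min => /andP[/andP[h_a h_b] /and3P[h_1 h_x h_e]] hN.
have {}Ha := Ha N h (introT andP (conj h0 h_a)) hN.
have {}Hb := Hb N h (introT andP (conj h0 h_b)) hN.
rewrite /lam_of -/x in Ha Hb.
set M := (eigenvalues _)`_k in Ha Hb *.
set n : R := N.+1%:R in hN Ha Hb *.
have n0 : 0 < 4 * n ^+ 2 by rewrite mulr_gt0// exprn_gt0// /n.
set m := 4 * n ^+ 2 in n0 Ha Hb *.
set y := h ^+ 2 / 12.
have h2 : 0 < h ^+ 2 := exprn_gt0 2 h0.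
have h2h : h ^+ 2 <= h by rewrite expr2 ler_piMl// ltW.
have hx2 : h * (x ^+ 2 + x + 1) < 1 by move: h_x; rewrite ltr_pdivlMr.
have hxe : h * (x ^+ 2 + x + 1) < eta by move: h_e; rewrite ltr_pdivlMr.
have xs := sqr_ge0 x.
have q1 : h ^+ 2 * x < 1.
  have : h ^+ 2 * x <= h * x by rewrite ler_wpM2r// ltW.
  have : h * x <= h * (x ^+ 2 + x + 1) by rewrite ler_wpM2l ?(ltW h0)//; lra.
  by move: hx2; clear; lra.
have q2 : h ^+ 2 * x ^+ 2 < eta.
  have : h ^+ 2 * x ^+ 2 <= h * x ^+ 2 by rewrite ler_wpM2r.
  have : h * x ^+ 2 <= h * (x ^+ 2 + x + 1) by rewrite ler_wpM2l ?(ltW h0)//; lra.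
  by move: hxe; clear; lra.
have y0 : 0 < y by rewrite divr_gt0.
have hE : h ^+ 2 = 12 * y by rewrite /y; field.
rewrite hE in q1 q2 *.
have Ea : h ^+ 2 * (c - eta) / 12 = y * (c - eta) by rewrite /y; ring.
have Eb : h ^+ 2 * x / 12 = y * x by rewrite /y; ring.
rewrite Ea in Ha; rewrite Eb in Hb.
have yx0 : 0 < y * x by exact: mulr_gt0.
have yc0 : 0 <= y * (c - eta) by rewrite mulr_ge0// ltW.
have ycx : y * (c - eta) <= y * x by rewrite ler_wpM2l ?(ltW y0)// /x; lra.
have ye0 : 0 < y * eta by exact: mulr_gt0.
have ye1 : y * eta <= y * e by rewrite ler_wpM2l// ltW.
have yxE : y * x = y * c + y * eta by rewrite /x; ring.
have lower : 1 + y * (c - eta) <= m * M.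
  apply: (@le_trans _ _ (m * (m * (1 - y * (c - eta)))^-1)); last by rewrite ler_wpM2l// ltW.
  have d0 : 0 < 1 - y * (c - eta) by move: q1 ycx; clear -yx0; lra.
  rewrite [leRHS](_ : _ = (1 - y * (c - eta))^-1); last by field; rewrite !gt_eqF.
  rewrite -[leRHS]mul1r ler_pdivlMr// -subr_ge0 (_ : _ - _ = (y * (c - eta)) ^+ 2); last by ring.
  exact: sqr_ge0.
have upper : m * M <= 1 + y * x + y * eta.
  apply: (@le_trans _ _ (m * (m * (1 - y * x))^-1)); first by rewrite ler_wpM2l// ltW.
  have d0 : 0 < 1 - y * x by move: q1 ; clear -yx0; lra.
  rewrite [leLHS](_ : _ = (1 - y * x)^-1); last by field; rewrite !gt_eqF.
  rewrite -[leLHS]mul1r ler_pdivrMr//.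
  have p1 : y * x * (y * eta) <= 1 / 12 * (y * eta) by rewrite ler_wpM2r ?(ltW ye0)//; lra.
  have p2 : y * (12 * y * x ^+ 2) <= y * eta by rewrite ler_wpM2l ?(ltW y0)// ltW.
  rewrite -subr_ge0 (_ : _ - _ = y * eta - y * x * (y * eta) - 1 / 12 * (y * (12 * y * x ^+ 2))); last by field.
  by move: p1 p2 ye0; clear; lra.
rewrite ler_norml -/c (mulrC c).
have lc : y * (c - eta) = y * c - y * eta by ring.
rewrite mulrCA [e * y]mulrC.
by apply/andP; split; move: lower upper; rewrite ?lc yxE; move: ye0 ye1; clear; lra.
Qed.
End Zeros.

(** * The asymptotic expansion *)

Section Scale.
Variable R : realType.
Lemma powRX3 (a : R) (r : R) : 0 < a -> (a `^ r) ^+ 3 = a `^ (3 * r).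
Proof. by move=> a0; rewrite -powR_mulrn ?powR_ge0// -powRrM mulrC. Qed.

(** The step h is (24 / n)^(1/3) = 2 3^(1/3) n^(-1/3). *)
Lemma scale_spec (n : R) : 0 < n -> exists2 h : R, 0 < h &
  n * h ^+ 3 = 24 /\ h ^+ 2 / 12 = n `^ (- (2 / 3)) / 3 `^ (1 / 3).
Proof.
move=> n0.
pose u : R := n `^ (- (1 / 3)); pose v : R := 3 `^ (1 / 3).
have u0 : 0 < u by exact: powR_gt0.
have v0 : 0 < v by exact: powR_gt0.
have uu : u ^+ 3 = n^-1.
  by rewrite powRX3// (_ : 3 * _ = -1); [rewrite powR_inv1// ltW | field].
have vv : v ^+ 3 = 3.
  by rewrite powRX3// (_ : 3 * _ = 1); [rewrite powRr1 | field].
have u2 : n `^ (- (2 / 3)) = u ^+ 2.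
  by rewrite -powR_mulrn ?powR_ge0// -powRrM; congr powR; field.
exists (2 * v * u); first by rewrite !mulr_gt0.
rewrite u2 -/v; split.
  by rewrite !exprMn uu vv; field; rewrite gt_eqF.
have -> : (2 * v * u) ^+ 2 / 12 = u ^+ 2 * v ^+ 3 / (3 * v) by field; rewrite gt_eqF.
by rewrite vv; field; rewrite gt_eqF.
Qed.
End Scale.

Theorem theorem2 (R : realType) (i : nat -> R)
    (hi : lists_positive_zeros (@airyA R) i)
    (nu : R) (hnu : 0 < nu) (j : nat) (hj : (0 < j)%N) :
  exists2 e : nat -> R,
    e =o_\oo (fun n : nat => n%:R `^ (- (2 / 3)))
  & \forall n \near \oo,
      mu j n nu =
      1 / (4 * n%:R ^+ 2) *
      (1 + i j / 3 `^ (1 / 3) * n%:R `^ (- (2 / 3)) + e n).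
Proof.
exists (fun n => 4 * n%:R ^+ 2 * mu j n nu - 1 - i j / 3 `^ (1 / 3) * n%:R `^ (- (2 / 3))); last first.
  near=> n; have n0 : 0 < n%:R :> R by rewrite ltr0n; near: n; exact: nbhs_infty_gt.
  rewrite /=; set M := mu _ _ _; set a := _ * _ `^ _; clearbody M a.
  by field; rewrite gt_eqF.
apply/eqoP => eps eps0.
have c0 : 0 < 3 `^ (1 / 3) :> R by exact: powR_gt0.
have e0 : 0 < eps * 3 `^ (1 / 3) / 12 by rewrite divr_gt0 ?mulr_gt0.
have [h1 h10 H] := eigenvalue_asymptotics hi j.-1 hnu e0.
near=> n.
have n0 : 0 < n%:R :> R by rewrite ltr0n; near: n; exact: nbhs_infty_gt.
have nE : n.-1.+1 = n by rewrite prednK// -(ltr0n R).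
have [h h0 [hn h2]] := scale_spec n0.
have hh1 : h < h1.
  rewrite ltNge; apply/negP => h1h.
  have : n%:R * h1 ^+ 3 <= 24 by rewrite -hn ler_pM2l// ler_pXn2r// nnegrE ltW.
  rewrite -ler_pdivlMr ?exprn_gt0// leNgt => /negP; apply.
  by near: n; exact: nbhs_infty_gtr.
have := H n.-1 h (introT andP (conj h0 hh1)); rewrite nE => /(_ hn).
rewrite prednK// h2 /mu (mulrA (i j)) (mulrAC (i j)).
have -> : eps * 3 `^ (1 / 3) / 12 * h ^+ 2 = eps * n%:R `^ (- (2 / 3)).
  have -> : h ^+ 2 = 12 * (h ^+ 2 / 12) by field.
  by rewrite h2; field; rewrite gt_eqF.
by rewrite (ger0_norm (powR_ge0 _ _)).
Unshelve. all: end_near. Qed.
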